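(* Let $d\ge 1$ be an integer and $\lambda\in(0,1]$. There exists a constant $\alpha=\alpha(d,\lambda)>0$ such that, for every $R\ge\sqrt{2d}$, there exists a constant $C=C(d,\lambda,R)\ge 1$ such that, for all $n$ sufficiently large, $$\frac{1}{C n^{\alpha}}\;\le\;\sup_{\mathbb{P}\in\mathfrak{M}_{d,\lambda,R}}\mathbb{P}\big[\,|M_n|\le\sqrt{d}\,R\,\big]\;\le\;\frac{C}{n^{\alpha}} .$$ Here $\mathfrak{M}_{d,\lambda,R}$ is the collection of laws of discrete-time $\mathbb{R}^d$-valued martingales $M_n=\sum_{i=1}^n\Delta_i$ (with $M_0=0$) satisfying, for every $i\ge1$, almost surely, $$|\Delta_i|\le R$$ and $$\lambda\le\inf_{v\in\mathbb{R}^d,|v|=1}\mathbb{E}\Big[\tfrac12(\Delta_i\cdot v)^2\,\Big|\,\mathcal{F}_{i-1}\Big]\le\sup_{v\in\mathbb{R}^d,|v|=1}\mathbb{E}\Big[\tfrac12(\Delta_i\cdot v)^2\,\Big|\,\mathcal{F}_{i-1}\Big]\le 1 .$$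
   Context: $|\cdot|$ is the Euclidean norm on $\mathbb{R}^d$. Martingales are taken with respect to their natural filtration: $\mathcal{F}_n=\sigma(\Delta_1,\dots,\Delta_n)$, with $\mathcal{F}_0$ trivial, and $\mathbb{E}[\Delta_i\mid\mathcal{F}_{i-1}]=0$ almost surely. A law $\mathbb{P}\in\mathfrak{M}_{d,\lambda,R}$ is a Borel probability measure on the space of sequences $(\Delta_i)_{i\ge1}$ of vectors of $\mathbb{R}^d$ of norm at most $R$, with $(\Delta_i)$ the canonical process. The exponent $\alpha$ depends only on $d$ and $\lambda$ (not on $R$). *)

(* Defs.v *)
From HB Require Import structures.
From mathcomp Require Import all_boot all_order all_algebra.
From mathcomp Require Import all_classical all_reals all_analysis.

Set Implicit Arguments.
Unset Strict Implicit.
Unset Printing Implicit Defensive.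

Import Order.TTheory GRing.Theory Num.Theory.
Import numFieldNormedType.Exports.

Local Open Scope classical_set_scope.
Local Open Scope ring_scope.

Definition dotv (R : realType) (d : nat) (u v : 'rV[R]_d) : R :=
  \sum_(k < d) u 0 k * v 0 k.

(* The library's norm on matrices is the max norm, hence this definition. *)
Definition enorm (R : realType) (d : nat) (u : 'rV[R]_d) : R :=
  Num.sqrt (dotv u u).

(* R^d with its Borel sigma-algebra. *)
Notation borel_rV R d := (g_sigma_algebraType (@open 'rV[R]_d)).

(* The increment Delta_(i+1) of the canonical process: indices start at 0. *)
Definition incr (R : realType) (d : nat) (i : nat) (w : nat -> 'rV[R]_d) :
  borel_rV R d := w i.

Definition cylinders (R : realType) (d : nat) : set (set (nat -> 'rV[R]_d)) :=
  \bigcup_i preimage_set_system setT (@incr R d i) measurable.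

(* The space of sequences of vectors of R^d with the product of the Borel
   sigma-algebras; as R^d is second countable, this is also the Borel
   sigma-algebra of the product topology. *)
Notation seq_space R d := (g_sigma_algebraType (@cylinders R d)).

(* F_n = sigma(Delta_1, ..., Delta_n); F_0 is trivial. *)
Definition natural_filtration (R : realType) (d n : nat) :
  set (set (seq_space R d)) := g_sigma_preimage (fun i : 'I_n => @incr R d i).

(* M_n = Delta_1 + ... + Delta_n *)
Definition partial_sum (R : realType) (d n : nat) (w : seq_space R d) :
  'rV[R]_d := \sum_(i < n) w i.

(* Y is a version of E[f | G], for a sub-sigma-algebra G. *)
Definition cond_exp (R : realType) (disp : measure_display)
    (T : measurableType disp) (P : probability T R) (G : set (set T))
    (f Y : T -> R) : Prop :=
  [/\ P.-integrable setT (EFin \o f),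
      P.-integrable setT (EFin \o Y),
      (forall B : set R, measurable B -> G (Y @^-1` B)) &
      forall A : set T, G A ->
        (\int[P]_(x in A) (Y x)%:E = \int[P]_(x in A) (f x)%:E)%E].

(* For each unit vector v, E[(Delta_(i+1).v)^2 / 2 | F_i] is only defined up to
   a null set, so the infimum and supremum over the uncountable sphere require
   a choice of versions.  They are taken over versions Y v w that are continuous
   in v; such a family always exists for bounded increments (it is the quadratic
   form of the conditional second moment matrix) and is unique up to a single
   null set. *)
Definition ellipticity (R : realType) (d : nat) (lambda : R)
    (P : probability (seq_space R d) R) (i : nat) : Prop :=
  exists Y : 'rV[R]_d -> seq_space R d -> R,
    [/\ (forall v, cond_exp P (natural_filtration i)
                     (fun w => 2^-1 * dotv (w i) v ^+ 2) (Y v)),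
        (forall w, continuous (fun v => Y v w)) &
        {ae P, forall w,
          (lambda%:E <= ereal_inf [set (Y v w)%:E | v in [set v | enorm v = 1%R]]
           /\
           ereal_sup [set (Y v w)%:E | v in [set v | enorm v = 1%R]] <= 1)%E}].

(* The collection of laws denoted by a fraktur M with indices d, lambda, R; the
   bound R is called rho here.  Conditional expectations of vectors are taken
   coordinatewise, and E[. | F_i] = 0 a.s. means that 0 is a version. *)
Definition martingale_laws (R : realType) (d : nat) (lambda rho : R) :
  set (probability (seq_space R d) R) :=
  [set P | forall i : nat,
    [/\ (forall k : 'I_d, cond_exp P (natural_filtration i)
                            (fun w => w i 0 k) (cst 0)),
        {ae P, forall w, enorm (w i) <= rho} &
        ellipticity lambda P i]].
Arguments martingale_laws {R} d lambda rho.

(* Main.v *)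
(* The optimal probability of being near the origin solves a parabolic equation
   of Pucci type, and the exponent comes from its self-similar solution
   [t^(-alpha) f(|x|^2 / t)], where [f > 0] is nonincreasing and
     [alpha f + s f' + 2 lambda (d-1) f' + max (z, lambda z) = 0],
     [z = 2 f' + 4 s f''].
   Near [s = 0] the function [f] is a Kummer power series; further out the
   logarithmic derivative [Q = - f'/f] solves a Riccati equation.  For large [s]
   the solution is pushed up above [Q = 1/2] and down below [Q = 1/8]; both
   escapes are open conditions on [alpha], small [alpha] escapes downwards and
   large [alpha] upwards, so some [alpha] does neither, and then [f] decays
   exponentially.

   Adding a correction [+- B t^(-alpha-1/2) (1 + |x|^2/t)^(-m)], which absorbs the
   Taylor errors, turns this solution into super- and subsolutions [V] of the
   discrete one-step problem.  For the upper bound [V (t0 + n - i) (|M_i|^2)] is a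
   supermartingale; the conditional estimate is obtained
   by discretizing [M_i] into cells that belong to the natural filtration.  For
   the lower bound a law is built from the base-[2d] digits of a uniform random
   variable: the digit chooses a vector [+- sqrt (2d) S e_k] with
   [S^2 = lambda I + (a - lambda) x x^T / |x|^2], where [a] is the optimizer of
   the equation, except for a bounded number of final steps that steer the
   walk into the ball with probability bounded below. *)

Require Import Defs.
From HB Require Import structures.
From mathcomp Require Import all_boot all_order all_algebra.
From mathcomp Require Import all_classical all_reals all_analysis.
From mathcomp Require Import measurable_realfun.
From mathcomp Require Import ring lra.

Set Implicit Arguments.
Unset Strict Implicit.
Unset Printing Implicit Defensive.

Import Order.TTheory GRing.Theory Num.Theory.
Import numFieldNormedType.Exports.

Local Open Scope classical_set_scope.
Local Open Scope ring_scope.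

(** * Calculus *)

Section calculus.
Context {R : realType}.
Implicit Types (f g df dg : R -> R) (a b : R).

(** For a function f of s = |x|^2 the Hessian has the tangential eigenvalue 2 f' <= 0, so staying
    near the origin calls for the least tangential variance lambda, while the radial variance is
    lambda or 1 according to the sign of z. This switch makes the equation nonlinear and leaves no
    closed formula for alpha. Fast decay of f is essential: the weight (1 + s)^(-m) must dominate f
    at infinity, so that the subsolution is negative outside a ball, and it must also bound the
    Taylor remainders of f. The order of the correction is forced: bounded steps leave a cubic
    remainder of order t^(-alpha-3/2), which is the order of the time derivative of t^(-alpha-1/2).
    For bounded s the correction alone may have the wrong sign in the equation; a relative change of
    order t^(-1/2) in the amplitude of f repairs this. The profile depends on d and lambda alone. R
    enters only through the size of these perturbations and through the initial time, and so alpha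
    does not depend on it. *)

Lemma is_derive_continuous f (x y : R) : is_derive x 1 f y -> {for x, continuous f}.
Proof.
by move=> h; apply: differentiable_continuous; apply/derivable1_diffP.
Qed.

Lemma derive_nondecreasing f df a b : a <= b ->
  (forall x : R, a <= x <= b -> is_derive x 1 f (df x)) ->
  (forall x, a <= x <= b -> 0 <= df x) -> f a <= f b.
Proof.
move=> ab fd d0.
have [c cab e] : exists2 c, c \in `[a, b]%R & f b - f a = df c * (b - a).
  apply: MVT_segment => //.
    by move=> x; rewrite in_itv/= => /andP[? ?]; apply: fd; rewrite !ltW.
  apply: continuous_in_subspaceT => x; rewrite inE/= in_itv/= => xab.
  exact: is_derive_continuous (fd _ xab).
by rewrite -subr_ge0 e mulr_ge0 ?subr_ge0// d0// -(itvP cab).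
Qed.

Lemma derive_norm_le f df g dg a b : a <= b ->
  (forall x : R, a <= x <= b -> is_derive x 1 f (df x)) ->
  (forall x : R, a <= x <= b -> is_derive x 1 g (dg x)) ->
  (forall x, a <= x <= b -> `|df x| <= dg x) -> `|f b - f a| <= g b - g a.
Proof.
move=> ab fd gd h; rewrite ler_norml; apply/andP; split.
- have : (f + g) a <= (f + g) b.
    apply: (@derive_nondecreasing _ (df + dg)) => // x xab.
      by apply: is_deriveD; [exact: fd|exact: gd].
    by have := h _ xab; rewrite ler_norml !fctE => /andP[]; lra.
  by rewrite !fctE; lra.
- have : (g - f) a <= (g - f) b.
    apply: (@derive_nondecreasing _ (dg - df)) => // x xab.
      by apply: is_deriveB; [exact: gd|exact: fd].
    by have := h _ xab; rewrite ler_norml !fctE => /andP[]; lra.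
  by rewrite !fctE; lra.
Qed.

Lemma derive_norm_le_cst f df C a b : a <= b ->
  (forall x : R, a <= x <= b -> is_derive x 1 f (df x)) ->
  (forall x, a <= x <= b -> `|df x| <= C) -> `|f b - f a| <= C * (b - a).
Proof.
move=> ab fd h.
have := @derive_norm_le f df (fun x => C * x) (fun=> C) a b ab fd.
rewrite mulrBr; apply => // x _.
have : is_derive x 1 (C \*: (@id R)) (C *: 1) by apply: is_deriveZ.
by rewrite /GRing.scale/= mulr1.
Qed.

(** At a first zero the difference quotients from the left are negative, against a positive
    derivative. Only the sign of the derivative at zeros matters, so the lemma confines solutions of
    differential equations to one side of a level. *)
Lemma barrier f df a : 0 < f a ->
  (forall x : R, a <= x -> is_derive x 1 f (df x)) ->
  (forall x, a <= x -> f x = 0 -> 0 < df x) ->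
  forall x, a <= x -> 0 < f x.
Proof.
move=> fa fd f0 b ab; rewrite ltNge; apply/negP => fb.
have cf x : a <= x -> {for x, continuous f}.
  by move=> ax; exact: is_derive_continuous (fd _ ax).
pose E := [set x | a <= x /\ f x <= 0].
have E0 : E b by [].
have lE : has_lbound E by exists a => x [].
have hE : has_inf E by split => //; exists b.
set c := inf E.
have ac : a <= c by apply: lb_le_inf; [exists b|move=> x []].
have pos x : a <= x -> x < c -> 0 < f x.
  move=> ax xc; rewrite ltNge; apply/negP => fx.
  have : c <= x by apply: ge_inf.
  by rewrite leNgt xc.
have fc : f c = 0.
  apply/eqP; rewrite eq_le; apply/andP; split; rewrite leNgt; apply/negP => fc.
    have /nbhs_ballP[e /= e0 he] : \forall x \near c, 0 < f x.
      by apply: (cvgr_gt (f c) (cf _ ac)).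
    have [x [ax fx] xe] := inf_adherent e0 hE.
    have : 0 < f x.
      apply: he; rewrite /ball/= distrC ger0_norm ?subr_ge0; last exact: ge_inf.
      by rewrite ltrBlDl.
    by rewrite ltNge fx.
  have ac' : a < c.
    by rewrite lt_neqAle ac andbT; apply: contraTneq fa => ->; rewrite -leNgt ltW.
  have /nbhs_ballP[e /= e0 he] : \forall x \near c, f x < 0.
    by apply: (cvgr_lt (f c) (cf _ ac)).
  pose m := Num.max a (c - e / 2).
  have mc : m < c by rewrite gt_max ac' /= ltrBlDr ltrDl divr_gt0.
  have am : a <= m by rewrite le_max lexx.
  have : f m < 0.
    apply: he; rewrite /ball/= ger0_norm ?subr_ge0 ?ltW// ltrBlDr -ltrBlDl.
    by rewrite lt_max; apply/orP; right; lra.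
  by rewrite ltNge (ltW (pos _ _ _)).
have ac' : a < c.
  by rewrite lt_neqAle ac andbT; apply: contraTneq fa => ->; rewrite fc ltxx.
have dc := f0 c ac fc.
have [dd dv] := fd c ac.
have : (fun h => h^-1 *: ((f \o shift c) (h *: 1) - f c)) @ 0^' --> df c.
  by rewrite -dv; exact: dd.
move/cvgrPdist_lt => /(_ _ dc) [e /= e0 he].
(* A negative increment that stays to the right of [a] and within the radius [e] given by the
   limit. *)
pose h := Num.max ((a - c)/2) (- (e / 2)).
have hneg : h < 0 by rewrite gt_max; apply/andP; split; lra.
have hh : `|h| < e.
  by rewrite ltr0_norm// ltrNl lt_max; apply/orP; right; lra.
have := he h; rewrite /= sub0r normrN => /(_ hh).
rewrite lt_eqF// => /(_ isT).
rewrite fc subr0 /= /GRing.scale/= mulr1.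
have fp : 0 < f (h + c).
  apply: pos; last by lra.
  have : (a - c)/2 <= h by rewrite le_max lexx.
  by lra.
have : h^-1 * f (h + c) < 0 by rewrite pmulr_llt0 ?invr_lt0.
move=> h1; rewrite ltr_norml => /andP[_]; lra.
Qed.

(** The base point -1 makes every s >= 0 an interior point, so that two-sided derivatives are
    available at the origin of the radial variable. *)
Lemma antiderivative_ex f : continuous f ->
  exists F : R -> R, forall x : R, -1 < x -> is_derive x 1 F (f x).
Proof.
move=> cf.
pose F (y : R) := (\int[@lebesgue_measure R]_(t in [set` Interval (BLeft (-1)%R) (BRight y)]) (f t))%R.
exists F => x x1.
have int : (@lebesgue_measure R).-integrable [set` Interval (BLeft (-1)) (BRight (x+1))] (EFin \o f).
  apply: continuous_compact_integrable; first exact: segment_compact.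
  by apply: continuous_subspaceT.
have xx1 : x < x + 1 by rewrite ltrDl.
have [dF F1] := @continuous_FTC1 R f (BLeft (-1)) x (x + 1) xx1 int x1 (cf x).
by apply: (DeriveDef dF); rewrite -F1 derive1E.
Qed.

End calculus.

(** * Power series near the origin *)

Section power_series.
Context {R : realType}.
Implicit Types (c e : nat -> R) (A k s : R).

(** Domination by the Taylor coefficients of [A * expR (k * s)]. Differentiating term by term keeps
    the rate [k] and multiplies [A] by [k], so all derivatives converge everywhere with explicit
    bounds. *)
Definition expb A k c := forall i, `|c i| <= A * (k ^+ i / i`!%:R).

Definition PS c s : R := limn (pseries c s).

Lemma expb_term A k c s i : 0 <= k -> expb A k c ->
  `|c i * s ^+ i| <= A * exp_coeff (k * `|s|) i.
Proof.
move=> k0 h; rewrite normrM normrX /exp_coeff /= exprMn.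
have -> : A * (k ^+ i * `|s| ^+ i / i`!%:R) = A * (k ^+ i / i`!%:R) * `|s| ^+ i.
  by rewrite -!mulrA; congr (_ * (_ * _)); rewrite mulrC.
by rewrite ler_wpM2r ?exprn_ge0 ?h.
Qed.

Lemma is_cvg_expb_series A k s : cvgn (series (fun i => A * exp_coeff (k * s) i)).
Proof.
have -> : (fun i => A * exp_coeff (k * s) i) = A *: exp_coeff (k * s) by [].
by apply: is_cvg_seriesZ; exact: is_cvg_series_exp_coeff.
Qed.

Lemma expb_cvg_norm A k c s : 0 <= k -> expb A k c ->
  cvgn [normed pseries c s].
Proof.
move=> k0 h; apply: (@series_le_cvg _ _ (fun i => A * exp_coeff (k * `|s|) i)).
- by move=> i /=.
- by move=> i; apply: (le_trans (normr_ge0 (c i * s ^+ i))); exact: expb_term.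
- by move=> i; exact: expb_term.
- exact: is_cvg_expb_series.
Qed.

Lemma expb_cvg A k c s : 0 <= k -> expb A k c -> cvgn (pseries c s).
Proof. by move=> k0 h; apply: normed_cvg; exact: expb_cvg_norm h. Qed.

Lemma PS_norm_le A k c s : 0 <= k -> expb A k c ->
  `|PS c s| <= A * expR (k * `|s|).
Proof.
move=> k0 h; have cn := @expb_cvg_norm A k c s k0 h.
apply: le_trans (lim_series_norm cn) _.
have -> : A * expR (k * `|s|) = limn (series (fun i => A * exp_coeff (k * `|s|) i)).
  have -> : (fun i => A * exp_coeff (k * `|s|) i) = A *: exp_coeff (k * `|s|) by [].
  by rewrite lim_seriesZ//; exact: is_cvg_series_exp_coeff.
apply: lim_series_le => //; first exact: is_cvg_expb_series.
by move=> i; exact: expb_term.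
Qed.

Lemma expb_diffs A k c : expb A k c -> expb (A * k) k (pseries_diffs c).
Proof.
move=> h i; rewrite /pseries_diffs normrM ger0_norm//.
apply: le_trans (ler_wpM2l _ (h i.+1)) _ => //.
rewrite exprS factS natrM invfM le_eqVlt; apply/orP; left; apply/eqP.
have f0 : i`!%:R != 0 :> R by rewrite pnatr_eq0 -lt0n fact_gt0.
by field; rewrite f0 /= nat1r pnatr_eq0.
Qed.

Lemma PS_derive A k c s : 0 <= k -> expb A k c ->
  is_derive s 1 (PS c) (PS (pseries_diffs c) s).
Proof.
move=> k0 h; apply: (@pseries_snd_diffs _ _ (`|s| + 1)).
- exact: expb_cvg h.
- exact: expb_cvg (expb_diffs h).
- exact: expb_cvg (expb_diffs (expb_diffs h)).
- by rewrite (@ger0_norm _ (`|s| + 1)) ?addr_ge0// ltrDl.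
Qed.

Lemma cvg_pseries_lin c e a b s x y :
  pseries c s @ \oo --> x -> pseries e s @ \oo --> y ->
  pseries (fun i => a * c i + b * e i) s @ \oo --> a * x + b * y.
Proof.
move=> cx ey.
have -> : pseries (fun i => a * c i + b * e i) s =
  (fun n => a * pseries c s n + b * pseries e s n).
  apply/funext => n; rewrite /pseries /series/= !mulr_sumr -big_split/=.
  by apply: eq_bigr => i _; ring.
by apply: cvgD; (apply: cvgM; first exact: cvg_cst).
Qed.

Lemma cvg_pseries_shift c s x : pseries c s @ \oo --> x ->
  pseries (fun i => if i is j.+1 then c j else 0) s @ \oo --> s * x.
Proof.
move=> cx; rewrite -cvg_shiftS /=.
have -> : (fun n => pseries (fun i => if i is j.+1 then c j else 0) s n.+1) =
   (fun n => s * pseries c s n).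
  apply/funext => n; rewrite /pseries /series/= big_nat_recl//= mul0r add0r mulr_sumr.
  by apply: eq_bigr => i _; rewrite exprS; ring.
by apply: cvgM; [exact: cvg_cst|exact: cx].
Qed.

Lemma PS0 c : PS c 0 = c 0%N.
Proof.
apply: cvg_lim => //; rewrite -cvg_shiftS /=.
have -> : (fun n => pseries c 0 n.+1) = (fun n => c 0%N).
  apply/funext => n; rewrite /pseries /series/= big_nat_recl//= expr0 mulr1.
  by rewrite big1 ?addr0// => i _; rewrite exprS mul0r mulr0.
exact: cvg_cst.
Qed.

End power_series.

(** * Kummer's equation: the profile near the origin *)

Section kummer.
Context {R : realType}.
Variables (lam D a1 : R).
Hypotheses (lam0 : 0 < lam) (D1 : 1 <= D) (a10 : 0 <= a1).

(** Taylor coefficients of Kummer's function M(al, D/2, - s / (4 lam)), the solution regular at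
    [s = 0] of the equation with isotropic diffusion [lam]. *)
Fixpoint kummer_coef (al : R) (k : nat) : R :=
  if k is j.+1 then
    - kummer_coef al j * ((al + j%:R) / ((j.+1)%:R * (4 * lam * j%:R + 2 * lam * D)))
  else 1.

(** The product kap (4 lam j + 2 lam D) = (1 + a1) (2 j + D) is at least [al + j] and at least 1;
    the first fact bounds the coefficients, the second their dependence on [al]. *)
Let kap : R := (1 + a1) / (2 * lam).

Let kap0 : 0 < kap. Proof. by rewrite divr_gt0// ?ltr_wpDr// mulr_gt0. Qed.

Let den0 j : 0 < 4 * lam * j%:R + 2 * lam * D.
Proof.
by rewrite ltr_wpDl ?mulr_gt0 ?mulr_ge0 ?(ltW lam0) ?ler0n//; exact: lt_le_trans D1.
Qed.

Let ratio_le (al : R) j : 0 <= al <= a1 ->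
  `|(al + j%:R) / ((j.+1)%:R * (4 * lam * j%:R + 2 * lam * D))| <= kap / (j.+1)%:R.
Proof.
move=> /andP[al0 al1]; have j0 : 0 <= j%:R :> R by rewrite ler0n.
have j1 : 0 < (j.+1)%:R :> R by rewrite ltr0n.
rewrite ger0_norm; last by rewrite divr_ge0 ?addr_ge0 ?mulr_ge0 ?(ltW (den0 _)).
rewrite invfM mulrCA mulrC ler_pM2r ?invr_gt0// ler_pdivrMr//.
have -> : kap * (4 * lam * j%:R + 2 * lam * D) = (1 + a1) * (2 * j%:R + D).
  by rewrite /kap; field; rewrite gt_eqF.
have h1 : 0 <= a1 * j%:R by rewrite mulr_ge0.
have h2 : 0 <= a1 * (D - 1) by rewrite mulr_ge0 ?subr_ge0.
move: D1 a10; lra.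
Qed.

Lemma kummer_coef_expb (al : R) : 0 <= al <= a1 -> expb 1 kap (kummer_coef al).
Proof.
move=> hal; elim=> [|j IH] /=; first by rewrite normr1 expr0 fact0 divr1 mul1r.
rewrite normrM normrN mul1r.
apply: le_trans (ler_pM _ _ IH (ratio_le j hal)) _ => //.
rewrite mul1r exprSr factS natrM invfM le_eqVlt; apply/orP; left; apply/eqP; ring.
Qed.

Let inv_le j : 1 / ((j.+1)%:R * (4 * lam * j%:R + 2 * lam * D)) <= kap / (j.+1)%:R.
Proof.
have j1 : 0 < (j.+1)%:R :> R by rewrite ltr0n.
have j0 : 0 <= j%:R :> R by rewrite ler0n.
rewrite invfM mulrCA mulrC ler_pM2r ?invr_gt0// ler_pdivrMr//.
have -> : kap * (4 * lam * j%:R + 2 * lam * D) = (1 + a1) * (2 * j%:R + D).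
  by rewrite /kap; field; rewrite gt_eqF.
have h1 : 0 <= a1 * j%:R by rewrite mulr_ge0.
have h2 : 0 <= a1 * (D - 1) by rewrite mulr_ge0 ?subr_ge0.
move: D1 a10; lra.
Qed.

(** In the induction, the error of the previous coefficient and the error of the ratio contribute (2
    kap)^j and kap^j; the doubled rate absorbs their sum. *)
Lemma kummer_coef_lip (al be : R) : 0 <= al <= a1 -> 0 <= be <= a1 ->
  expb `|al - be| (2 * kap) (fun i => kummer_coef al i - kummer_coef be i).
Proof.
move=> hal hbe; elim=> [|j IH] /=.
  by rewrite subrr normr0 expr0 fact0 divr1 mulr1.
set ra := (_ + _) / _; set rb := (be + _) / _.
have -> : - kummer_coef al j * ra - - kummer_coef be j * rb =
   - (kummer_coef al j - kummer_coef be j) * ra - kummer_coef be j * (ra - rb).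
  by ring.
apply: le_trans (ler_normB _ _) _; rewrite (normrM _ ra) (normrM _ (ra - rb)) normrN.
have h1 := ler_pM (normr_ge0 _) (normr_ge0 _) IH (ratio_le j hal).
have rab : `|ra - rb| <= `|al - be| * (kap / (j.+1)%:R).
  have -> : ra - rb = (al - be) * (1 / ((j.+1)%:R * (4 * lam * j%:R + 2 * lam * D))).
    by rewrite /ra /rb; ring.
  rewrite normrM ler_wpM2l// ger0_norm ?inv_le//.
  by rewrite divr_ge0// mulr_ge0// ltW.
have h2 := ler_pM (normr_ge0 _) (normr_ge0 _) (kummer_coef_expb hbe j) rab.
apply: (le_trans (lerD h1 h2)).
have jf : 0 <= (j`!%:R)^-1 :> R by rewrite invr_ge0.
have j1 : 0 <= ((j.+1)%:R)^-1 :> R by rewrite invr_ge0.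
have k2 : kap ^+ j <= (2 * kap) ^+ j.
  by have k0 := kap0; apply: lerXn2r; rewrite ?nnegrE; lra.
rewrite factS natrM invfM exprS.
have -> : `|al - be| * ((2 * kap) ^+ j / j`!%:R) * (kap / j.+1%:R) +
   1 * (kap ^+ j / j`!%:R) * (`|al - be| * (kap / j.+1%:R)) =
   `|al - be| * (j`!%:R)^-1 * (j.+1%:R)^-1 * kap * ((2 * kap) ^+ j + kap ^+ j) by ring.
have -> : `|al - be| * (2 * kap * (2 * kap) ^+ j * ((j.+1%:R)^-1 * (j`!%:R)^-1)) =
   `|al - be| * (j`!%:R)^-1 * (j.+1%:R)^-1 * kap * ((2 * kap) ^+ j + (2 * kap) ^+ j).
  by ring.
have kk := ltW kap0; apply: ler_wpM2l; last by rewrite lerD2l.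
by apply: mulr_ge0 => //; apply: mulr_ge0 => //; apply: mulr_ge0.
Qed.

Let K al := PS (kummer_coef al).
Let K1 al := PS (pseries_diffs (kummer_coef al)).
Let K2 al := PS (pseries_diffs (pseries_diffs (kummer_coef al))).
Let K3 al := PS (pseries_diffs (pseries_diffs (pseries_diffs (kummer_coef al)))).

Lemma kummer_coef_rec (al : R) j :
  (j.+1)%:R * (4 * lam * j%:R + 2 * lam * D) * kummer_coef al j.+1 = - (al + j%:R) * kummer_coef al j.
Proof.
have h := den0 j; rewrite /=.
by field; rewrite gt_eqF//= gt_eqF// nat1r ltr0n.
Qed.

(** The left side is a power series whose coefficients vanish one by one, by the recurrence that
    defines [kummer_coef]. *)
Lemma kummer_ode (al s : R) : 0 <= al <= a1 ->
  4 * lam * s * K2 al s + (2 * lam * D + s) * K1 al s + al * K al s = 0.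
Proof.
move=> hal; have e0 := kummer_coef_expb hal.
have e1 := expb_diffs e0; have e2 := expb_diffs e1.
have k0 := ltW kap0.
pose c := kummer_coef al.
have c0 : pseries c s @ \oo --> K al s := expb_cvg k0 e0.
have c1 : pseries (pseries_diffs c) s @ \oo --> K1 al s := expb_cvg k0 e1.
have c2 : pseries (pseries_diffs (pseries_diffs c)) s @ \oo --> K2 al s := expb_cvg k0 e2.
have := @cvg_pseries_lin R _ _ (4 * lam) 1 s _ _ (cvg_pseries_shift c2)
  (@cvg_pseries_lin R _ _ 1 1 s _ _ (cvg_pseries_shift c1)
    (@cvg_pseries_lin R _ _ (2 * lam * D) al s _ _ c1 c0)).
set e := (X in pseries X); have -> : e = fun=> 0.
  apply/funext => i; rewrite /e /pseries_diffs; case: i => [|i].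
    have := kummer_coef_rec al 0; rewrite -/c => h; lra.
  by have := kummer_coef_rec al i.+1; rewrite -/c -!natr1 => h; lra.
have -> : pseries (fun=> 0) s = cst 0.
  by apply/funext => n; rewrite /pseries /series/= big1// => i _; rewrite mul0r.
move=> h; have := cvg_lim (@norm_hausdorff _ _) h; rewrite lim_cst//.
by rewrite /= => /(_ _) e0'; lra.
Qed.

(** All bounds are uniform for [al] in [[0, a1]], since the matching point has to be chosen before
    [al]. The Lipschitz dependence on [al] feeds the continuity argument of the shooting. *)
Lemma kummer_solution : exists (C : R) (K K1 K2 K3 : R -> R -> R),
  [/\ 0 < C,
      forall al s : R, 0 <= al <= a1 ->
        [/\ is_derive s 1 (K al) (K1 al s), is_derive s 1 (K1 al) (K2 al s),
            is_derive s 1 (K2 al) (K3 al s) &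
            4 * lam * s * K2 al s + (2 * lam * D + s) * K1 al s + al * K al s = 0],
      forall al s : R, 0 <= al <= a1 -> 0 <= s <= 1 ->
        [/\ `|K al s - 1| <= C * s, `|K1 al s + al / (2 * lam * D)| <= C * s,
            `|K2 al s| <= C & `|K3 al s| <= C] &
      forall al be s : R, 0 <= al <= a1 -> 0 <= be <= a1 -> 0 <= s <= 1 ->
        `|K al s - K be s| <= C * `|al - be| /\ `|K1 al s - K1 be s| <= C * `|al - be| ].
Proof.
(* Up to three differentiations multiply the constant by powers of [kap], and the rate is at most
   [2 * kap]; this one constant covers all cases on [[0, 1]]. *)
pose C := (1 + 2 * kap) ^+ 3 * expR (2 * kap).
have k0 := kap0; have k0' := ltW k0.
have E1 : expR kap <= expR (2 * kap) by rewrite ler_expR; lra.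
have Ep := expR_gt0 (2 * kap).
have kk2 : 0 <= kap * kap by apply: mulr_ge0.
have kk3 : 0 <= kap * kap * kap by apply: mulr_ge0.
have cube : (1 + 2 * kap) ^+ 3 = 1 + 6 * kap + 12 * (kap * kap) + 8 * (kap * kap * kap) by ring.
have bd (k : R) c (B s : R) : 0 <= k -> k <= 2 * kap -> expb B k c -> 0 <= B -> 0 <= s <= 1 -> 
    B <= (1 + 2 * kap) ^+ 3 -> `|PS c s| <= C.
  move=> kk kle hc B0 /andP[s0 s1] Ble; have h := @PS_norm_le R B k c s kk hc; apply: (le_trans h).
  apply: ler_pM => //; rewrite ?expR_ge0//.
  by rewrite ler_expR ger0_norm//; nra.
exists C, K, K1, K2, K3.
have dv (al s : R) : 0 <= al <= a1 -> [/\ is_derive s 1 (K al) (K1 al s),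
  is_derive s 1 (K1 al) (K2 al s) & is_derive s 1 (K2 al) (K3 al s)].
  move=> hal; have e0 := kummer_coef_expb hal; have e1 := expb_diffs e0.
  have e2 := expb_diffs e1.
  by split; [exact: PS_derive e0|exact: PS_derive e1|exact: PS_derive e2].
have b1 (al s : R) : 0 <= al <= a1 -> 0 <= s <= 1 ->
   [/\ `|K1 al s| <= C, `|K2 al s| <= C & `|K3 al s| <= C].
  move=> hal hs; have e0 := kummer_coef_expb hal; have e1 := expb_diffs e0.
  have e2 := expb_diffs e1; have e3 := expb_diffs e2.
  split; [apply: bd e1 _ hs _|apply: bd e2 _ hs _|apply: bd e3 _ hs _] => //;
  rewrite ?cube; lra.
split.
- by rewrite mulr_gt0// exprn_gt0//; lra.
- by move=> al s hal; have [] := dv al s hal; split => //; exact: kummer_ode.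
- move=> al s hal hs; have [? ? ?] := b1 al s hal hs; split => //.
    have /andP[s0 s1] := hs.
    have := @derive_norm_le_cst R (K al) (K1 al) C 0 s s0; rewrite subr0.
    have -> : K al 0 = 1 by rewrite /K PS0.
    apply => x /andP[x0 xs]; first by have [] := dv al x hal.
    by have [|] := b1 al x hal => //; rewrite x0 (le_trans xs).
  have /andP[s0 s1] := hs.
  have := @derive_norm_le_cst R (K1 al) (K2 al) C 0 s s0; rewrite subr0.
  have -> : K1 al 0 = - (al / (2 * lam * D)).
    have D0 : D != 0 by rewrite gt_eqF//; exact: lt_le_trans D1.
    have l0 : lam != 0 by rewrite gt_eqF.
    by rewrite /K1 PS0 /pseries_diffs /= mul1r; field; rewrite ?D0 ?l0.
  rewrite opprK; apply => x /andP[x0 xs]; first by have [] := dv al x hal.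
  by have [|] := b1 al x hal => //; rewrite x0 (le_trans xs).
- move=> al be s hal hbe /andP[s0 s1].
  have e := kummer_coef_lip hal hbe; have e' := expb_diffs e.
  have k2 : 0 <= 2 * kap by lra.
  have fin c c' (B B' k k' M : R) : 0 <= k -> 0 <= k' -> 0 <= M -> M <= (1 + 2 * kap) ^+ 3 ->
      expb B k c -> expb B' k' c' -> 
      expb (`|al - be| * M) (2 * kap) (fun i => c i - c' i) ->
      `|PS c s - PS c' s| <= C * `|al - be|.
    move=> kk kk' M0 Mle hc hc' hcc.
    have -> : PS c s - PS c' s = PS (fun i => c i - c' i) s.
      apply/esym/cvg_lim => //.
      have := @cvg_pseries_lin R c c' 1 (-1) s _ _ (expb_cvg kk hc) (expb_cvg kk' hc').
      rewrite mul1r mulN1r.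
      by under [X in pseries X]eq_fun do rewrite mul1r mulN1r.
    have h := @PS_norm_le R _ _ _ s k2 hcc; apply: (le_trans h).
    rewrite (mulrC C) -(mulrA _ M) ler_wpM2l//.
    apply: ler_pM => //; rewrite ?expR_ge0//.
    by rewrite ler_expR ger0_norm//; nra.
  have ea := kummer_coef_expb hal; have eb := kummer_coef_expb hbe.
  split.
    apply: (fin _ _ _ _ _ _ 1 _ _ _ _ ea eb) => //; rewrite ?mulr1//.
    by rewrite cube; lra.
  apply: (fin _ _ _ _ _ _ (2 * kap) _ _ _ _ (expb_diffs ea) (expb_diffs eb)) => //.
    by rewrite cube; lra.
  have -> : (fun i => pseries_diffs (kummer_coef al) i - pseries_diffs (kummer_coef be) i) =
    pseries_diffs (fun i => kummer_coef al i - kummer_coef be i).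
    by apply/funext => i; rewrite /pseries_diffs; ring.
  exact: e'.
Qed.

End kummer.

(** * Integral equations *)

Section picard.
Context {R : realType}.

(** The intervals of radius 2 E / 2^k around [u k] are nested, so the supremum of their left ends
    lies in all of them; the rate of convergence comes for free. *)
Lemma geometric_limit (u : nat -> R) (E : R) :
  (forall k, `|u k.+1 - u k| <= E / 2 ^+ k) ->
  exists l, forall k, `|u k - l| <= 2 * E / 2 ^+ k.
Proof.
move=> h.
pose a k := u k - 2 * E / 2 ^+ k; pose b k := u k + 2 * E / 2 ^+ k.
have stp k : 2 * E / 2 ^+ k.+1 = E / 2 ^+ k.
  by rewrite exprS; field; rewrite expf_neq0.
have am : {homo a : m n / (m <= n)%N >-> m <= n}.
  apply: homo_leq => [x//|y x z|k]; first exact: le_trans.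
  by have := h k; rewrite /a stp ler_norml -mulrA => /andP[]; lra.
have bm : {homo b : m n / (m <= n)%N >-> n <= m}.
  apply: homo_leq => [x//|y x z xy yz|k]; first exact: le_trans yz xy.
  by have := h k; rewrite /b stp ler_norml -mulrA => /andP[]; lra.
have E0 k : 0 <= E / 2 ^+ k by apply: le_trans (normr_ge0 _) (h k).
have ab m n : a m <= b n.
  have h1 := am m (maxn m n) (leq_maxl _ _).
  have h2 := bm n (maxn m n) (leq_maxr _ _).
  apply: le_trans h1 _; apply: le_trans h2; have := E0 (maxn m n).
  by rewrite /a /b -mulrA; lra.
exists (sup (range a)) => k.
have h1 : a k <= sup (range a).
  by apply: ub_le_sup; [exists (b 0%N) => _ [m _ <-]|exists k].
have h2 : sup (range a) <= b k.
  by apply: ge_sup; [exists (a 0%N); exists 0%N|move=> _ [m _ <-]].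
by rewrite ler_norml; move: h1 h2; rewrite /a /b; lra.
Qed.

(** A chosen primitive; the default [0] is taken only if there is none, which does not happen for
    continuous [f]. *)
Definition prim (f : R -> R) : R -> R :=
  xget 0 [set F : R -> R | forall x : R, -1 < x -> is_derive x 1 F (f x)].

Lemma prim_derive (f : R -> R) (x : R) :
  continuous f -> -1 < x -> is_derive x 1 (prim f) (f x).
Proof.
move=> /antiderivative_ex[F hF].
by rewrite /prim; case: xgetP => [P -> h|/(_ F)]; [exact: h|move/(_ hF)].
Qed.

Lemma lipschitz_continuous (f : R -> R) (B : R) :
  (forall x y, `|f x - f y| <= B * `|x - y|) -> continuous f.
Proof.
move=> h x.
have B0 : 0 <= B.
  by have := h 1 0; rewrite subr0 normr1 mulr1; apply: le_trans.
have B1 : 0 < B + 1 by lra.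
apply/cvgrPdist_lt => e e0.
have e1 : 0 < e / (B + 1) by rewrite divr_gt0.
apply: filterS (nbhsx_ballx x _ e1) => y; rewrite /ball/= ltr_pdivlMr// => h1.
by apply: le_lt_trans (h x y) _; have := normr_ge0 (x - y); nra.
Qed.

Lemma max_lip (a x y : R) : `|Num.max x a - Num.max y a| <= `|x - y|.
Proof.
by rewrite ler_norml; case: (leP x a); case: (leP y a);
  have := ler_norm (x - y); have := ler_norm (y - x); rewrite (distrC y); lra.
Qed.

Lemma is_derive_expR_affine (L a x : R) :
  is_derive x 1 (fun x => expR (L * (x - a))) (L * expR (L * (x - a))).
Proof.
have h : is_derive x 1 (fun x => L * (x - a)) L.
  have : is_derive x 1 (L \*: (id - cst a : R -> R)) (L *: (1 - 0)).
    by apply: is_deriveZ; apply: is_deriveB.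
  by rewrite subr0 /GRing.scale/= mulr1.
have := @is_derive1_comp R expR (fun x => L * (x - a)) x _ _ (is_derive_expR _) h.
by rewrite mulrC.
Qed.

(** Picard iteration on a whole half-line at once: for the weight exp (2 L (s - s1)) the integral
    operator contracts by 1/2. Boundedness of [H] makes all iterates Lipschitz with the constant
    [B], so that the limit is continuous. *)
Lemma picard (H : R -> R -> R) (s1 c L B : R) : -1 < s1 -> 0 < L -> 0 <= B ->
  (forall u : R -> R, continuous u -> continuous (fun s => H s (u s))) ->
  (forall s x, `|H s x| <= B) ->
  (forall s x y, `|H s x - H s y| <= L * `|x - y|) ->
  exists u : R -> R, u s1 = c /\
    forall s : R, s1 <= s -> is_derive s 1 u (H s (u s)).
Proof.
move=> s11 L0 B0 Hc HB HL.
pose P (v : R -> R) := prim (fun s => H s (v s)).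
(* [Num.max s s1] freezes the iterates to the left of [s1]; they are then continuous on the whole
   line, as [prim] requires. *)
pose T (v : R -> R) s := c + (P v (Num.max s s1) - P v s1).
pose v k := iter k T (cst c).
have dP w : continuous w -> forall x, s1 <= x -> is_derive x 1 (P w) (H x (w x)).
  by move=> cw x sx; apply: (@prim_derive (fun s => H s (w s))); [exact: Hc|lra].
have lipT w : continuous w -> forall x y, `|T w x - T w y| <= B * `|x - y|.
  move=> cw x y; rewrite /T.
  have -> : c + (P w (Num.max x s1) - P w s1) - (c + (P w (Num.max y s1) - P w s1)) =
    P w (Num.max x s1) - P w (Num.max y s1) by ring.
  apply: (@le_trans _ _ (B * `|Num.max x s1 - Num.max y s1|)); last first.
    by rewrite ler_wpM2l// max_lip.
  wlog xy : x y / Num.max y s1 <= Num.max x s1.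
    move=> wl; have [|] := leP (Num.max y s1) (Num.max x s1); first exact: wl.
    by move=> /ltW/wl; rewrite distrC [in X in _ <= X]distrC.
  rewrite (ger0_norm (_ : 0 <= Num.max x s1 - Num.max y s1)) ?subr_ge0//.
  apply: (@derive_norm_le_cst _ _ (fun x => H x (w x))) => // z /andP[z1 z2].
  apply: dP => //; apply: le_trans z1; by rewrite le_max lexx orbT.
have cv k : continuous (v k).
  elim: k => [|k IH]; first exact: cst_continuous.
  by apply: (@lipschitz_continuous _ B); exact: lipT.
have lipv k x y : `|v k x - v k y| <= B * `|x - y|.
  case: k => [|k]; first by rewrite /v/= subrr normr0 mulr_ge0.
  exact: lipT.
pose E s := B / (2 * L) * expR (2 * L * (Num.max s s1 - s1)).
have BL : 0 <= B / (2 * L) by rewrite divr_ge0// mulr_ge0// ltW.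
have L2 : 0 < 2 * L by lra.
have stp k s : `|v k.+1 s - v k s| <= E s / 2 ^+ k.
  elim: k s => [|k IH] s.
    rewrite expr0 divr1 /= /T /=.
    have sm : s1 <= Num.max s s1 by rewrite le_max lexx orbT.
    have -> : c + (P (cst c) (Num.max s s1) - P (cst c) s1) - c =
      P (cst c) (Num.max s s1) - P (cst c) s1 by ring.
    have := @derive_norm_le_cst R (P (cst c)) (fun x => H x c) B s1 (Num.max s s1) sm.
    move=> /(_ _ _)/le_trans; apply.
    - by move=> x /andP[x1 _]; apply: dP => //; exact: cst_continuous.
    - by move=> x _.
    - set m := _ - s1; have m0 : 0 <= m by rewrite subr_ge0.
      have := expR_ge1Dx (2 * L * m).
      have -> : B * m = B / (2 * L) * (2 * L * m) by field; rewrite gt_eqF.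
      by move=> h; rewrite ler_wpM2l//; lra.
  have sm : s1 <= Num.max s s1 by rewrite le_max lexx orbT.
  set m := Num.max s s1 in sm *.
  have vT j : v j.+1 s = c + (P (v j) m - P (v j) s1) by [].
  rewrite [v k.+2 s]vT [v k.+1 s]vT.
  have -> : c + (P (v k.+1) m - P (v k.+1) s1) - (c + (P (v k) m - P (v k) s1)) =
    (P (v k.+1) - P (v k)) m - (P (v k.+1) - P (v k)) s1 by rewrite !fctE; ring.
  pose g x := B / (2 * L) / 2 ^+ k.+1 * expR (2 * L * (x - s1)).
  apply: (@le_trans _ _ (g m - g s1)).
    pose dg x := B / (2 * L) / 2 ^+ k.+1 * (2 * L * expR (2 * L * (x - s1))).
    apply: (@derive_norm_le _ _ (fun x => H x (v k.+1 x) - H x (v k x)) g dg) => //.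
    - by move=> x /andP[x1 x2]; apply: is_deriveB; exact: dP.
    - move=> x _; apply: is_deriveZ; exact: is_derive_expR_affine.
    - move=> x /andP[x1 x2]; apply: le_trans (HL _ _ _) _.
      apply: le_trans (ler_wpM2l (ltW L0) (IH x)) _.
      rewrite /dg /E max_l// exprS le_eqVlt; apply/orP; left; apply/eqP; field.
      by rewrite expf_neq0//= gt_eqF.
  rewrite /g /E -/m subrr mulr0 expR0 mulr1.
  have : 0 <= B / (2 * L) / 2 ^+ k.+1 by rewrite divr_ge0// exprn_ge0.
  by move=> h; rewrite mulrAC; lra.
have lim_ex s : exists l, forall k, `|v k s - l| <= 2 * E s / 2 ^+ k.
  exact: geometric_limit.
pose u s := xget 0 [set l | forall k, `|v k s - l| <= 2 * E s / 2 ^+ k].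
have uP s k : `|v k s - u s| <= 2 * E s / 2 ^+ k.
  by rewrite /u; case: xgetP => [l -> //|]; have [l hl] := lim_ex s; move/(_ l).
have small (X M : R) : (forall k, X <= M / 2 ^+ k) -> X <= 0.
  move=> h; rewrite leNgt; apply/negP => X0.
  have M0 : 0 < M by have := h 0%N; rewrite expr0 divr1; lra.
  have [n hn] : exists n : nat, M / X < n%:R.
    by exists (Num.truncn (M / X)).+1; exact: truncnS_gt.
  have n2 : n%:R <= 2 ^+ n :> R by rewrite -natrX ler_nat ltnW// ltn_expl.
  have := h n; rewrite ler_pdivlMr ?exprn_gt0//.
  move: hn; rewrite ltr_pdivrMr// => h1.
  have : X * n%:R <= X * 2 ^+ n by rewrite ler_wpM2l// ltW.
  by lra.
have E0 s : 0 <= E s by rewrite mulr_ge0// expR_ge0.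
have lipu x y : `|u x - u y| <= B * `|x - y|.
  rewrite -subr_le0; apply: (@small _ (2 * E x + 2 * E y)) => k.
  have h1 := uP x k; have h2 := uP y k; have h3 := lipv k x y.
  have -> : u x - u y = - (v k x - u x) + (v k y - u y) + (v k x - v k y) by ring.
  have := ler_normD (- (v k x - u x) + (v k y - u y)) (v k x - v k y).
  have := ler_normD (- (v k x - u x)) (v k y - u y).
  by rewrite normrN mulrDl; lra.
have cu : continuous u by exact: lipschitz_continuous lipu.
(* [u] is only a pointwise limit; its image [w] under the integral operator is differentiable by
   construction and agrees with [u] beyond [s1]. *)
pose w s := c + (P u s - P u s1).
have dw s : s1 <= s -> is_derive s 1 w (H s (u s)).
  move=> ss; have -> : w = cst c + (P u - cst (P u s1)) by apply/funext => x.
  rewrite -[H s (u s)]add0r; apply: is_deriveD.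
  by rewrite -[H s (u s)]subr0; apply: is_deriveB; exact: dP.
have wu s : s1 <= s -> w s = u s.
  move=> ss; apply/eqP; rewrite -subr_eq0 -normr_le0.
  apply: (@small _ (4 * E s + 4 * E s)) => k.
  have h1 := uP s k.+1.
  suff h2 : `|v k.+1 s - w s| <= 2 * E s / 2 ^+ k.
    have -> : w s - u s = - (v k.+1 s - w s) + (v k.+1 s - u s) by ring.
    have := ler_normD (- (v k.+1 s - w s)) (v k.+1 s - u s).
    have e : 2 * E s / 2 ^+ k.+1 = E s / 2 ^+ k by rewrite exprS; field; rewrite expf_neq0.
    have : 0 <= E s / 2 ^+ k by rewrite divr_ge0// exprn_ge0.
    have -> : (4 * E s + 4 * E s) / 2 ^+ k = 8 * (E s / 2 ^+ k) by ring.
    have e2 : 2 * E s / 2 ^+ k = 2 * (E s / 2 ^+ k) by ring.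
    rewrite normrN; move: h1 h2; rewrite e e2; move: (E s / _) => Z; lra.
  have -> : v k.+1 s = c + (P (v k) s - P (v k) s1).
    by rewrite /v /= /T max_l.
  have -> : c + (P (v k) s - P (v k) s1) - w s = (P (v k) - P u) s - (P (v k) - P u) s1.
    by rewrite /w !fctE; ring.
  pose g x := B / (2 * L) / 2 ^+ k * expR (2 * L * (x - s1)).
  apply: (@le_trans _ _ (g s - g s1)).
    pose dg x := B / (2 * L) / 2 ^+ k * (2 * L * expR (2 * L * (x - s1))).
    apply: (@derive_norm_le _ _ (fun x => H x (v k x) - H x (u x)) g dg) => //.
    - by move=> x /andP[x1 x2]; apply: is_deriveB; exact: dP.
    - move=> x _; apply: is_deriveZ; exact: is_derive_expR_affine.
    - move=> x /andP[x1 x2]; apply: le_trans (HL _ _ _) _.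
      apply: le_trans (ler_wpM2l (ltW L0) (uP x k)) _.
      rewrite /dg /E max_l// le_eqVlt; apply/orP; left; apply/eqP; field.
      by rewrite expf_neq0//= gt_eqF.
  rewrite /g /E max_l// subrr mulr0 expR0 mulr1.
  have : 0 <= B / (2 * L) / 2 ^+ k by rewrite divr_ge0// exprn_ge0.
  have := expR_ge0 (2 * L * (s - s1)).
  set X := expR _; set Y := _ / 2 ^+ k => h2 h3.
  have -> : 2 * (B / (2 * L) * X) / 2 ^+ k = 2 * (Y * X) by rewrite /Y; ring.
  have : 0 <= Y * X by rewrite mulr_ge0.
  by lra.
exists w; split; first by rewrite /w subrr addr0.
by move=> s ss; rewrite (wu s)//; exact: dw.
Qed.

End picard.

(** * The Riccati equation and the shooting argument *)

Section riccati.
Context {R : realType}.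
Implicit Types (lam N al be s Q : R).

(** The inverse of [p |-> Num.min p (lam * p)]: it appears when the profile equation is solved for
    its second-order term. *)
Definition pucci lam (y : R) : R := Num.max y (y / lam).

Lemma pucci_ge lam (y : R) : y <= pucci lam y.
Proof. by rewrite le_max lexx. Qed.

Lemma pucci_lip lam (y z : R) : 0 < lam <= 1 ->
  `|pucci lam y - pucci lam z| <= `|y - z| / lam.
Proof.
move=> /andP[l0 l1]; have l2 : 1 <= lam^-1 by rewrite invf_ge1.
have key a b : pucci lam a - pucci lam b <= `|a - b| / lam.
  have h0 := normr_ge0 (a - b); have h1 := ler_norm (a - b).
  have h2 : `|a - b| <= `|a - b| / lam by rewrite ler_peMr.
  have h3 : (a - b) / lam <= `|a - b| / lam by rewrite ler_wpM2r// invr_ge0 ltW.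
  rewrite lerBlDr ge_max; apply/andP; split.
    by apply: le_trans (lerD (lexx _) (pucci_ge lam b)); lra.
  have : b / lam <= pucci lam b by rewrite le_max lexx orbT.
  by move: h3; rewrite mulrBl; lra.
rewrite ler_norml; apply/andP; split; last exact: key.
by have := key z y; rewrite distrC; lra.
Qed.

Lemma pucci_norm_le lam (y : R) : 0 < lam <= 1 -> `|pucci lam y| <= `|y| / lam.
Proof.
move=> h; have := pucci_lip y 0 h; rewrite subr0.
by rewrite {2}/pucci mul0r maxxx subr0.
Qed.

Lemma pucci_neg lam (y : R) : 0 < lam <= 1 -> y <= 0 -> pucci lam y = y.
Proof.
move=> /andP[l0 l1] y0; apply/max_idPl.
by rewrite ler_pdivrMr//; nra.
Qed.

Lemma pucci_pos lam (y : R) : 0 < lam <= 1 -> 0 <= y -> pucci lam y = y / lam.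
Proof.
by move=> /andP[l0 l1] y0; apply/max_idPr; rewrite ler_pdivlMr// ler_piMr.
Qed.

(* The right-hand side of the equation [4 s Q' = pucci (al - (s + 2 N) Q) - 2 Q + 4 s Q^2]
   satisfied by the logarithmic derivative [Q = - f' / f] of a radial profile [f]. *)
Definition riccati lam N al s Q : R :=
  (pucci lam (al - (s + 2 * N) * Q) - 2 * Q) / (4 * s) + Q ^+ 2.

(** Truncation makes the quadratic right-hand side bounded and globally Lipschitz; it is removed
    later by showing that the solution never leaves [[0, B]]. *)
Definition clamp (B Q : R) : R := Num.min (Num.max Q 0) B.

Lemma clamp_itv B Q : 0 <= B -> 0 <= clamp B Q <= B.
Proof. by move=> B0; rewrite /clamp le_min ge_min B0 le_max !lexx !orbT. Qed.

Lemma clamp_id B Q : 0 <= Q <= B -> clamp B Q = Q.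
Proof. by move=> /andP[h1 h2]; rewrite /clamp max_l// min_l. Qed.

Lemma clamp_lip B x y : `|clamp B x - clamp B y| <= `|x - y|.
Proof.
rewrite /clamp; apply: le_trans (max_lip 0 x y); move: (Num.max x 0) (Num.max y 0) => a b.
have h1 := ler_norm (a - b); have h2 := ler_norm (b - a); rewrite distrC in h2.
have h3 := normr_ge0 (a - b).
by rewrite ler_norml /Num.min; case: (ltP a B) => ?; case: (ltP b B) => ?; apply/andP; split; lra.
Qed.

Lemma clamp_le B Q : 0 <= Q -> clamp B Q <= Q.
Proof. by move=> Q0; rewrite /clamp (max_l Q0) ge_min lexx. Qed.

Section fixed_parameters.
Variables (lam N s1 B : R).
Hypotheses (hlam : 0 < lam <= 1) (N0 : 0 <= N) (s10 : 0 < s1) (B0 : 0 <= B).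

Let lam0 : 0 < lam. Proof. by have /andP[] := hlam. Qed.

(** The variable [s] is kept at or above [s1] as well, away from the singularity at [s = 0]. *)
Definition riccati_clamped al s Q : R :=
  riccati lam N al (Num.max s s1) (clamp B Q).

Let slope : R := ((1 + 2 * N / s1) / lam + 2 / s1) / 4.

Let slopeP s : s1 <= s -> ((s + 2 * N) / lam + 2) / (4 * s) <= slope.
Proof.
move=> ss; have s0 : 0 < s by exact: lt_le_trans ss.
have h : s^-1 <= s1^-1 by rewrite lef_pV2 ?posrE.
have -> : ((s + 2 * N) / lam + 2) / (4 * s) = ((1 + 2 * N * s^-1) / lam + 2 * s^-1) / 4.
  by field; rewrite !gt_eqF.
have h1 : 2 * N * s^-1 <= 2 * N * s1^-1 by rewrite ler_wpM2l// mulr_ge0.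
rewrite ler_pM2r// lerD//; last by rewrite ler_pM2l.
by rewrite ler_pM2r ?invr_gt0//; lra.
Qed.

Lemma riccati_lip al s Q Q' : s1 <= s -> 0 <= Q <= B -> 0 <= Q' <= B ->
  `|riccati lam N al s Q - riccati lam N al s Q'| <= (slope + 2 * B) * `|Q - Q'|.
Proof.
move=> ss /andP[q1 q2] /andP[q3 q4]; have s0 : 0 < s by exact: lt_le_trans ss.
have s4 : 0 < (4 * s)^-1 by rewrite invr_gt0; lra.
rewrite /riccati.
set y := al - _; set y' := al - (s + 2 * N) * Q'.
have -> : (pucci lam y - 2 * Q) / (4 * s) + Q ^+ 2 - ((pucci lam y' - 2 * Q') / (4 * s) + Q' ^+ 2) =
   ((pucci lam y - pucci lam y') - 2 * (Q - Q')) * (4 * s)^-1 + (Q - Q') * (Q + Q') by ring.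
apply: le_trans (ler_normD _ _) _; rewrite [leRHS]mulrDl; apply: lerD; last first.
  rewrite normrM mulrC ler_wpM2r// ger0_norm; lra.
rewrite normrM (ger0_norm (ltW s4)).
apply: le_trans (ler_wpM2r _ (slopeP ss)) => //.
rewrite -mulrA [_^-1 * _]mulrC mulrA ler_wpM2r ?(ltW s4)//.
apply: le_trans (ler_normB _ _) _; rewrite [leRHS]mulrDl; apply: lerD; last first.
  by rewrite normrM ger0_norm.
apply: le_trans (pucci_lip _ _ hlam) _.
have -> : y - y' = - ((s + 2 * N) * (Q - Q')) by rewrite /y /y'; ring.
rewrite normrN normrM ger0_norm ?addr_ge0 ?mulr_ge0// ?(ltW s0)//.
by rewrite mulrAC.
Qed.

Lemma riccati_lip_al al be s Q : s1 <= s ->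
  `|riccati lam N al s Q - riccati lam N be s Q| <= `|al - be| / (4 * lam * s1).
Proof.
move=> ss; have s0 : 0 < s by exact: lt_le_trans ss.
rewrite /riccati.
set y := al - _; set y' := be - _.
have -> : (pucci lam y - 2 * Q) / (4 * s) + Q ^+ 2 - ((pucci lam y' - 2 * Q) / (4 * s) + Q ^+ 2) =
   (pucci lam y - pucci lam y') * (4 * s)^-1 by ring.
rewrite normrM; have -> : al - be = y - y' by rewrite /y /y'; ring.
have -> : `|y - y'| / (4 * lam * s1) = `|y - y'| / lam * (4 * s1)^-1.
  by field; rewrite !gt_eqF.
apply: ler_pM => //; first exact: pucci_lip.
have s4 : 0 < 4 * s by lra.
by rewrite ger0_norm ?invr_ge0 ?(ltW s4)// lef_pV2 ?posrE// ?mulr_gt0//; lra.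
Qed.

Lemma riccati_clamped_lip al s Q Q' :
  `|riccati_clamped al s Q - riccati_clamped al s Q'| <= (slope + 2 * B) * `|Q - Q'|.
Proof.
have ss : s1 <= Num.max s s1 by rewrite le_max lexx orbT.
apply: le_trans (riccati_lip al ss (clamp_itv _ B0) (clamp_itv _ B0)) _.
rewrite ler_wpM2l ?clamp_lip// addr_ge0// ?mulr_ge0//.
have n1 : 0 <= N / s1 by rewrite divr_ge0// ltW.
have s1' : 0 <= s1^-1 by rewrite invr_ge0 ltW.
by rewrite /slope !(divr_ge0, addr_ge0, mulr_ge0)// ?(ltW lam0)// ?(ltW s10).
Qed.

Lemma riccati_clamped_bounded al : exists M, forall s Q,
  `|riccati_clamped al s Q| <= M.
Proof.
exists (`|al| / lam / (4 * s1) + (slope + 2 * B) * B) => s Q.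
have ss : s1 <= Num.max s s1 by rewrite le_max lexx orbT.
have s0 : 0 < Num.max s s1 by exact: lt_le_trans ss.
have /andP[c1 c2] := clamp_itv Q B0.
have := riccati_clamped_lip al s Q 0.
have c0 : clamp B 0 = 0 by rewrite clamp_id// lexx.
have := riccati_lip al ss (clamp_itv Q B0) (_ : 0 <= 0 <= B).
rewrite lexx => /(_ B0); rewrite -/(riccati_clamped al s Q) subr0 (ger0_norm c1).
have h0 : `|riccati lam N al (Num.max s s1) 0| <= `|al| / lam / (4 * s1).
  rewrite /riccati !mulr0 !subr0 expr0n addr0 normrM.
  apply: ler_pM => //; first exact: pucci_norm_le.
  rewrite ger0_norm ?invr_ge0 ?mulr_ge0 ?(ltW s0)//.
  by rewrite lef_pV2 ?posrE ?mulr_gt0// ler_pM2l.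
move: h0; set r0 := riccati _ _ _ _ 0; set r := riccati_clamped _ _ _ => h0 h1 _.
have h2 : (slope + 2 * B) * clamp B Q <= (slope + 2 * B) * B.
  apply: ler_wpM2l => //.
  have n1 : 0 <= N / s1 by rewrite divr_ge0// ltW.
  have s1' : 0 <= s1^-1 by rewrite invr_ge0 ltW.
  by rewrite /slope !(divr_ge0, addr_ge0, mulr_ge0)// ?(ltW lam0)// ?(ltW s10).
have -> : r = r0 + (r - r0) by ring.
by have := ler_normD r0 (r - r0); lra.
Qed.

Lemma continuous_pucci : continuous (pucci lam).
Proof.
by apply: (@lipschitz_continuous _ _ lam^-1) => x y; rewrite mulrC pucci_lip.
Qed.

Lemma continuous_clamp : continuous (clamp B).
Proof. by apply: (@lipschitz_continuous _ _ 1) => x y; rewrite mul1r clamp_lip. Qed.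

Lemma continuous_maxs1 : continuous (fun s => Num.max s s1).
Proof. by apply: (@lipschitz_continuous _ _ 1) => x y; rewrite mul1r max_lip. Qed.

Lemma riccati_clamped_continuous al (u : R -> R) : continuous u ->
  continuous (fun s => riccati_clamped al s (u s)).
Proof.
move=> cu; rewrite /riccati_clamped /riccati.
have cm := continuous_maxs1.
have cc : continuous (fun s => clamp B (u s)).
  by move=> x; apply: (@continuous_comp _ _ _ u (clamp B)); [exact: cu|exact: continuous_clamp].
move=> x.
have s0 : Num.max x s1 != 0 by rewrite gt_eqF// lt_max s10 orbT.
apply: cvgD; last first.
  by under eq_fun do rewrite expr2; rewrite expr2; apply: cvgM; exact: cc.
apply: cvgM; last first.
  apply: cvgV; first by rewrite mulf_neq0.
  by apply: cvgM; [exact: cvg_cst|exact: cm].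
apply: cvgB; last by apply: cvgM; [exact: cvg_cst|exact: cc].
apply: (@continuous_comp _ _ _ (fun s => al - (Num.max s s1 + 2 * N) * clamp B (u s)) (pucci lam)); last exact: continuous_pucci.
apply: cvgB; first exact: cvg_cst.
apply: cvgM; last exact: cc.
by apply: cvgD; [exact: cm|exact: cvg_cst].
Qed.

Lemma riccati_solution al c : exists u : R -> R, u s1 = c /\
  forall s, s1 <= s -> is_derive s 1 u (riccati_clamped al s (u s)).
Proof.
have [M hM] := riccati_clamped_bounded al.
have L0 : 0 < slope + 2 * B.
  have n1 : 0 <= N / s1 by rewrite divr_ge0// ltW.
  have s1' : 0 < s1^-1 by rewrite invr_gt0.
  rewrite ltr_wpDr ?mulr_ge0// /slope divr_gt0// ltr_wpDl ?mulr_gt0//.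
  by rewrite !(divr_ge0, addr_ge0, mulr_ge0)// ?(ltW lam0)// ?(ltW s10).
apply: (@picard _ (riccati_clamped al) s1 c (slope + 2 * B) M) => //.
- by have := s10; lra.
- exact: le_trans (hM 0 0).
- exact: riccati_clamped_continuous.
- exact: riccati_clamped_lip.
Qed.

End fixed_parameters.

(** Working with the square of the difference W avoids the corner of the absolute value: 2 |W| (L
    |W| + eta) <= (2 L + 1) W^2 + eta^2. *)
Lemma gronwall (U V dU dV : R -> R) (s1 L eta : R) : 0 <= L ->
  (forall s : R, s1 <= s -> is_derive s 1 U (dU s)) ->
  (forall s : R, s1 <= s -> is_derive s 1 V (dV s)) ->
  (forall s : R, s1 <= s -> `|dU s - dV s| <= L * `|U s - V s| + eta) ->
  forall s, s1 <= s ->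
  (U s - V s) ^+ 2 <= ((U s1 - V s1) ^+ 2 + eta ^+ 2) * expR ((2 * L + 1) * (s - s1)).
Proof.
move=> L0 hU hV h s ss.
pose W := (U - V : R -> R).
pose g x := ((W x * W x) + eta ^+ 2) * expR ((- (2 * L + 1)) * (x - s1)).
pose dg x := (dU x - dV x) * W x + W x * (dU x - dV x).
suff : - g s1 <= - g s.
  rewrite /g subrr mulr0 expR0 mulr1 lerN2 mulNr expRN /W !fctE -!expr2.
  rewrite ler_pdivrMr ?expR_gt0// => h1; apply: le_trans h1.
  by rewrite lerDl sqr_ge0.
apply: (@derive_nondecreasing _ (- g) (fun x => - (((dg x + 0)) * expR ((- (2 * L + 1)) * (x - s1)) +
   ((W x * W x) + eta ^+ 2) * ((- (2 * L + 1)) * expR ((- (2 * L + 1)) * (x - s1)))))) => // x /andP[x1 x2].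
  have dW : is_derive x 1 W (dU x - dV x) by apply: is_deriveB; [exact: hU|exact: hV].
  apply: is_deriveN.
  have e := is_derive_expR_affine (- (2 * L + 1)) s1 x.
  have d1 : is_derive x 1 (W * W + cst (eta ^+ 2)) (W x *: (dU x - dV x) + W x *: (dU x - dV x) + 0).
    by apply: is_deriveD; apply: is_deriveM.
  have := is_deriveM d1 e.
  rewrite (_ : (W * W + cst (eta ^+ 2)) * _ = g)//.
  move=> d2; apply: is_derive_eq.
  by rewrite /dg !fctE /GRing.scale/=; ring.
have := expR_gt0 (- (2 * L + 1) * (x - s1)); set e := expR _ => e0.
have := h x x1; rewrite -[U x - V x]/(W x); set X := W x; set Y := dU x - dV x.
move=> hY.
have -> : - ((dg x + 0) * e + (X * X + eta ^+ 2) * (- (2 * L + 1) * e)) =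
  e * ((2 * L + 1) * (X * X + eta ^+ 2) - 2 * (X * Y)).
  by rewrite /dg -/X -/Y; ring.
rewrite mulr_ge0 ?(ltW e0)//.
have h1 : X * Y <= `|X| * (L * `|X| + eta).
  by apply: le_trans (ler_norm _) _; rewrite normrM ler_wpM2l.
have h2 : X * X = `|X| * `|X| by rewrite -normrM ger0_norm// -expr2 sqr_ge0.
have h3 : 0 <= (`|X| - eta) ^+ 2 by rewrite sqr_ge0.
have h4 : 0 <= L * eta ^+ 2 by rewrite mulr_ge0// sqr_ge0.
rewrite h2; move: h1 h3 h4; move: `|X| => Z.
by rewrite !expr2; lra.
Qed.

End riccati.

(** * Shooting for the exponent *)

Section shooting.
Context {R : realType}.

Lemma riccati_ge (lam N al s Q : R) : 0 < s ->
  (al - (s + 2 * N) * Q - 2 * Q) / (4 * s) + Q ^+ 2 <= riccati lam N al s Q.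
Proof.
move=> s0; rewrite /riccati lerD2r ler_pM2r ?invr_gt0 ?mulr_gt0// lerD2r.
exact: pucci_ge.
Qed.

(** On the branch where [pucci] is the identity the right-hand side tends to Q^2 - Q / 4 as [s]
    grows. The levels 1/2 here and 1/8 in [riccati_down] lie on either side of the zero 1/4, so each
    can be crossed in one direction only. *)
Lemma riccati_up (lam N al s : R) : 0 < s -> 1 + N <= al + s / 2 -> 0 <= al -> 
  0 < al + s / 2 - (1 + N) -> 0 < riccati lam N al s (1 / 2).
Proof.
move=> s0 h1 a0 h2; apply: lt_le_trans (riccati_ge lam N al (1 / 2) s0).
have -> : (al - (s + 2 * N) * (1 / 2) - 2 * (1 / 2)) / (4 * s) + (1 / 2) ^+ 2 =
   (al + s / 2 - (1 + N)) / (4 * s) by field; rewrite gt_eqF.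
by rewrite divr_gt0// mulr_gt0.
Qed.

Lemma riccati_up1 (lam N al s : R) : 0 < s -> 0 < al - 2 * (1 + N) + 3 * s ->
  0 < riccati lam N al s 1.
Proof.
move=> s0 h1; apply: lt_le_trans (riccati_ge lam N al 1 s0).
have -> : (al - (s + 2 * N) * 1 - 2 * 1) / (4 * s) + 1 ^+ 2 =
   (al - 2 * (1 + N) + 3 * s) / (4 * s) by field; rewrite gt_eqF.
by rewrite divr_gt0// mulr_gt0.
Qed.

Lemma riccati_down (lam N al s : R) : 0 < lam <= 1 -> 0 <= N -> 16 * al < s -> 0 < s ->
  riccati lam N al s (1 / 8) < 0.
Proof.
move=> hl N0 h s0; rewrite /riccati pucci_neg//; last by lra.
have -> : (al - (s + 2 * N) * (1 / 8) - 2 * (1 / 8)) / (4 * s) + (1 / 8) ^+ 2 =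
   - ((2 * (1 + N) / 8 + s / 16 - al) / (4 * s)) by field; rewrite gt_eqF.
by rewrite oppr_lt0 divr_gt0// ?mulr_gt0//; lra.
Qed.

(** Small [al] makes the level 1/8 a barrier for every [s > 0], so that it confines the solution
    from the matching point on; [riccati_up1] is the counterpart for large [al], with the level
    1. *)
Lemma riccati_down_small (lam D al s : R) : 0 < lam <= 1 -> 1 <= D -> 0 < s ->
  al < lam * D / 4 -> riccati lam (lam * (D - 1)) al s (1 / 8) < 0.
Proof.
move=> /andP[l0 l1] D1 s0 ha; set N := lam * (D - 1).
have N0 : 0 <= N by rewrite mulr_ge0 ?subr_ge0// ltW.
rewrite /riccati; set y := al - _.
have -> : (pucci lam y - 2 * (1 / 8)) / (4 * s) + (1 / 8) ^+ 2 =
   - ((1 / 4 - s / 16 - pucci lam y) / (4 * s)) by field; rewrite gt_eqF.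
rewrite oppr_lt0 divr_gt0// ?mulr_gt0// subr_gt0 /pucci gt_max; apply/andP; split.
  have : N = lam * D - lam by rewrite /N; ring.
  by rewrite /y; lra.
rewrite ltr_pdivrMr// /y.
have : 0 <= s * (1 - lam) by rewrite mulr_ge0// ?subr_ge0// ltW.
have : N = lam * D - lam by rewrite /N; ring.
by lra.
Qed.

Lemma sqr_lt_norm (x e : R) : 0 <= e -> x ^+ 2 < e ^+ 2 -> `|x| < e.
Proof.
move=> e0; rewrite !ltNge; apply: contra => h.
by rewrite -[leRHS]real_normK ?num_real// lerXn2r ?nnegrE.
Qed.

Lemma quotient_lip (a b a' b' P e : R) : 1 / 2 <= b -> 1 / 2 <= b' <= 2 -> `|a'| <= P ->
  `|a - a'| <= e -> `|b - b'| <= e -> `|- a / b - - a' / b'| <= 4 * (2 + P) * e.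
Proof.
move=> hb /andP[hb' hb2] ha' da db.
have b0 : 0 < b by lra.
have b0' : 0 < b' by lra.
have P0 : 0 <= P by exact: le_trans ha'.
have e0 : 0 <= e by exact: le_trans da.
have -> : - a / b - - a' / b' = (- (a - a') * b' + a' * (b - b')) / (b * b').
  by field; rewrite !gt_eqF.
rewrite normrM normfV (ger0_norm (_ : 0 <= b * b')) ?mulr_ge0 ?(ltW b0) ?(ltW b0')//.
rewrite ler_pdivrMr ?mulr_gt0//.
have e1 : `|- (a - a') * b'| <= e * 2.
  by rewrite normrM normrN; apply: ler_pM => //; rewrite ger0_norm//; exact: ltW.
have e2 : `|a' * (b - b')| <= P * e by rewrite normrM; apply: ler_pM.
apply: le_trans (ler_normD _ _) _; apply: le_trans (lerD e1 e2) _.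
have e3 : 1 / 4 <= b * b'.
  have : 1 / 2 * (1 / 2) <= b * b' by apply: ler_pM => //; lra.
  by lra.
have -> : e * 2 + P * e = 4 * (2 + P) * e * (1 / 4) by field.
by apply: ler_wpM2l => //; rewrite mulr_ge0// mulr_ge0// addr_ge0.
Qed.

(** One matching point [s1] serves every [al] in [[a0, a1]]. With N = lam (D - 1), the expression al
    K + (s + 2 N) K' equals al / D > 0 at [s = 0]; as long as it is nonnegative, the isotropic
    linear equation coincides with the Pucci equation. *)
Lemma inner_data (lam D a0 a1 : R) : 0 < lam <= 1 -> 1 <= D -> 0 < a0 -> a0 <= a1 ->
  exists (s1 C : R) (K K1 K2 K3 : R -> R -> R),
  [/\ [/\ 0 < s1, s1 <= 1 & 0 < C],
      forall al s : R, a0 <= al <= a1 ->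
        [/\ is_derive s 1 (K al) (K1 al s), is_derive s 1 (K1 al) (K2 al s),
            is_derive s 1 (K2 al) (K3 al s) &
            4 * lam * s * K2 al s + (2 * lam * D + s) * K1 al s + al * K al s = 0],
      forall al s : R, a0 <= al <= a1 -> 0 <= s <= s1 ->
        [/\ 1 / 2 <= K al s, K1 al s < 0,
            0 <= al * K al s + (s + 2 * (lam * (D - 1))) * K1 al s &
            `|K2 al s| <= C /\ `|K3 al s| <= C],
      forall al : R, a0 <= al <= a1 ->
        `|K al s1 - 1| <= 1 / 100 /\ `|K1 al s1 + al / (2 * lam * D)| <= 1 / 100 &
      forall al be : R, a0 <= al <= a1 -> a0 <= be <= a1 ->
        `|- K1 al s1 / K al s1 - - K1 be s1 / K be s1| <= C * `|al - be|].
Proof.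
move=> /andP[l0 l1] D1 a00 a01.
set N := lam * (D - 1).
have N0 : 0 <= N by rewrite mulr_ge0 ?subr_ge0// ltW.
have lD : 0 < lam * D by rewrite mulr_gt0//; lra.
have a10 : 0 <= a1 by lra.
have [C [K [K1 [K2 [K3 [C0 hK bK cK]]]]]] := @kummer_solution R lam D a1 l0 D1 a10.
(* [M * s] bounds the loss of al K + (s + 2 N) K' against its value al / D at the origin. *)
pose M := a1 * C + 2 * N * C + a1 / (2 * lam * D) + C.
have lD2 : 0 < 2 * lam * D by lra.
have M0 : 0 < M.
  have h1 : 0 <= a1 * C by rewrite mulr_ge0// ltW.
  have h2 : 0 <= 2 * N * C by apply: mulr_ge0; lra.
  have h3 : 0 <= a1 / (2 * lam * D) by rewrite divr_ge0// ltW.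
  by rewrite /M; lra.
(* The last three conditions keep K and K' close to their values at 0, keep al K + (s + 2 N) K'
   nonnegative, and keep K' negative. *)
have [s1 [s10 s11 s1C s1M s1K]] : exists s1 : R, [/\ 0 < s1, s1 <= 1, C * s1 <= 1 / 100,
   M * s1 <= a0 / D & C * s1 < a0 / (2 * lam * D)].
  pose t1 := 1 / 100 / C; pose t2 := a0 / D / M; pose t3 := a0 / (2 * lam * D) / (2 * C).
  have D0 : 0 < D by lra.
  have t10 : 0 < t1 by rewrite !divr_gt0.
  have t20 : 0 < t2 by rewrite !divr_gt0.
  have t30 : 0 < t3 by rewrite !divr_gt0// mulr_gt0.
  pose t := Num.min 1 (Num.min t1 (Num.min t2 t3)).
  have h1 : t <= 1 by rewrite /t ge_min lexx.
  have h2 : t <= t1 by rewrite /t !ge_min lexx !orbT.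
  have h3 : t <= t2 by rewrite /t !ge_min lexx !orbT.
  have h4 : t <= t3 by rewrite /t !ge_min lexx !orbT.
  have t0 : 0 < t by rewrite /t !lt_min ltr01 t10 t20 t30.
  exists t; split => //.
  - by rewrite mulrC -ler_pdivlMr.
  - by rewrite mulrC -ler_pdivlMr.
  - rewrite mulrC -ltr_pdivlMr//; apply: le_lt_trans h4 _.
    rewrite /t3 ltr_pM2l ?divr_gt0// ltf_pV2 ?posrE// ?mulr_gt0//; lra.
have in01 (s : R) : 0 <= s <= s1 -> 0 <= s <= 1.
  by move=> /andP[-> h]; exact: le_trans s11.
have Cs (s : R) : 0 <= s <= s1 -> C * s <= C * s1 by move=> /andP[_ h]; rewrite ler_pM2l.
have adm (al : R) : a0 <= al <= a1 -> 0 <= al <= a1.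
  by move=> /andP[h ->]; rewrite (le_trans _ h)// ltW.
have inner (al s : R) : a0 <= al <= a1 -> 0 <= s <= s1 ->
    [/\ 1 / 2 <= K al s, K1 al s < 0, K al s <= 101/100, `|K1 al s| <= a1 / (2 * lam * D) + 1 &
        0 <= al * K al s + (s + 2 * N) * K1 al s].
  move=> hal hs; have [h1 h2 _ _] := bK al s (adm _ hal) (in01 s hs).
  have hs' := Cs s hs; have /andP[s0 ss1] := hs; have /andP[al0 al1] := hal.
  move: h1 h2; rewrite !ler_norml => /andP[h1 h1'] /andP[h2 h2'].
  have e1 : al / (2 * lam * D) >= a0 / (2 * lam * D) by rewrite ler_pM2r ?invr_gt0.
  have e2 : al / (2 * lam * D) <= a1 / (2 * lam * D) by rewrite ler_pM2r ?invr_gt0.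
  split; [lra|lra|lra| |].
    apply/andP; split; lra.
  have e3 : M * s <= M * s1 by rewrite ler_pM2l.
  have e4 : a0 / D <= al / D by rewrite ler_pM2r ?invr_gt0//; lra.
  have e5 : 2 * N * (al / (2 * lam * D)) = al - al / D.
    by rewrite /N; field; rewrite !gt_eqF//; lra.
  have f1 : al * (1 - C * s) <= al * K al s by rewrite ler_wpM2l//; lra.
  have f2 : (s + 2 * N) * (- (al / (2 * lam * D)) - C * s) <= (s + 2 * N) * K1 al s.
    by rewrite ler_wpM2l//; lra.
  have g1 : al * (C * s) <= a1 * (C * s) by rewrite ler_wpM2r// mulr_ge0// ltW.
  have g2 : s * (al / (2 * lam * D)) <= s * (a1 / (2 * lam * D)) by rewrite ler_wpM2l.
  have g3 : s * (C * s) <= C * s by rewrite ler_piMl ?mulr_ge0 ?(ltW C0)//; lra.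
  have e6 : M * s = a1 * (C * s) + 2 * N * (C * s) + s * (a1 / (2 * lam * D)) + C * s.
    by rewrite /M; ring.
  have e7 : (s + 2 * N) * (- (al / (2 * lam * D)) - C * s) =
    - (s * (al / (2 * lam * D))) - s * (C * s) - 2 * N * (al / (2 * lam * D)) - 2 * N * (C * s).
    by ring.
  move: f1 f2 g1 g2 g3 e3 e4 e5 s1M; rewrite e6 e7 mulrBr mulr1.
  move: (al / (2 * lam * D)) (a1 / (2 * lam * D)) (al / D) (a0 / D) (M * s1).
  by move=> X A Y Z W *; lra.
have ss1 : 0 <= s1 <= s1 by rewrite lexx ltW.
pose P := a1 / (2 * lam * D) + 1.
have P0 : 0 <= P by rewrite addr_ge0// divr_ge0// ltW.
have PC : 0 <= 4 * (2 + P) * C by rewrite mulr_ge0 ?(ltW C0)// mulr_ge0// addr_ge0.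
exists s1, (C + 4 * (2 + P) * C), K, K1, K2, K3; split.
- by split => //; clear -C0 PC; lra.
- by move=> al s /adm; exact: hK.
- move=> al s hal hs; have [k1 k2 _ _ k5] := inner al s hal hs.
  have [_ _ b2 b3] := bK al s (adm _ hal) (in01 _ hs).
  by split => //; split; clear -PC b2 b3; lra.
- move=> al hal; have [b1 b2 _ _] := bK al s1 (adm _ hal) (in01 _ ss1).
  by clear -s1C b1 b2; split; lra.
- move=> al be ha hb; have [k1 _ _ _ _] := inner al s1 ha ss1.
  have [k1' _ k3' k4' _] := inner be s1 hb ss1.
  have [d1 d2] := cK al be s1 (adm _ ha) (adm _ hb) (in01 _ ss1).
  have k3'' : 1 / 2 <= K be s1 <= 2 by clear -k1' k3'; lra.
  apply: le_trans (quotient_lip k1 k3'' k4' d2 d1) _.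
  have := normr_ge0 (al - be); rewrite -/P mulrA; clear -C0; nra.
Qed.

Definition riccati_flow (lam N s1 B : R) (Q1 : R -> R) (U : R -> R -> R) :=
  forall al : R, U al s1 = Q1 al /\
    forall s : R, s1 <= s -> is_derive s 1 (U al) (riccati_clamped lam N s1 B al s (U al s)).

(** Gronwall's inequality for two parameters: the initial values differ by at most a multiple of the
    difference of the parameters, and so do the right-hand sides. *)
Lemma flow_continuous (lam N s1 B a0 a1 Cq : R) (Q1 : R -> R) (U : R -> R -> R) :
  0 < lam <= 1 -> 0 <= N -> 0 < s1 -> 0 <= B -> riccati_flow lam N s1 B Q1 U ->
  (forall al be : R, a0 <= al <= a1 -> a0 <= be <= a1 ->
    `|Q1 al - Q1 be| <= Cq * `|al - be|) ->
  forall al s e : R, a0 <= al <= a1 -> s1 <= s -> 0 < e -> exists2 r : R, 0 < r &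
    forall be : R, a0 <= be <= a1 -> `|al - be| < r -> `|U al s - U be s| < e.
Proof.
move=> hl N0 s10 B0 hU Q1lip.
have U1 (al : R) : U al s1 = Q1 al by have [] := hU al.
have dU (al s : R) : s1 <= s -> is_derive s 1 (U al) (riccati_clamped lam N s1 B al s (U al s)).
  by have [_] := hU al; apply.
have [L L0 hL] : exists2 L : R, 0 <= L & forall al s Q Q' : R,
    `|riccati_clamped lam N s1 B al s Q - riccati_clamped lam N s1 B al s Q'| <= L * `|Q - Q'|.
  have h := @riccati_clamped_lip R lam N s1 B hl N0 s10 B0.
  eexists; last exact: h.
  by have := le_trans (normr_ge0 _) (h 0 0 1 0); rewrite subr0 normr1 mulr1.
have l4 : 0 < 4 * lam * s1 by have /andP[? _] := hl; rewrite !mulr_gt0.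
move=> al s e ha ss e0.
  pose Z := (Cq ^+ 2 + (4 * lam * s1)^-1 ^+ 2) * expR ((2 * L + 1) * (s - s1)).
  have Z0 : 0 <= Z by rewrite mulr_ge0 ?expR_ge0// addr_ge0// sqr_ge0.
  exists (e / (1 + Z)); first by rewrite divr_gt0//; lra.
  move=> be hb hab; set r := `|al - be| in hab *.
  have r0 : 0 <= r by exact: normr_ge0.
  have := @gronwall R (U al) (U be) _ _ s1 L (r / (4 * lam * s1)) L0
    (fun x => dU al x) (fun x => dU be x) _ s ss.
  rewrite !U1 => h.
  have {}h : (U al s - U be s) ^+ 2 <= Z * r ^+ 2.
    apply: le_trans (h _) _.
      move=> x x1.
      have -> : riccati_clamped lam N s1 B al x (U al x) - riccati_clamped lam N s1 B be x (U be x) =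
       (riccati_clamped lam N s1 B al x (U al x) - riccati_clamped lam N s1 B al x (U be x)) +
       (riccati_clamped lam N s1 B al x (U be x) - riccati_clamped lam N s1 B be x (U be x)) by ring.
      apply: le_trans (ler_normD _ _) _; apply: lerD; first exact: hL.
      by apply: riccati_lip_al => //; rewrite max_l.
    have -> : Z * r ^+ 2 = ((Cq * r) ^+ 2 + (r / (4 * lam * s1)) ^+ 2) * expR ((2 * L + 1) * (s - s1)).
      by rewrite /Z; ring.
    rewrite ler_wpM2r ?expR_ge0// lerD2r -real_normK ?num_real//.
    have Qr := Q1lip al be ha hb.
    by rewrite lerXn2r ?nnegrE ?Q1lip//; exact: le_trans Qr.
  apply: sqr_lt_norm; first exact: ltW.
  have h2 : r * (1 + Z) < e by rewrite -ltr_pdivlMr//; lra.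
  have h3 : 0 <= r * Z by rewrite mulr_ge0.
  have h4 : r ^+ 2 * Z <= (r * (1 + Z)) ^+ 2.
    rewrite !expr2; have : 0 <= r * Z * r by rewrite mulr_ge0.
    have : 0 <= (r * Z) * (r * Z) by rewrite mulr_ge0.
    have : 0 <= r * r by rewrite mulr_ge0.
    by lra.
  have h5 : (r * (1 + Z)) ^+ 2 < e ^+ 2.
    by rewrite ltrXn2r// ?nnegrE ?(ltW e0)// mulr_ge0//; lra.
  by lra.
Qed.

Lemma riccati_clamped_ge (lam N s1 B al s Q : R) : 0 <= N -> 0 < s1 -> 0 <= B -> s1 <= s ->
  0 <= al -> 0 <= Q ->
  - ((1 + (2 * N + 2) / s1) / 4 * Q) <= riccati_clamped lam N s1 B al s Q.
Proof.
move=> N0 s10 B0 ss al0 Q0; rewrite /riccati_clamped max_l//.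
have s0 : 0 < s by exact: lt_le_trans ss.
have c1 := clamp_le B Q0; have /andP[c0 _] := clamp_itv Q B0.
set c := clamp B _ in c0 c1 *.
apply: le_trans (riccati_ge lam N al c s0).
have e1 : (al - (s + 2 * N) * c - 2 * c) / (4 * s) =
  al / (4 * s) - (1 + (2 * N + 2) / s) / 4 * c by field; rewrite gt_eqF.
have e2 : 0 <= al / (4 * s) by rewrite divr_ge0// mulr_ge0// ltW.
have e3 : (1 + (2 * N + 2) / s) / 4 <= (1 + (2 * N + 2) / s1) / 4.
  rewrite ler_pM2r// lerD2l ler_wpM2l//; first by lra.
  by rewrite lef_pV2 ?posrE.
have e7 : 0 <= (1 + (2 * N + 2) / s1) / 4.
  by rewrite divr_ge0// addr_ge0// divr_ge0 ?(ltW s10)//; lra.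
have e4 := ler_wpM2r c0 e3; have e5 := ler_wpM2l e7 c1.
have e6 : 0 <= c ^+ 2 by rewrite sqr_ge0.
by rewrite e1; clear -e2 e4 e5 e6; lra.
Qed.

(** A large value cannot come back quickly: [u] decreases at most at the exponential rate G = (1 +
    (2 N + 2) / s1) / 4, so exceeding B = exp (G s0) before [s0] would leave more than 1/2 at [s0].
    Thus the truncation stays inactive although the equation is quadratic. *)
Lemma flow_below (lam N s1 s0 B al : R) (u : R -> R) : 0 <= N -> 0 < s1 -> 0 <= al ->
  B = expR ((1 + (2 * N + 2) / s1) / 4 * s0) ->
  (forall s : R, s1 <= s -> is_derive s 1 u (riccati_clamped lam N s1 B al s (u s))) ->
  (forall s : R, s1 <= s -> 0 < u s) -> s1 <= s0 -> u s0 <= 1 / 2 ->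
  forall s : R, s1 <= s <= s0 -> u s <= B.
Proof.
move=> N0 s10 al0 hB du upos s10' us0 s /andP[ss ss0].
have B0 : 0 < B by rewrite hB expR_gt0.
set G := (1 + (2 * N + 2) / s1) / 4 in hB.
have G0 : 0 < G by rewrite /G divr_gt0// ltr_wpDr// divr_ge0 ?(ltW s10)//; lra.
rewrite leNgt; apply/negP => hBu.
pose g x := u x * expR (G * (x - s)).
have : g s <= g s0.
  pose dg x := riccati_clamped lam N s1 B al x (u x) * expR (G * (x - s)) +
    u x * (G * expR (G * (x - s))).
  apply: (@derive_nondecreasing _ g dg) => //.
  - move=> x /andP[x1 x2]; have h := du x (le_trans ss x1).
    have := is_deriveM h (is_derive_expR_affine G s x).
    rewrite (_ : u * _ = g)// => d2; apply: is_derive_eq.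
    by rewrite /dg /GRing.scale/=; ring.
  - move=> x /andP[x1 x2]; have xs1 := le_trans ss x1.
    have e0 := expR_gt0 (G * (x - s)).
    have := riccati_clamped_ge lam N0 s10 (ltW B0) xs1 al0 (ltW (upos _ xs1)).
    rewrite -/G /dg; move: (riccati_clamped _ _ _ _ _ _ _) (expR _) e0 => r ee e0 h.
    have -> : r * ee + u x * (G * ee) = (r + G * u x) * ee by ring.
    by rewrite mulr_ge0 ?(ltW e0)//; clear -h; lra.
rewrite /g subrr mulr0 expR0 mulr1 => h.
have h2 : u s0 * expR (G * (s0 - s)) <= 1 / 2 * B.
  apply: ler_pM; rewrite ?expR_ge0//; first by rewrite ltW// upos.
  by rewrite hB ler_expR ler_pM2l// lerBlDr lerDl (le_trans (ltW s10)).
by clear -h h2 hBu B0; lra.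
Qed.

(** The parameter is the supremum of those whose solution falls below 1/8 beyond [s0]. If its own
    solution fell below 1/8, so would those of slightly larger parameters; if it exceeded 1/2, so
    would that of some parameter in the set, which cannot do both. *)
Lemma outer_data (lam D s1 a0 a1 Cq : R) (Q1 : R -> R) : 0 < lam <= 1 -> 1 <= D -> 0 < s1 -> s1 <= 1 ->
  a0 = lam * D / 8 -> a1 = 4 * (1 + lam * (D - 1)) ->
  (forall al : R, a0 <= al <= a1 -> 0 < Q1 al) -> Q1 a0 < 1 / 8 -> 1 < Q1 a1 ->
  (forall al be : R, a0 <= al <= a1 -> a0 <= be <= a1 ->
    `|Q1 al - Q1 be| <= Cq * `|al - be|) ->
  exists (al s0 B : R) (u : R -> R), 
  [/\ a0 <= al <= a1, s1 <= s0, u s1 = Q1 al,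
      forall s : R, s1 <= s ->
        is_derive s 1 u (riccati lam (lam * (D - 1)) al s (u s)) /\ 0 < u s <= B &
      forall s : R, s0 <= s -> 1 / 8 <= u s].
Proof.
move=> hl D1 s10 s11 ha0 ha1 Q1pos Q1a0 Q1a1 Q1lip; have /andP[l0 l1] := hl.
set N := lam * (D - 1) in ha1 *.
have N0 : 0 <= N by rewrite mulr_ge0 ?subr_ge0// ltW.
have lD : 0 < lam * D by rewrite mulr_gt0//; lra.
have NE : N = lam * (D - 1) by [].
clearbody N.
have a00 : 0 < a0 by rewrite ha0 divr_gt0.
have a01 : a0 < a1.
  have : N = lam * D - lam by rewrite NE; ring.
  by rewrite ha0 ha1; clear -lD N0 l1; lra.
have a14 : 4 <= a1 by clear -ha1 N0; lra.
(* From here on both levels are one-way for every admissible [al]: [16 * al < s] serves the level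
   1/8, and [s / 2] exceeds [1 + N] for the level 1/2. *)
pose s0 := 16 * a1 + 1.
have s10' : s1 <= s0 by rewrite /s0; clear -s11 a14; lra.
pose B := expR ((1 + (2 * N + 2) / s1) / 4 * s0).
have B1 : 1 <= B.
  rewrite /B -[leLHS]expR0 ler_expR mulr_ge0//; last by rewrite /s0; clear -a14; lra.
  rewrite divr_ge0// addr_ge0// divr_ge0 ?(ltW s10)//. clear -N0; lra.
have B0 : 0 <= B by exact: le_trans B1.
have cB (c : R) : 0 <= c <= 1 -> 0 <= c <= B by move=> /andP[-> h]; exact: le_trans B1.
have i8 : (0 <= 1 / 8 :> R) && (1 / 8 <= 1 :> R) by apply/andP; split; lra.
have i2 : (0 <= 1 / 2 :> R) && (1 / 2 <= 1 :> R) by apply/andP; split; lra.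
have i1 : (0 <= 1 :> R) && (1 <= 1 :> R) by apply/andP; split; lra.
have sol (al : R) : exists u : R -> R, u s1 = Q1 al /\
    forall s : R, s1 <= s -> is_derive s 1 u (riccati_clamped lam N s1 B al s (u s)).
  exact: riccati_solution.
have [U hU] := choice sol.
have cont := flow_continuous hl N0 s10 B0 hU Q1lip.
have U1 (al : R) : U al s1 = Q1 al by have [] := hU al.
have dU (al s : R) : s1 <= s -> is_derive s 1 (U al) (riccati_clamped lam N s1 B al s (U al s)).
  by have [_] := hU al; apply.
have clm (al s Q : R) : s1 <= s -> 0 <= Q <= B -> riccati_clamped lam N s1 B al s Q = riccati lam N al s Q.
  by move=> ss hQ; rewrite /riccati_clamped max_l// clamp_id.
have spos (s : R) : s1 <= s -> 0 < s by exact: lt_le_trans.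
have Upos (al : R) : a0 <= al <= a1 -> forall s : R, s1 <= s -> 0 < U al s.
  move=> hal; apply: (@barrier _ (U al) (fun s => riccati_clamped lam N s1 B al s (U al s))).
  - by rewrite U1 Q1pos.
  - move=> x x1 ->; rewrite clm ?lexx//.
    apply: lt_le_trans (riccati_ge lam N al 0 (spos _ x1)).
    have /andP[h _] := hal.
    have x0 := spos _ x1.
    by rewrite !mulr0 !subr0 expr0n/= addr0; apply: divr_gt0; clear -a00 h x0; lra.
have up (al a c : R) : s1 <= a -> 0 <= c <= B ->
    (forall s : R, a <= s -> 0 < riccati lam N al s c) ->
    c < U al a -> forall s : R, a <= s -> c < U al s.
  move=> a1' hc hp ca s sa; rewrite -subr_gt0.
  apply: (@barrier _ (fun s => U al s - c) (fun s => riccati_clamped lam N s1 B al s (U al s)) a) => //.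
  - by rewrite subr_gt0.
  - move=> x ax; have h := dU al x (le_trans a1' ax).
    have := is_deriveB h (is_derive_cst c x 1); rewrite subr0.
    by rewrite (_ : U al - cst c = fun s => U al s - c).
  - move=> x ax /eqP; rewrite subr_eq0 => /eqP ->.
    by rewrite clm ?hp// (le_trans a1').
have down (al a c : R) : s1 <= a -> 0 <= c <= B ->
    (forall s : R, a <= s -> riccati lam N al s c < 0) ->
    U al a < c -> forall s : R, a <= s -> U al s < c.
  move=> a1' hc hp ca s sa; rewrite -subr_gt0.
  apply: (@barrier _ (fun s => c - U al s) (fun s => - riccati_clamped lam N s1 B al s (U al s)) a) => //.
  - by rewrite subr_gt0.
  - move=> x ax; have h := dU al x (le_trans a1' ax).
    have := is_deriveB (is_derive_cst c x 1) h; rewrite sub0r.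
    by rewrite (_ : cst c - U al = fun s => c - U al s).
  - move=> x ax /eqP; rewrite subr_eq0 => /eqP <-.
    by rewrite clm ?oppr_gt0 ?hp// (le_trans a1').
pose Am al := exists2 s : R, s0 <= s & U al s < 1 / 8.
pose Ap al := exists2 s : R, s0 <= s & 1 / 2 < U al s.
(* Each escape persists, so both would hold at the larger of the two times. *)
have dis (al : R) : a0 <= al <= a1 -> Am al -> Ap al -> False.
  move=> hal [s ss us] [t tt ut]; have /andP[h1 h2] := hal.
  have m1 : s <= Num.max s t by rewrite le_max lexx.
  have m2 : t <= Num.max s t by rewrite le_max lexx orbT.
  have v1 : U al (Num.max s t) < 1 / 8.
    apply: (down al s) => //; [exact: le_trans ss|exact: cB|].
    move=> x sx; apply: riccati_down => //; move: ss; rewrite /s0; clear -h2 sx a14; lra.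
  have v2 : 1 / 2 < U al (Num.max s t).
    apply: (up al t) => //; [exact: le_trans tt|exact: cB|].
    by move=> x sx; apply: riccati_up => //; move: tt; rewrite /s0; clear -h1 h2 sx a14 a00 ha1; lra.
  by clear -v1 v2; lra.
have Am0 : Am a0.
  exists s0 => //; apply: (down a0 s1) => //; first exact: cB.
    move=> s ss; rewrite NE; apply: riccati_down_small => //; first exact: spos.
    by rewrite ha0; clear -lD; lra.
  by rewrite U1.
have Ap1 : Ap a1.
  exists s0 => //; apply: (@lt_trans _ _ 1); first by clear; lra.
  apply: (up a1 s1) => //; first exact: cB.
    by move=> s ss; have := spos s ss; move=> s0'; apply: riccati_up1 => //; rewrite ha1; clear -s0' N0; lra.
  by rewrite U1.
pose E := [set al : R | a0 <= al <= a1 /\ Am al].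
have Ea0 : E a0 by split => //; rewrite lexx ltW.
have ubE : ubound E a1 by move=> x [/andP[]].
have hE : has_sup E by split; [exists a0|exists a1].
set als := sup E.
have hals : a0 <= als <= a1.
  apply/andP; split; first by apply: ub_le_sup => //; exists a1.
  by apply: ge_sup => //; exists a0.
have nAm : ~ Am als.
  move=> hAm; have [s ss us] := hAm; have /andP[h1 h2] := hals.
  have lt1 : als < a1.
    rewrite lt_neqAle h2 andbT; apply/eqP => eq1; apply: (dis als hals hAm).
    by rewrite eq1.
  have [r r0 hr] := cont als s (1 / 8 - U als s) hals (le_trans s10' ss) ltac:(clear -us; lra).
  pose be := Num.min a1 (als + r / 2).
  have be1 : als < be by rewrite lt_min lt1 ltrDl divr_gt0.
  have be2 : be <= a1 by rewrite ge_min lexx.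
  have be3 : be <= als + r / 2 by rewrite ge_min lexx orbT.
  have hb : a0 <= be <= a1 by rewrite be2 (le_trans h1)// ltW.
  have : E be.
    split => //; exists s => //.
    have br : `|als - be| < r.
      by rewrite distrC ger0_norm ?subr_ge0 ?(ltW be1)//; clear -be3 r0; lra.
    by have := hr be hb br; rewrite ltr_norml => /andP[]; clear; lra.
  move=> /(ub_le_sup (ex_intro _ a1 ubE)); rewrite -/als; clear -be1; lra.
have nAp : ~ Ap als.
  move=> [s ss us].
  have [r r0 hr] := cont als s (U als s - 1 / 2) hals (le_trans s10' ss) ltac:(clear -us; lra).
  have [al [hal Amal] lal] := sup_adherent r0 hE.
  have lal' : al <= als by apply: ub_le_sup; [exists a1|split].
  apply: (dis al hal Amal); exists s => //.
  have br : `|als - al| < r.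
    by rewrite ger0_norm ?subr_ge0//; move: lal; rewrite -/als; clear; lra.
  by have := hr al hal br; rewrite ltr_norml => /andP[]; clear; lra.
have lo s : s0 <= s -> 1 / 8 <= U als s.
  by move=> ss; rewrite leNgt; apply/negP => h; apply: nAm; exists s.
have hi s : s0 <= s -> U als s <= 1 / 2.
  by move=> ss; rewrite leNgt; apply/negP => h; apply: nAp; exists s.
have Upos' := Upos als hals; have /andP[al0 _] := hals.
have UB (s : R) : s1 <= s -> U als s <= B.
  move=> ss; have [s0s|ss0] := leP s0 s.
    by have := hi s s0s; clear -B1; lra.
  apply: (@flow_below lam N s1 s0 B als (U als)) => //; last by rewrite ss ltW.
  - by clear -a00 al0; lra.
  - exact: hi.
exists als, s0, B, (U als); split => // s ss.
split; last by rewrite Upos'//= UB.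
by rewrite -(clm als s)//; [exact: dU|rewrite UB// ltW// Upos'].
Qed.

Lemma shooting (lam D : R) : 0 < lam <= 1 -> 1 <= D ->
  exists (al s1 s0 : R) (K K1 K2 K3 u : R -> R) (C : R),
  [/\ [/\ 0 < al, 0 < s1, s1 <= 1 & s1 <= s0],
      forall s : R, [/\ is_derive s 1 K (K1 s), is_derive s 1 K1 (K2 s) & is_derive s 1 K2 (K3 s)],
      forall s : R, 0 <= s <= s1 ->
        [/\ 0 < K s, K1 s <= 0, 0 <= al * K s + (s + 2 * (lam * (D - 1))) * K1 s,
            4 * lam * s * K2 s + (2 * lam * D + s) * K1 s + al * K s = 0 &
            `|K2 s| <= C /\ `|K3 s| <= C] &
      [/\ u s1 = - K1 s1 / K s1,
          forall s : R, s1 <= s -> is_derive s 1 u (riccati lam (lam * (D - 1)) al s (u s)),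
          forall s : R, s1 <= s -> 0 < u s <= C &
          forall s : R, s0 <= s -> 1 / 8 <= u s]].
Proof.
move=> hl D1; have /andP[l0 l1] := hl.
set N := lam * (D - 1).
have N0 : 0 <= N by rewrite mulr_ge0 ?subr_ge0// ltW.
have NE : N = lam * D - lam by rewrite /N; ring.
have lD : 0 < lam * D by rewrite mulr_gt0//; lra.
(* The initial value - K'/K at [s1] is close to al / (2 lam D): about 1/16 for [a0], hence below
   1/8, and at least nearly 2 for [a1], hence above 1. *)
pose a0 := lam * D / 8; pose a1 := 4 * (1 + N).
have a00 : 0 < a0 by rewrite divr_gt0.
have a01 : a0 <= a1 by rewrite /a0 /a1; lra.
have [s1 [C [K [K1 [K2 [K3 [[s10 s11 C0] dK bK b1 lK]]]]]]] := inner_data hl D1 a00 a01.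
pose Q1 al := - K1 al s1 / K al s1.
have ss1 : 0 <= s1 <= s1 by rewrite lexx ltW.
have e0 : a0 / (2 * lam * D) = 1 / 16.
  by rewrite /a0; field; rewrite !gt_eqF//; lra.
have e1 : 2 <= a1 / (2 * lam * D) by rewrite ler_pdivlMr ?mulr_gt0//; rewrite ?/a1; lra.
have [||||] := @outer_data lam D s1 a0 a1 C Q1 hl D1 s10 s11 erefl erefl.
- by move=> al /bK/(_ ss1)[h1 h2 _ _]; rewrite /Q1 divr_gt0//; clear -h1 h2; lra.
- have := b1 a0; rewrite lexx a01 => /(_ isT); rewrite e0 !ler_norml => -[/andP[h1 h2] /andP[h3 h4]].
  by rewrite /Q1 ltr_pdivrMr; clear -h1 h2 h3 h4; lra.
- have := b1 a1; rewrite lexx a01 => /(_ isT); rewrite !ler_norml => -[/andP[h1 h2] /andP[h3 h4]].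
  by rewrite /Q1 ltr_pdivlMr; clear -h1 h2 h3 h4 e1; lra.
- exact: lK.
move=> al [s0 [B [u [hal s10' u1 du u0]]]].
have /andP[al0 _] := hal.
exists al, s1, s0, (K al), (K1 al), (K2 al), (K3 al), u, (Num.max C B).
split.
- by split => //; clear -a00 al0; lra.
- by move=> s; have [] := dK al s hal.
- move=> s hs; have [k1 k2 k3 [k4 k5]] := bK al s hal hs.
  have [_ _ _ ode] := dK al s hal.
  split => //; [by clear -k1; lra|exact: ltW|].
  by split; rewrite le_max ?k4 ?k5.
- split => //.
  + by move=> s /du[].
  + by move=> s /du[_ /andP[-> h]] /=; rewrite le_max h orbT.
Qed.

End shooting.

(** * The radial profile *)

Section profile.
Context {R : realType}.

Lemma eq_of_derive (f g df : R -> R) (a b : R) : a <= b ->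
  (forall x : R, a <= x <= b -> is_derive x 1 f (df x)) ->
  (forall x : R, a <= x <= b -> is_derive x 1 g (df x)) ->
  f a = g a -> f b = g b.
Proof.
move=> ab hf hg e.
have h : `|(f - g) b - (f - g) a| <= 0 * (b - a).
  apply: (@derive_norm_le_cst R (f - g) (fun=> 0)) => // x xab; last by rewrite normr0.
  by rewrite -(subrr (df x)); apply: is_deriveB; [exact: hf|exact: hg].
by move: h; rewrite mul0r normr_le0 !fctE e subrr subr0 subr_eq0 => /eqP.
Qed.

(** The second derivative is pasted first, as one continuous function built with [Num.min] and
    [Num.max], and then integrated twice; this yields two-sided derivatives at the junction without
    one-sided calculus. *)
Lemma glue (s1 : R) (g1 g1' g1'' g2 g2' g2'' : R -> R) : 0 < s1 ->
  (forall s : R, is_derive s 1 g1 (g1' s) /\ is_derive s 1 g1' (g1'' s)) ->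
  continuous g1'' ->
  (forall s : R, s1 <= s -> is_derive s 1 g2 (g2' s) /\ is_derive s 1 g2' (g2'' s)) ->
  continuous (fun s => g2'' (Num.max s s1)) ->
  g1 s1 = g2 s1 -> g1' s1 = g2' s1 -> g1'' s1 = g2'' s1 ->
  exists f f1 f2 : R -> R,
  [/\ forall s : R, 0 <= s -> is_derive s 1 f (f1 s) /\ is_derive s 1 f1 (f2 s),
      forall s : R, 0 <= s <= s1 -> [/\ f s = g1 s, f1 s = g1' s & f2 s = g1'' s] &
      forall s : R, s1 <= s -> [/\ f s = g2 s, f1 s = g2' s & f2 s = g2'' s]].
Proof.
move=> s10 d1 c1 d2 c2 e0 e1 e2.
pose f2 s := g1'' (Num.min s s1) + g2'' (Num.max s s1) - g1'' s1.
have cmin : continuous (fun s : R => Num.min s s1).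
  apply: (@lipschitz_continuous _ _ 1) => x y; rewrite mul1r.
  have h := max_lip (- s1) (- x) (- y); rewrite -!oppr_min in h.
  move: h; rewrite -opprD normrN => h; apply: le_trans h _.
  by rewrite -opprD normrN.
have cf2 : continuous f2.
  move=> x; apply: cvgB; last exact: cvg_cst.
  apply: cvgD; last exact: c2.
  by apply: (@continuous_comp _ _ _ (fun s => Num.min s s1) g1''); [exact: cmin|exact: c1].
pose f1 s := g1' 0 + (prim f2 s - prim f2 0).
have df1 (s : R) : -1 < s -> is_derive s 1 f1 (f2 s).
  move=> ss; have h := prim_derive cf2 ss.
  have := is_deriveD (is_derive_cst (g1' 0) s 1) (is_deriveB h (is_derive_cst (prim f2 0) s 1)).
  by rewrite subr0 add0r.
(* Constant to the left of 0, so that [prim] applies to a function continuous on the whole line. *)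
pose f1c (s : R) := f1 (Num.max s 0).
have cf1 : continuous f1c.
  move=> x; apply: (@continuous_comp _ _ _ (fun s : R => Num.max s 0) f1).
    by apply: (@lipschitz_continuous _ _ 1) => y z; rewrite mul1r max_lip.
  apply: is_derive_continuous (df1 _ _).
  by apply: (@lt_le_trans _ _ 0); rewrite ?ltrN10// le_max lexx orbT.
pose f s := g1 0 + (prim f1c s - prim f1c 0).
have df (s : R) : 0 <= s -> is_derive s 1 f (f1 s).
  move=> ss; have h := prim_derive cf1 (lt_le_trans (ltrN10 _) ss).
  have := is_deriveD (is_derive_cst (g1 0) s 1) (is_deriveB h (is_derive_cst (prim f1c 0) s 1)).
  by rewrite subr0 add0r /f1c max_l.
have m1 (x : R) : 0 <= x -> -1 < x by move=> h; exact: lt_le_trans h.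
have f2l (s : R) : s <= s1 -> f2 s = g1'' s.
  by move=> ss; rewrite /f2 min_l// max_r// e2 addrK.
have f2r (s : R) : s1 <= s -> f2 s = g2'' s.
  by move=> ss; rewrite /f2 min_r// max_l// addrC addKr.
have f1l (s : R) : 0 <= s <= s1 -> f1 s = g1' s.
  move=> /andP[s0 ss]; apply: (@eq_of_derive f1 g1' g1'' 0 s) => //.
  - move=> x /andP[x0 xs]; rewrite -f2l ?(le_trans xs)//; exact/df1/m1.
  - by move=> x _; have [] := d1 x.
  - by rewrite /f1 subrr addr0.
have f1r (s : R) : s1 <= s -> f1 s = g2' s.
  move=> ss; apply: (@eq_of_derive f1 g2' g2'' s1 s) => //.
  - move=> x /andP[x0 xs]; rewrite -f2r//; apply/df1/m1; exact: le_trans (ltW s10) x0.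
  - by move=> x /andP[x0 _]; have [] := d2 x x0.
  - by rewrite f1l// lexx ltW.
have fl (s : R) : 0 <= s <= s1 -> f s = g1 s.
  move=> /andP[s0 ss]; apply: (@eq_of_derive f g1 g1' 0 s) => //.
  - move=> x /andP[x0 xs]; rewrite -f1l ?x0 ?(le_trans xs)//; exact/df.
  - by move=> x _; have [] := d1 x.
  - by rewrite /f subrr addr0.
have fr (s : R) : s1 <= s -> f s = g2 s.
  move=> ss; apply: (@eq_of_derive f g2 g2' s1 s) => //.
  - move=> x /andP[x0 xs]; rewrite -f1r//; apply/df; exact: le_trans (ltW s10) x0.
  - by move=> x /andP[x0 _]; have [] := d2 x x0.
  - by rewrite fl// lexx ltW.
exists f, f1, f2; split.
- by move=> s ss; split; [exact: df|exact/df1/m1].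
- by move=> s hs; have /andP[_ ss] := hs; rewrite fl// f1l// f2l.
- by move=> s hs; rewrite fr// f1r// f2r.
Qed.

(** Beyond [s1] the profile is recovered from its logarithmic derivative, as K(s1) times the
    exponential of minus the primitive of [u]. The pieces match to second order because al K + (s1 +
    2 N) K' >= 0 at [s1], where both equations then determine the same second derivative. *)
Lemma profile_pieces (lam D : R) : 0 < lam <= 1 -> 1 <= D ->
  exists (al s1 s0 C : R) (f f1 f2 u : R -> R),
  [/\ [/\ 0 < al, 0 < s1, s1 <= 1, s1 <= s0 & 0 <= C],
      forall s : R, 0 <= s -> is_derive s 1 f (f1 s) /\ is_derive s 1 f1 (f2 s),
      forall s : R, 0 <= s <= s1 ->
        [/\ 0 < f s, f1 s <= 0, 0 <= al * f s + (s + 2 * (lam * (D - 1))) * f1 s,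
            4 * lam * s * f2 s + (2 * lam * D + s) * f1 s + al * f s = 0 &
            `|f2 s| <= C],
      forall s s' : R, 0 <= s -> s <= s' -> s' <= s1 -> `|f2 s' - f2 s| <= C * (s' - s) &
      forall s : R, s1 <= s ->
        [/\ 0 < f s, f1 s = - (u s * f s),
            4 * s * f2 s = - (f s * (pucci lam (al - (s + 2 * (lam * (D - 1))) * u s) - 2 * u s)),
            0 < u s <= C & s0 <= s -> 1 / 8 <= u s]].
Proof.
move=> hl D1; have /andP[l0 l1] := hl.
have [al [s1 [s0 [K [K1 [K2 [K3 [u [C [[al0 s10 s11 s10'] dK hK [u1 du uC u8]]]]]]]]]]] := shooting hl D1.
set N := lam * (D - 1) in hK du *.
have NE : N = lam * D - lam by rewrite /N; ring.
pose ut s := u (Num.max s s1).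
have maxs (s : R) : s1 <= Num.max s s1 by rewrite le_max lexx orbT.
have cmax : continuous (fun s : R => Num.max s s1).
  by apply: (@lipschitz_continuous _ _ 1) => x y; rewrite mul1r max_lip.
have cut : continuous ut.
  move=> x; apply: (@continuous_comp _ _ _ (fun s => Num.max s s1) u); first exact: cmax.
  exact: is_derive_continuous (du _ (maxs _)).
have m1 (x : R) : s1 <= x -> -1 < x by move=> h; apply: lt_le_trans h; apply: lt_trans s10.
pose P := prim ut.
have dP (s : R) : s1 <= s -> is_derive s 1 P (u s).
  by move=> ss; have := prim_derive cut (m1 _ ss); rewrite {2}/ut max_l.
pose fo s := K s1 * expR (- (P s - P s1)).
have dfo (s : R) : s1 <= s -> is_derive s 1 fo (- (u s * fo s)).
  move=> ss; have h : is_derive s 1 (fun x => - (P x - P s1)) (- u s).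
    have := is_deriveN (is_deriveB (dP s ss) (is_derive_cst (P s1) s 1)).
    by rewrite subr0.
  have e := @is_derive1_comp R expR (fun x => - (P x - P s1)) s _ _ (is_derive_expR _) h.
  have := is_deriveZ (K s1) e.
  rewrite (_ : K s1 \*: _ = fo)// => d2; apply: is_derive_eq.
  by rewrite /fo /GRing.scale/=; ring.
have ss1 : 0 <= s1 <= s1 by rewrite lexx ltW.
have [K0 K1n y1 ode1 _] := hK s1 ss1.
have fos1 : fo s1 = K s1 by rewrite /fo subrr oppr0 expR0 mulr1.
pose go1 s := - (u s * fo s).
pose go2 s := - (fo s * (pucci lam (al - (s + 2 * N) * u s) - 2 * u s)) / (4 * s).
have dgo1 (s : R) : s1 <= s -> is_derive s 1 go1 (go2 s).
  move=> ss; have s0' : s != 0 by rewrite gt_eqF// (lt_le_trans s10).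
  have := is_deriveN (is_deriveM (du s ss) (dfo s ss)).
  rewrite (_ : - (u * fo) = go1)// => d2; apply: is_derive_eq.
  by rewrite /go2 /riccati /GRing.scale/=; field.
have cfo : continuous (fun s => fo (Num.max s s1)).
  move=> x; apply: (@continuous_comp _ _ _ (fun s : R => Num.max s s1) fo); first exact: cmax.
  exact: is_derive_continuous (dfo _ (maxs _)).
have cgo2 : continuous (fun s => go2 (Num.max s s1)).
  move=> x; rewrite /go2; apply: cvgM; last first.
    apply: cvgV; first by rewrite gt_eqF// mulr_gt0// (lt_le_trans s10).
    by apply: cvgM; [exact: cvg_cst|exact: cmax].
  apply: cvgN; apply: cvgM; first exact: cfo.
  apply: cvgB; last by apply: cvgM; [exact: cvg_cst|exact: cut].
  apply: (@continuous_comp _ _ _ (fun s => al - (Num.max s s1 + 2 * N) * ut s) (pucci lam)).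
    apply: cvgB; first exact: cvg_cst.
    by apply: cvgM; [apply: cvgD; [exact: cmax|exact: cvg_cst]|exact: cut].
  exact: continuous_pucci.
have [f [f1 [f2 [df fl fr]]]] : exists f f1 f2 : R -> R,
  [/\ forall s : R, 0 <= s -> is_derive s 1 f (f1 s) /\ is_derive s 1 f1 (f2 s),
      forall s : R, 0 <= s <= s1 -> [/\ f s = K s, f1 s = K1 s & f2 s = K2 s] &
      forall s : R, s1 <= s -> [/\ f s = fo s, f1 s = go1 s & f2 s = go2 s]].
  apply: glue => //.
  - by move=> s; have [] := dK s.
  - move=> s; have [_ _ h] := dK s; exact: is_derive_continuous h.
  - by move=> s ss; split; [exact: dfo|exact: dgo1].
  - by rewrite /go1 fos1 u1; field; rewrite gt_eqF.
  - rewrite /go2 fos1 u1 pucci_pos//; last first.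
      have -> : al - (s1 + 2 * N) * (- K1 s1 / K s1) = (al * K s1 + (s1 + 2 * N) * K1 s1) / K s1.
        by field; rewrite gt_eqF.
      by rewrite divr_ge0// ltW.
    have ode2 : 4 * lam * s1 * K2 s1 = - ((2 * lam * D + s1) * K1 s1 + al * K s1).
      by clear -ode1; lra.
    have -> : K2 s1 = (4 * lam * s1 * K2 s1) / (4 * lam * s1) by field; rewrite !gt_eqF.
    by rewrite ode2 NE; field; rewrite !gt_eqF.
exists al, s1, s0, C, f, f1, f2, u.
have C0 : 0 <= C by have /andP[h1 h2] := uC s1 (lexx _); apply: le_trans h2; exact: ltW.
split => //.
- move=> s hs; have [-> -> ->] := fl s hs.
  by have [? ? ? ? [? ?]] := hK s hs.
- move=> s s' h0 ss h1.
  have [|_ _ ->] := fl s; first by rewrite h0 (le_trans ss).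
  have [|_ _ ->] := fl s'; first by rewrite h1 (le_trans h0).
  apply: (@derive_norm_le_cst _ _ K3) => // x /andP[x0 x1]; first by have [] := dK x.
  have [|_ _ _ _ [_ h]] := hK x; last exact: h.
  by rewrite (le_trans h0)//= (le_trans x1).
- move=> s ss; have [-> -> ->] := fr s ss.
  have s0' : s != 0 by rewrite gt_eqF// (lt_le_trans s10).
  split => //.
  + by rewrite /fo mulr_gt0// expR_gt0.
  + by rewrite /go2; field.
  + exact: uC.
  + exact: u8.
Qed.

End profile.

(** * Exponential decay and regularity of the profile *)

Section profile_decay.
Context {R : realType}.

(** The profile decays at the rate 1/8; half of it is given up to absorb polynomial factors in
    [s]. *)
Definition damp (s : R) : R := expR (- (s / 16)).

Lemma damp_gt0 s : 0 < damp s. Proof. exact: expR_gt0. Qed.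

Lemma damp_le (s s' : R) : s <= s' -> damp s' <= damp s.
Proof. by move=> h; rewrite /damp ler_expR; lra. Qed.

Lemma poly_damp (s : R) : 0 <= s -> (1 + s) ^+ 2 * expR (- (s / 8)) <= 32 ^+ 2 * damp s.
Proof.
move=> s0; rewrite /damp.
have -> : - (s / 8) = - (s / 16) + - (s / 16) by lra.
rewrite expRD mulrA ler_pM2r ?expR_gt0// expRN ler_pdivrMr ?expR_gt0//.
have -> : s / 16 = s / 32 + s / 32 by lra.
rewrite expRD -expr2.
have h := expR_ge1Dx (s / 32).
by rewrite -exprMn; apply: lerXn2r; rewrite ?nnegrE; lra.
Qed.

(** The second derivative is asked to be Lipschitz and no more, as [pucci] has a corner; this
    suffices for a cubic Taylor remainder. *)
Definition tame_decay (f f1 f2 : R -> R) (C : R) :=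
  [/\ forall s : R, 0 <= s -> is_derive s 1 f (f1 s) /\ is_derive s 1 f1 (f2 s),
      forall s : R, 0 <= s -> [/\ `|f s| <= C * damp s, `|f1 s| <= C * damp s & `|f2 s| <= C * damp s] &
      forall s s' : R, 0 <= s -> s <= s' -> `|f2 s' - f2 s| <= C * damp s * (s' - s)].

Lemma inner_ode_pucci (lam D al s x x1 x2 : R) : 0 < lam <= 1 ->
  0 <= al * x + (s + 2 * (lam * (D - 1))) * x1 ->
  4 * lam * s * x2 + (2 * lam * D + s) * x1 + al * x = 0 ->
  al * x + s * x1 + 2 * (lam * (D - 1)) * x1 + Num.max (2 * x1 + 4 * s * x2) (lam * (2 * x1 + 4 * s * x2)) = 0.
Proof.
move=> /andP[l0 l1] y0 ode.
have e : lam * (2 * x1 + 4 * s * x2) = - (al * x + (s + 2 * (lam * (D - 1))) * x1).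
  by clear -ode; lra.
have z0 : 2 * x1 + 4 * s * x2 <= 0.
  by rewrite -(pmulr_rle0 _ l0) e; clear -y0; lra.
rewrite max_r; last by clear -z0 l0 l1; nra.
by rewrite e; ring.
Qed.

Lemma outer_ode_pucci (lam D al s x x1 x2 u : R) : 0 < lam <= 1 -> 0 < x ->
  x1 = - (u * x) ->
  4 * s * x2 = - (x * (pucci lam (al - (s + 2 * (lam * (D - 1))) * u) - 2 * u)) ->
  al * x + s * x1 + 2 * (lam * (D - 1)) * x1 + Num.max (2 * x1 + 4 * s * x2) (lam * (2 * x1 + 4 * s * x2)) = 0.
Proof.
move=> hl x0 h1 h2; have /andP[l0 l1] := hl; set y := al - _ in h2.
have e : 2 * x1 + 4 * s * x2 = - (x * pucci lam y) by rewrite h1 h2; ring.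
rewrite e; have [y0|y0] := leP 0 y.
  rewrite (pucci_pos hl y0) max_r; last first.
    have : 0 <= x * (y / lam) by rewrite mulr_ge0 ?divr_ge0 ?(ltW l0)// ltW.
    by clear -l0 l1; nra.
  by rewrite h1 /y; field; rewrite gt_eqF.
rewrite (pucci_neg hl (ltW y0)) max_l; last first.
  have : x * y <= 0 by rewrite pmulr_rle0// ltW.
  by clear -l0 l1; nra.
by rewrite h1 /y; ring.
Qed.

Lemma pucci_homo (lam x y : R) : 0 <= x -> x * pucci lam y = pucci lam (x * y).
Proof. by move=> x0; rewrite /pucci maxr_pMr// mulrA. Qed.

Lemma profile_exp_decay (f f1 : R -> R) (B s0 : R) : 0 <= s0 ->
  (forall s : R, 0 <= s -> is_derive s 1 f (f1 s)) ->
  (forall s : R, 0 <= s -> 0 < f s) -> (forall s : R, 0 <= s -> f1 s <= 0) ->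
  (forall s : R, s0 <= s -> f1 s <= - (1 / 8 * f s)) ->
  forall s : R, 0 <= s -> f s <= f 0 * expR (s0 / 8) * expR (- (s / 8)).
Proof.
move=> s00 df fp f1n f8 s ss.
have mono (a b : R) : 0 <= a -> a <= b -> f b <= f a.
  move=> a0 ab; rewrite -lerN2.
  apply: (@derive_nondecreasing _ (- f) (fun x => - f1 x)) => // x /andP[x0 _].
    by apply: is_deriveN; apply: df; exact: le_trans x0.
  by rewrite oppr_ge0 f1n// (le_trans a0).
rewrite -mulrA -expRD; have [h|h] := leP s s0.
  apply: le_trans (mono 0 s (lexx _) ss) _; rewrite ler_peMr ?(ltW (fp _ _))//.
  by rewrite -[leLHS]expR0 ler_expR; lra.
pose g x := f x * expR (1 / 8 * (x - s0)).
have : - g s0 <= - g s.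
  pose dg x := f1 x * expR (1 / 8 * (x - s0)) + f x * (1 / 8 * expR (1 / 8 * (x - s0))).
  apply: (@derive_nondecreasing _ (- g) (- dg)); first exact: ltW.
    move=> x /andP[x0 _]; apply: is_deriveN.
    have := is_deriveM (df x (le_trans s00 x0)) (is_derive_expR_affine (1 / 8) s0 x).
    rewrite (_ : f * _ = g)// => d2; apply: is_derive_eq.
    by rewrite /dg /GRing.scale/=; ring.
  move=> x /andP[x0 _]; rewrite !fctE /dg.
  have := f8 x x0; have := expR_gt0 (1 / 8 * (x - s0)); move: (expR _) => e e0 h1.
  have -> : - (f1 x * e + f x * (1 / 8 * e)) = (- f1 x - 1 / 8 * f x) * e by ring.
  by rewrite mulr_ge0 ?(ltW e0)//; clear -h1; lra.
rewrite lerN2 /g subrr mulr0 expR0 mulr1 => h1.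
have {h1} h2 : f s <= f s0 * expR (- (1 / 8 * (s - s0))).
  by rewrite expRN ler_pdivlMr ?expR_gt0.
apply: le_trans h2 _.
have -> : - (1 / 8 * (s - s0)) = s0 / 8 + - (s / 8) by lra.
by rewrite ler_pM2r ?expR_gt0// mono.
Qed.

(** Decay of the derivatives beyond [s1] is read off the equations: f' = - u f with [u] bounded, and
    4 s f'' is a function of s, f and f'. The Lipschitz bound for f'' follows from the same
    expression. *)
Lemma profile_exists (lam D : R) : 0 < lam <= 1 -> 1 <= D ->
  exists (al C : R) (f f1 f2 : R -> R),
  [/\ 0 < al, 0 <= C, tame_decay f f1 f2 C &
      forall s : R, 0 <= s -> [/\ 0 < f s, f1 s <= 0 &
        al * f s + s * f1 s + 2 * (lam * (D - 1)) * f1 s +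
        Num.max (2 * f1 s + 4 * s * f2 s) (lam * (2 * f1 s + 4 * s * f2 s)) = 0]].
Proof.
move=> hl D1; have /andP[l0 l1] := hl.
have [al [s1 [s0 [C [f [f1 [f2 [u [[al0 s10 s11 s10' C0] df hin hlip hout]]]]]]]]] := profile_pieces hl D1.
have N0 : 0 <= lam * (D - 1) by rewrite mulr_ge0 ?subr_ge0// ltW.
have cases (s : R) : 0 <= s -> (0 <= s <= s1) \/ s1 <= s.
  by move=> h; have [?|/ltW ?] := leP s s1; [left; rewrite h|right].
have sgn (s : R) : 0 <= s -> [/\ 0 < f s, f1 s <= 0 &
    al * f s + s * f1 s + 2 * (lam * (D - 1)) * f1 s +
    Num.max (2 * f1 s + 4 * s * f2 s) (lam * (2 * f1 s + 4 * s * f2 s)) = 0].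
  move=> /cases[/hin[? ? ? ? _]|/hout[h1 h2 h3 /andP[h4 _] _]].
    by split => //; exact: inner_ode_pucci.
  split => //; last exact: outer_ode_pucci h3.
  by rewrite h2 oppr_le0 mulr_ge0 ?(ltW h1) ?(ltW h4).
have sgn' := sgn.
set N := lam * (D - 1) in N0 hin hout sgn.
have s00 : 0 <= s0 by rewrite (le_trans (ltW s10)).
have [F0 F00 fdec] : exists2 F0, 0 <= F0 & forall s : R, 0 <= s -> f s <= F0 * expR (- (s / 8)).
  exists (f 0 * expR (s0 / 8)).
    by rewrite mulr_ge0 ?expR_ge0//; have [/ltW] := sgn 0 (lexx _).
  apply: (@profile_exp_decay f f1 C s0) => //.
  - by move=> s /df[].
  - by move=> s /sgn[].
  - by move=> s /sgn[].
  - move=> s ss; have [h1 h2 _ _ h3] := hout s (le_trans s10' ss).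
    have := h3 ss; rewrite h2; clear -h1; nra.
clearbody N.
pose A1 := C; pose A2 := ((al + (1 + 2 * N) * C) / lam + 2 * C) / (4 * s1).
have A10 : 0 <= A1 by [].
have A20 : 0 <= A2.
  rewrite /A2 divr_ge0 ?mulr_ge0 ?(ltW s10)// addr_ge0 ?mulr_ge0// ?invr_ge0 ?(ltW l0)//.
  by rewrite addr_ge0 ?mulr_ge0 ?(ltW al0)//; clear -N0; lra.
have fo (s : R) : s1 <= s -> `|f1 s| <= A1 * f s /\ `|f2 s| <= A2 * (1 + s) * f s.
  move=> ss; have [h1 h2 h3 /andP[u0 uC] _] := hout s ss.
  have sp : 0 < s by exact: lt_le_trans ss.
  split.
    by rewrite h2 normrN normrM !gtr0_norm// ler_pM2r.
  have -> : f2 s = - (f s * (pucci lam (al - (s + 2 * N) * u s) - 2 * u s)) / (4 * s).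
    by rewrite -h3; field; rewrite gt_eqF.
  rewrite normrM normrN normrM (gtr0_norm h1) normfV (gtr0_norm (_ : 0 < 4 * s)) ?mulr_gt0//.
  have e1 : `|pucci lam (al - (s + 2 * N) * u s) - 2 * u s| <=
      ((al + (1 + 2 * N) * C) / lam + 2 * C) * (1 + s).
    apply: le_trans (ler_normB _ _) _; rewrite [leRHS]mulrDl; apply: lerD; last first.
      by rewrite gtr0_norm ?mulr_gt0//; clear -uC C0 sp; nra.
    apply: le_trans (pucci_norm_le _ hl) _; rewrite mulrAC ler_pM2r ?invr_gt0//.
    apply: le_trans (ler_normB _ _) _.
    rewrite (gtr0_norm al0) normrM (gtr0_norm u0) ger0_norm; last by clear -sp N0; lra.
    have g1 : (s + 2 * N) * u s <= (s + 2 * N) * C by rewrite ler_wpM2l//; clear -sp N0; lra.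
    have g2 : 0 <= al * s by rewrite mulr_ge0// ltW.
    have g3 : 0 <= N * s * C by rewrite !mulr_ge0// ltW.
    have g4 : 0 <= C by [].
    by clear -g1 g2 g3 g4; lra.
  have e2 : (4 * s)^-1 <= (4 * s1)^-1 by rewrite lef_pV2 ?posrE ?mulr_gt0// ler_pM2l.
  have -> : A2 * (1 + s) * f s = f s * (((al + (1 + 2 * N) * C) / lam + 2 * C) * (1 + s)) * (4 * s1)^-1.
    by rewrite /A2; ring.
  apply: ler_pM => //; rewrite ?mulr_ge0 ?(ltW h1) ?invr_ge0 ?mulr_ge0 ?(ltW sp)//.
  by rewrite ler_pM2l.
pose T := 32 ^+ 2 * F0.
have T0 : 0 <= T by rewrite mulr_ge0// exprn_ge0.
have Tdec (s : R) : 0 <= s -> (1 + s) ^+ 2 * f s <= T * damp s.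
  move=> ss; have h := poly_damp ss.
  apply: (@le_trans _ _ ((1 + s) ^+ 2 * (F0 * expR (- (s / 8))))).
    by rewrite ler_wpM2l ?sqr_ge0 ?fdec.
  rewrite mulrCA; have -> : T * damp s = F0 * (32 ^+ 2 * damp s) by rewrite /T mulrAC mulrC.
  by rewrite ler_wpM2l.
have sq (s : R) : 0 <= s -> 1 <= (1 + s) ^+ 2 /\ 1 + s <= (1 + s) ^+ 2.
  by move=> ss; split; rewrite expr2; clear -ss; nra.
have fT (s : R) : 0 <= s -> f s <= T * damp s.
  move=> ss; apply: le_trans (Tdec s ss); have [h _] := sq s ss.
  by rewrite ler_peMl//; have [/ltW] := sgn s ss.
have f1T (s : R) : s1 <= s -> `|f1 s| <= A1 * T * damp s.
  move=> ss; have [h _] := fo s ss; apply: le_trans h _.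
  by rewrite -mulrA ler_wpM2l// fT// (le_trans (ltW s10)).
have f2T (s : R) : s1 <= s -> (1 + s) * `|f2 s| <= A2 * T * damp s.
  move=> ss; have [_ h] := fo s ss; have s0' := le_trans (ltW s10) ss.
  apply: (@le_trans _ _ ((1 + s) * (A2 * (1 + s) * f s))).
    by rewrite ler_wpM2l//; clear -s0'; lra.
  have -> : (1 + s) * (A2 * (1 + s) * f s) = A2 * ((1 + s) ^+ 2 * f s) by ring.
  by rewrite -mulrA ler_wpM2l// Tdec.
have dpos := damp_gt0.
pose D2 := A2 * T.
have D20 : 0 <= D2 by rewrite mulr_ge0.
have f2T' (s : R) : s1 <= s -> `|f2 s| <= D2 * damp s.
  move=> ss; apply: le_trans (f2T s ss); rewrite ler_peMl// lerDl.
  exact: le_trans (ltW s10) ss.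
pose E1 := (al + 1) * (A1 * T) + (1 + 2 * N) * D2.
have E10 : 0 <= E1.
  by rewrite /E1 addr_ge0// mulr_ge0// ?mulr_ge0//; clear -al0 N0; lra.
(* Beyond [s1] one has f'' = - n / (4 s), and [n] is Lipschitz because [pucci] is. *)
pose n s := pucci lam (al * f s + (s + 2 * N) * f1 s) + 2 * f1 s.
have nE (s : R) : s1 <= s -> n s = - (4 * s * f2 s).
  move=> ss; have [h1 h2 h3 _ _] := hout s ss; rewrite h3 opprK mulrBr pucci_homo ?(ltW h1)//.
  by rewrite /n h2; congr (pucci _ _ + _); ring.
have lip2 (s s' : R) : s1 <= s -> s <= s' ->
    `|f2 s' - f2 s| <= ((E1 / lam + 2 * D2) / (4 * s1) + D2 / s1) * damp s * (s' - s).
  move=> ss ss'; have ss1' := le_trans ss ss'.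
  have sp : 0 < s by exact: lt_le_trans ss.
  have sp' : 0 < s' by exact: lt_le_trans ss1'.
  have x0 (x : R) : s <= x -> 0 <= x by move=> h; exact: le_trans (ltW sp) h.
  have d1 : `|f1 s' - f1 s| <= D2 * damp s * (s' - s).
    apply: (@derive_norm_le_cst _ _ f2) => // x /andP[x1 x2].
      by have [] := df x (x0 _ x1).
    apply: le_trans (f2T' _ (le_trans ss x1)) _; rewrite ler_wpM2l//; exact: damp_le.
  have d2 : `|(al * f s' + (s' + 2 * N) * f1 s') - (al * f s + (s + 2 * N) * f1 s)| <= E1 * damp s * (s' - s).
    apply: (@derive_norm_le_cst _ (fun x => al * f x + (x + 2 * N) * f1 x)
      (fun x => al * f1 x + (f1 x + (x + 2 * N) * f2 x))) => // x /andP[x1 x2].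
      have [g1 g2] := df x (x0 _ x1).
      have g3 : is_derive x 1 (id + cst (2 * N) : R -> R) (1 + 0) by apply: is_deriveD.
      have := is_deriveD (is_deriveZ al g1) (is_deriveM g3 g2).
      rewrite (_ : al \*: f + _ = fun x => al * f x + (x + 2 * N) * f1 x)// => g4.
      by apply: is_derive_eq; rewrite /GRing.scale/= !fctE; ring.
    have x1s := le_trans ss x1.
    have k1 := f1T x x1s; have k2 := f2T x x1s; have dx := damp_le x1.
    have k3 : `|al * f1 x + (f1 x + (x + 2 * N) * f2 x)| <= (al + 1) * `|f1 x| + (1 + 2 * N) * ((1 + x) * `|f2 x|).
      have -> : al * f1 x + (f1 x + (x + 2 * N) * f2 x) = (al + 1) * f1 x + (x + 2 * N) * f2 x by ring.
      apply: le_trans (ler_normD _ _) _; rewrite !normrM.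
      rewrite (ger0_norm (_ : 0 <= al + 1)); last by clear -al0; lra.
      have xx := x0 _ x1.
      rewrite (ger0_norm (_ : 0 <= x + 2 * N)); last by clear -N0 xx; lra.
      by rewrite lerD2l mulrA ler_wpM2r//; clear -N0 xx; nra.
    apply: le_trans k3 _.
    have k4 : (al + 1) * `|f1 x| <= (al + 1) * (A1 * T * damp x) by rewrite ler_wpM2l//; clear -al0; lra.
    have k5 : (1 + 2 * N) * ((1 + x) * `|f2 x|) <= (1 + 2 * N) * (D2 * damp x).
      by rewrite ler_wpM2l//; clear -N0; lra.
    apply: le_trans (lerD k4 k5) _.
    have -> : (al + 1) * (A1 * T * damp x) + (1 + 2 * N) * (D2 * damp x) = E1 * damp x.
      by rewrite /E1; ring.
    by rewrite ler_wpM2l.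
  have d3 : `|n s' - n s| <= (E1 / lam + 2 * D2) * damp s * (s' - s).
    rewrite /n; set p' := pucci _ _; set p := pucci _ (_ + (s + _) * _).
    have -> : p' + 2 * f1 s' - (p + 2 * f1 s) = (p' - p) + 2 * (f1 s' - f1 s) by ring.
    apply: le_trans (ler_normD _ _) _.
    have -> : (E1 / lam + 2 * D2) * damp s * (s' - s) =
      E1 * damp s * (s' - s) / lam + 2 * (D2 * damp s * (s' - s)) by ring.
    apply: lerD; last by rewrite normrM (ger0_norm (_ : 0 <= 2))// ler_pM2l.
    by apply: le_trans (pucci_lip _ _ hl) _; rewrite ler_pM2r ?invr_gt0.
  have -> : f2 s' - f2 s = - (n s' - n s) / (4 * s) - f2 s' * (s' - s) / s.
    by rewrite !nE//; field; rewrite gt_eqF.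
  apply: le_trans (ler_normB _ _) _.
  have -> : ((E1 / lam + 2 * D2) / (4 * s1) + D2 / s1) * damp s * (s' - s) =
    (E1 / lam + 2 * D2) * damp s * (s' - s) / (4 * s1) + D2 * damp s * (s' - s) / s1 by ring.
  have sd : 0 <= s' - s by rewrite subr_ge0.
  apply: lerD; rewrite normrM normfV.
    rewrite normrN (gtr0_norm (_ : 0 < 4 * s)) ?mulr_gt0//.
    by apply: ler_pM => //; rewrite ?invr_ge0 ?mulr_ge0 ?(ltW sp)// lef_pV2 ?posrE ?mulr_gt0// ler_pM2l.
  rewrite normrM (gtr0_norm sp) (ger0_norm sd).
  apply: ler_pM => //; rewrite ?mulr_ge0// ?invr_ge0 ?(ltW sp)//; last by rewrite lef_pV2 ?posrE.
  rewrite ler_wpM2r//; apply: le_trans (f2T' _ ss1') _.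
  by rewrite ler_wpM2l// damp_le.
(* Since [s1 <= 1], [damp] is at least [e1] on [[0, s1]]; constant bounds there become damped ones
   at the price of a factor [e1^-1]. *)
pose e1 := damp 1; have e10 : 0 < e1 by exact: dpos.
have Ce : 0 <= C / e1 by rewrite divr_ge0// ltW.
have in1 (s M : R) : s <= s1 -> 0 <= M -> M <= M / e1 * damp s.
  move=> ss M0; rewrite -mulrA ler_peMr// mulrC ler_pdivlMr// mul1r; apply: damp_le.
  exact: le_trans s11.
pose L2 := (E1 / lam + 2 * D2) / (4 * s1) + D2 / s1.
have L20 : 0 <= L2.
  have q1 : 0 <= E1 / lam by apply: divr_ge0 => //; exact: ltW.
  rewrite /L2; apply: addr_ge0; apply: divr_ge0 => //; last exact: ltW.
    by clear -q1 D20; lra.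
  by clear -s10; lra.
have A1T : 0 <= A1 * T by rewrite mulr_ge0.
exists al, (T + A1 * T + D2 + C / e1 + L2), f, f1, f2; split => //.
  by clear -T0 A1T D20 Ce L20; lra.
have bw (x y s : R) : 0 <= y -> x <= y * damp s -> y <= T + A1 * T + D2 + C / e1 + L2 ->
   x <= (T + A1 * T + D2 + C / e1 + L2) * damp s.
  by move=> y0 xy yle; apply: le_trans xy _; rewrite ler_pM2r.
split => //.
- move=> s ss; split.
  + apply: bw T0 _ _; last by clear -A1T D20 Ce L20; lra.
    by rewrite gtr0_norm ?fT//; have [] := sgn s ss.
  + have [hs|hs] := cases s ss; last first.
      by apply: bw A1T (f1T _ hs) _; clear -T0 D20 Ce L20; lra.
    have /andP[_ h] := hs.
    apply: (@bw _ (A1 * T + C / e1)); [exact: addr_ge0| |by clear -T0 D20 L20; lra].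
    have -> : f1 s = f1 s1 - (f1 s1 - f1 s) by ring.
    apply: le_trans (ler_normB _ _) _; rewrite mulrDl; apply: lerD.
      by apply: le_trans (f1T _ (lexx _)) _; rewrite ler_wpM2l// damp_le.
    apply: (@le_trans _ _ C); last exact: in1.
    apply: (@le_trans _ _ (C * (s1 - s))).
      apply: (@derive_norm_le_cst _ _ f2) => // x /andP[x1 x2].
        by have [] := df x (le_trans ss x1).
      have xs : 0 <= x <= s1 by rewrite x2 (le_trans ss).
      by have [] := hin x xs.
    by rewrite ler_piMr//; clear -s11 ss; lra.
  + have [hs|hs] := cases s ss; last first.
      by apply: bw D20 (f2T' _ hs) _; clear -T0 A1T Ce L20; lra.
    have /andP[_ h] := hs.
    apply: (@bw _ (C / e1)) => //; last by clear -T0 D20 L20 A1T; lra.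
    by apply: le_trans (in1 _ _ h C0); have [] := hin s hs.
- move=> s s' ss ss'.
  suff : `|f2 s' - f2 s| <= (C / e1 + L2) * damp s * (s' - s).
    move=> h; apply: le_trans h _; rewrite ler_wpM2r ?subr_ge0// ler_pM2r//.
    by clear -T0 D20 A1T; lra.
  have [s1s|ss1] := leP s1 s.
    apply: le_trans (lip2 s s' s1s ss') _; rewrite -/L2 ler_wpM2r ?subr_ge0// ler_pM2r//.
    by clear -Ce; lra.
  have k1 := in1 s C (ltW ss1) C0.
  have [s1s'|ss1'] := leP s' s1.
    apply: le_trans (hlip s s' ss ss' s1s') _; rewrite ler_wpM2r ?subr_ge0//.
    apply: le_trans k1 _; rewrite ler_pM2r//; clear -L20; lra.
  have g1 := hlip s s1 ss (ltW ss1) (lexx _).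
  have g2 := lip2 s1 s' (lexx _) (ltW ss1').
  have -> : f2 s' - f2 s = (f2 s' - f2 s1) + (f2 s1 - f2 s) by ring.
  apply: le_trans (ler_normD _ _) _; apply: le_trans (lerD g2 g1) _; rewrite -/L2.
  have d1 := damp_le (ltW ss1).
  have q1 : L2 * damp s1 * (s' - s1) <= L2 * damp s * (s' - s1).
    by rewrite ler_wpM2r ?subr_ge0 ?(ltW ss1')// ler_wpM2l.
  have q2 : C * (s1 - s) <= C / e1 * damp s * (s1 - s) by rewrite ler_wpM2r// subr_ge0 ltW.
  have q3 : 0 <= L2 * damp s * (s1 - s) by rewrite !mulr_ge0 ?subr_ge0 ?(ltW ss1) ?(ltW (dpos s)).
  have q4 : 0 <= C / e1 * damp s * (s' - s1).
    by rewrite mulr_ge0 ?subr_ge0 ?(ltW ss1')// mulr_ge0// ltW.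
  clear -q1 q2 q3 q4; move: (C / e1) q2 q4 => Z q2 q4; lra.
Qed.

End profile_decay.

(** * Super- and subsolutions *)

Section tame.
Context {R : realType}.

Definition wt (m : nat) (s : R) : R := ((1 + s) ^+ m)^-1.

Lemma wt_gt0 m s : 0 <= s -> 0 < wt m s.
Proof. by move=> s0; rewrite invr_gt0 exprn_gt0//; lra. Qed.

Lemma wt_le m (c s t : R) : 0 <= s -> 0 <= t -> 0 < c -> 1 + s <= c * (1 + t) ->
  wt m t <= c ^+ m * wt m s.
Proof.
move=> s0 t0 c0 h; rewrite /wt mulrC ler_pdivlMl ?exprn_gt0//; last lra.
rewrite ler_pdivrMr ?exprn_gt0//; last lra.
by rewrite -exprMn lerXn2r ?nnegrE//; [lra|rewrite mulr_ge0//; lra].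
Qed.

(** Each derivative gains a factor 1 / (1 + s), as for the weight itself. Profile and corrector both
    belong to this class, so the Taylor estimates are proved once for both. *)
Definition tame (m : nat) (h h1 h2 : R -> R) (C : R) :=
  [/\ forall s : R, 0 <= s -> is_derive s 1 h (h1 s) /\ is_derive s 1 h1 (h2 s),
      forall s : R, 0 <= s -> [/\ `|h s| <= C * wt m s, (1 + s) * `|h1 s| <= C * wt m s &
          (1 + s) ^+ 2 * `|h2 s| <= C * wt m s] &
      forall s s' : R, 0 <= s -> s <= s' ->
        (1 + s) ^+ 2 * `|h2 s' - h2 s| <= C * wt m s * (s' - s)].

Lemma taylor1 (k k1 k2 : R -> R) (a b L : R) : a <= b -> 0 <= L ->
  (forall x : R, a <= x <= b -> is_derive x 1 k (k1 x) /\ is_derive x 1 k1 (k2 x)) ->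
  (forall x : R, a <= x <= b -> `|k2 x| <= L) ->
  `|k b - k a - k1 a * (b - a)| <= L * (b - a) ^+ 2.
Proof.
move=> ab L0 dk bk.
pose g x := k x - k1 a * x.
have -> : k b - k a - k1 a * (b - a) = g b - g a by rewrite /g; ring.
have -> : L * (b - a) ^+ 2 = L * (b - a) * (b - a) by ring.
apply: (@derive_norm_le_cst _ g (fun x => k1 x - k1 a)) => // x /andP[ax xb].
  have xab : a <= x <= b by rewrite ax.
  have [h _] := dk x xab.
  have h2 : is_derive x 1 (k1 a \*: (@id R)) (k1 a *: 1) by apply: is_deriveZ.
  have := is_deriveB h h2; rewrite (_ : k - _ = g)// => h3.
  by apply: is_derive_eq; rewrite /GRing.scale/= mulr1.
apply: (@le_trans _ _ (L * (x - a))); last by rewrite ler_wpM2l//; lra.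
apply: (@derive_norm_le_cst _ k1 k2) => // y /andP[ay yx].
  by have [] : is_derive y 1 k (k1 y) /\ is_derive y 1 k1 (k2 y) by apply: dk; rewrite ay (le_trans yx).
by apply: bk; rewrite ay (le_trans yx).
Qed.

Lemma taylor2 (k k1 k2 : R -> R) (L : R) : 0 <= L ->
  (forall x : R, 0 <= x <= 1 -> is_derive x 1 k (k1 x) /\ is_derive x 1 k1 (k2 x)) ->
  (forall x : R, 0 <= x <= 1 -> `|k2 x - k2 0| <= L) ->
  `|k 1 - k 0 - k1 0 - 1 / 2 * k2 0| <= L.
Proof.
move=> L0 dk bk.
have dsq (x c : R) : is_derive x 1 (fun x => c * x ^+ 2) (2 * c * x).
  have h : is_derive x 1 (@id R * @id R) (x *: 1 + x *: 1) by apply: is_deriveM.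
  have := is_deriveZ c h.
  rewrite (_ : c \*: _ = fun x => c * x ^+ 2)//.
  by move=> h2; apply: is_derive_eq; rewrite /GRing.scale/=; ring.
have dlin (x c : R) : is_derive x 1 (fun x => c * x) c.
  have h : is_derive x 1 (c \*: @id R) (c *: 1) by apply: is_deriveZ.
  by move: h; rewrite /GRing.scale/= mulr1.
have := @taylor1 (fun x => k x - 1 / 2 * k2 0 * x ^+ 2) (fun x => k1 x - 2 * (1 / 2 * k2 0) * x)
  (fun x => k2 x - 2 * (1 / 2 * k2 0)) 0 1 L ler01 L0.
have -> : L * (1 - 0) ^+ 2 = L by ring.
have -> : k 1 - 1 / 2 * k2 0 * 1 ^+ 2 - (k 0 - 1 / 2 * k2 0 * 0 ^+ 2) -
  (k1 0 - 2 * (1 / 2 * k2 0) * 0) * (1 - 0) = k 1 - k 0 - k1 0 - 1 / 2 * k2 0 by ring.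
apply => x xx.
  have [h1 h2] := dk x xx; split.
    by apply: is_deriveB => //; exact: dsq.
  by apply: is_deriveB => //; exact: dlin.
have -> : 2 * (1 / 2 * k2 0) = k2 0 by field.
exact: bk.
Qed.

Lemma wt_near m (s t : R) : 0 <= s -> 0 <= t -> 1 + s <= 3 * (1 + t) ->
  wt m t / (1 + t) ^+ 2 <= 3 ^+ (m + 2) * wt m s / (1 + s) ^+ 2.
Proof.
move=> s0 t0 h.
have e (x : R) : wt m x / (1 + x) ^+ 2 = wt (m + 2) x.
  by rewrite /wt exprD [RHS]invfM.
by rewrite -mulrA !e; apply: wt_le.
Qed.

(** With z = |x| / sqrt t, p = x . Delta / t and e = |Delta| / sqrt t, the argument z^2 + 2 p + e^2
    is |x + Delta|^2 / t. This is Taylor's formula along the segment from x to x + Delta, on which 1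
    + s drops at most by a factor 3, so that the weight can be evaluated at the starting point. *)
Lemma tame_space m (h h1 h2 : R -> R) (C : R) : tame m h h1 h2 C -> 0 <= C ->
  forall z p e : R, 0 <= z -> 0 <= e <= 1 -> `|p| <= z * e ->
  `|h (z ^+ 2 + 2 * p + e ^+ 2) - h (z ^+ 2) - h1 (z ^+ 2) * (2 * p + e ^+ 2)
    - 2 * h2 (z ^+ 2) * p ^+ 2| <= 60 * 3 ^+ (m + 2) * C * wt m (z ^+ 2) * e ^+ 3.
Proof.
move=> [dh bh lh] C0 z p e z0 /andP[e0 e1] pze.
set s := z ^+ 2; pose st (x : R) := s + 2 * x * p + x ^+ 2 * e ^+ 2.
have s0 : 0 <= s by rewrite sqr_ge0.
have /andP[p1 p2] : - (z * e) <= p <= z * e by rewrite -ler_norml.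
have st_ge (x : R) : 0 <= x <= 1 -> (z - x * e) ^+ 2 <= st x.
  move=> /andP[x0 x1]; rewrite /st /s; have : 0 <= x * (p + z * e) by rewrite mulr_ge0//; lra.
  by clear; rewrite !expr2; nra.
have st0 (x : R) : 0 <= x <= 1 -> 0 <= st x.
  by move=> hx; apply: le_trans (st_ge x hx); rewrite sqr_ge0.
have st3 (x : R) : 0 <= x <= 1 -> 1 + s <= 3 * (1 + st x).
  move=> hx; have := st_ge x hx; have /andP[x0 x1] := hx.
  have xe : 0 <= x * e <= 1 by rewrite mulr_ge0//= mulr_ile1.
  move: (x * e) xe => y /andP[y0 y1]; rewrite /s; clear -y0 y1.
  have : 0 <= (z - 2 * y) ^+ 2 by rewrite sqr_ge0.
  have : y ^+ 2 <= 1 by rewrite expr2 mulr_ile1.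
  by have := sqr_ge0 (z - y); rewrite !expr2; nra.
have std (x : R) : 0 <= x <= 1 -> `|st x - s| <= (2 * z + 1) * e.
  move=> /andP[x0 x1]; have -> : st x - s = x * (2 * p + x * e ^+ 2) by rewrite /st; ring.
  rewrite normrM (ger0_norm x0).
  have xe : 0 <= x * e ^+ 2 <= e.
    rewrite mulr_ge0 ?sqr_ge0//= expr2 mulrA ler_piMl//; exact: mulr_ile1.
  have b : `|2 * p + x * e ^+ 2| <= (2 * z + 1) * e.
    by move: xe => /andP[? ?]; rewrite ler_norml; apply/andP; split; lra.
  by apply: le_trans b; rewrite ler_piMl.
pose q (x : R) := 2 * p + 2 * x * e ^+ 2.
have q0 : q 0 = 2 * p by rewrite /q mulr0 mul0r addr0.
have ze0 : 0 <= z * e by rewrite mulr_ge0.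
have e2 : 0 <= e ^+ 2 <= e by rewrite sqr_ge0 expr2 ler_piMl.
have qb (x : R) : 0 <= x <= 1 -> `|q x| <= 2 * (z + 1) * e.
  move=> /andP[x0 x1]; have : 0 <= x * e ^+ 2 <= e.
    by move: e2 => /andP[? ?]; rewrite mulr_ge0//= (le_trans _ (_ : e ^+ 2 <= e))// ler_piMl.
  by move=> /andP[? ?]; rewrite /q ler_norml; apply/andP; split; lra.
pose W := 3 ^+ (m + 2) * wt m s / (1 + s) ^+ 2.
have wp : 0 < wt m s by exact: wt_gt0.
have s1p : 0 < (1 + s) ^+ 2 by rewrite exprn_gt0//; lra.
have W0 : 0 <= W by rewrite divr_ge0 ?(ltW s1p)// mulr_ge0 ?(ltW wp)// exprn_ge0.
have h2b (t : R) : 0 <= t -> 1 + s <= 3 * (1 + t) -> `|h2 t| <= C * W.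
  move=> t0 st'; have [_ _ b] := bh t t0; have tp : 0 < (1 + t) ^+ 2 by rewrite exprn_gt0//; lra.
  apply: (@le_trans _ _ (C * (wt m t / (1 + t) ^+ 2))).
    by rewrite mulrA ler_pdivlMr// mulrC.
  by rewrite ler_wpM2l// wt_near.
have h2l (x : R) : 0 <= x <= 1 -> `|h2 (st x) - h2 s| <= C * W * ((2 * z + 1) * e).
  move=> hx.
  have gen (a b : R) : 0 <= a -> a <= b -> 1 + s <= 3 * (1 + a) -> `|h2 b - h2 a| <= C * W * (b - a).
    move=> a0 ab ha; have b2 := lh a b a0 ab; have tp : 0 < (1 + a) ^+ 2 by rewrite exprn_gt0//; lra.
    apply: (@le_trans _ _ (C * (wt m a / (1 + a) ^+ 2) * (b - a))).
      have -> : C * (wt m a / (1 + a) ^+ 2) * (b - a) = C * wt m a * (b - a) / (1 + a) ^+ 2 by ring.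
      by rewrite ler_pdivlMr// mulrC.
    by rewrite ler_wpM2r ?subr_ge0// ler_wpM2l// wt_near.
  have CW : 0 <= C * W by rewrite mulr_ge0.
  have d := std x hx; have [sx|sx] := leP s (st x).
    apply: le_trans (gen s (st x) s0 sx _) _; first by clear -s0; lra.
    by rewrite ler_wpM2l//; apply: le_trans d; exact: ler_norm.
  rewrite distrC; apply: le_trans (gen (st x) s (st0 _ hx) (ltW sx) (st3 _ hx)) _.
  by rewrite ler_wpM2l//; apply: le_trans d; rewrite distrC; exact: ler_norm.
have h1l (x : R) : 0 <= x <= 1 -> `|h1 (st x) - h1 s| <= C * W * ((2 * z + 1) * e).
  move=> hx.
  have gen (a b : R) : 0 <= a -> a <= b -> 1 + s <= 3 * (1 + a) -> `|h1 b - h1 a| <= C * W * (b - a).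
    move=> a0 ab ha; apply: (@derive_norm_le_cst _ _ h2) => // y /andP[ay yb].
      by have [] := dh y (le_trans a0 ay).
    by apply: h2b; [exact: le_trans ay|clear -ha ay; lra].
  have CW : 0 <= C * W by rewrite mulr_ge0.
  have d := std x hx; have [sx|sx] := leP s (st x).
    apply: le_trans (gen s (st x) s0 sx _) _; first by clear -s0; lra.
    by rewrite ler_wpM2l//; apply: le_trans d; exact: ler_norm.
  rewrite distrC; apply: le_trans (gen (st x) s (st0 _ hx) (ltW sx) (st3 _ hx)) _.
  by rewrite ler_wpM2l//; apply: le_trans d; rewrite distrC; exact: ler_norm.
pose k x := h (st x); pose k1 x := h1 (st x) * q x.
pose k2 x := h2 (st x) * q x ^+ 2 + h1 (st x) * (2 * e ^+ 2).
pose L := 60 * 3 ^+ (m + 2) * C * wt m s * e ^+ 3.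
have L0 : 0 <= L.
  by rewrite /L !mulr_ge0// ?exprn_ge0// ltW.
have stE0 : st 0 = s by rewrite /st; ring.
have stE1 : st 1 = s + 2 * p + e ^+ 2 by rewrite /st; ring.
have dst (x : R) : is_derive x 1 st (q x).
  have g1 : is_derive x 1 (@id R * @id R) (x *: 1 + x *: 1) by apply: is_deriveM.
  have g2 : is_derive x 1 (@id R) 1 by apply: is_derive_id.
  have := is_deriveD (is_deriveD (is_derive_cst s x 1) (is_deriveZ (2 * p) g2)) (is_deriveZ (e ^+ 2) g1).
  have -> : st = cst s + (2 * p) \*: (@id R) + (e ^+ 2) \*: (@id R * @id R).
    by apply/funext => y; rewrite -[RHS]/(s + (2 * p) * y + e ^+ 2 * (y * y)) /st; ring.
  by move=> g3; apply: is_derive_eq; rewrite /q /GRing.scale/=; ring.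
have dq (x : R) : is_derive x 1 q (2 * e ^+ 2).
  have g2 : is_derive x 1 (@id R) 1 by apply: is_derive_id.
  have := is_deriveD (is_derive_cst (2 * p) x 1) (is_deriveZ (2 * e ^+ 2) g2).
  have -> : q = cst (2 * p) + (2 * e ^+ 2) \*: (@id R).
    by apply/funext => y; rewrite -[RHS]/(2 * p + 2 * e ^+ 2 * y) /q; ring.
  by move=> g3; apply: is_derive_eq; rewrite /GRing.scale/=; ring.
have := @taylor2 k k1 k2 L L0.
rewrite /k stE0 stE1 /k1 /k2 stE0 q0.
have -> : h (s + 2 * p + e ^+ 2) - h s - h1 s * (2 * p) -
   1 / 2 * (h2 s * (2 * p) ^+ 2 + h1 s * (2 * e ^+ 2)) =
   h (s + 2 * p + e ^+ 2) - h s - h1 s * (2 * p + e ^+ 2) - 2 * h2 s * p ^+ 2 by field.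
apply => x hx.
  have [g1 g2] := dh (st x) (st0 x hx); split.
    have := @is_derive1_comp R h st x _ _ g1 (dst x).
    by move=> g3; apply: is_derive_eq; rewrite mulrC.
  have g3 := @is_derive1_comp R h1 st x _ _ g2 (dst x).
  have := is_deriveM g3 (dq x).
  rewrite (_ : _ * q = fun x => h1 (st x) * q x)// => g4.
  by apply: is_derive_eq; rewrite /GRing.scale/= expr2; ring.
have -> : h2 (st x) * q x ^+ 2 + h1 (st x) * (2 * e ^+ 2) - (h2 s * (2 * p) ^+ 2 + h1 s * (2 * e ^+ 2)) =
  (h2 (st x) - h2 s) * q x ^+ 2 + h2 s * ((q x - 2 * p) * (q x + 2 * p)) + (h1 (st x) - h1 s) * (2 * e ^+ 2).
  by ring.
pose z1 := z + 1.
have CW : 0 <= C * W by rewrite mulr_ge0.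
have T1 : `|(h2 (st x) - h2 s) * q x ^+ 2| <= C * W * ((2 * z + 1) * e) * (2 * z1 * e) ^+ 2.
  rewrite normrM; apply: ler_pM => //; first exact: h2l.
  by rewrite normrX lerXn2r ?nnegrE ?qb// !mulr_ge0// /z1; lra.
have T2 : `|h2 s * ((q x - 2 * p) * (q x + 2 * p))| <= C * W * (2 * e ^+ 2 * (4 * z1 * e)).
  rewrite normrM; apply: ler_pM => //.
    by apply: h2b => //; lra.
  rewrite normrM; apply: ler_pM => //.
    have -> : q x - 2 * p = 2 * e ^+ 2 * x by rewrite /q; ring.
    have /andP[? ?] := hx; have /andP[? _] := e2.
    by rewrite ger0_norm ?mulr_ge0// ler_piMr// mulr_ge0.
  have g1 := qb x hx; have g2 : `|2 * p| <= 2 * (z + 1) * e by rewrite -q0; apply: qb; rewrite lexx ler01.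
  by apply: le_trans (ler_normD _ _) _; apply: le_trans (lerD g1 g2) _; rewrite /z1; lra.
have T3 : `|(h1 (st x) - h1 s) * (2 * e ^+ 2)| <= C * W * ((2 * z + 1) * e) * (2 * e ^+ 2).
  by rewrite normrM; apply: ler_pM => //; [exact: h1l|rewrite ger0_norm// mulr_ge0// sqr_ge0].
apply: le_trans (ler_normD _ _) _.
apply: le_trans (lerD (le_trans (ler_normD _ _) (lerD T1 T2)) T3) _.
have -> : C * W * ((2 * z + 1) * e) * (2 * z1 * e) ^+ 2 + C * W * (2 * e ^+ 2 * (4 * z1 * e)) +
  C * W * ((2 * z + 1) * e) * (2 * e ^+ 2) =
  C * W * e ^+ 3 * (4 * (2 * z + 1) * z1 ^+ 2 + 8 * z1 + 2 * (2 * z + 1)) by ring.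
have -> : L = C * W * e ^+ 3 * (60 * (1 + s) ^+ 2).
  by rewrite /L /W; field; rewrite gt_eqF//; lra.
apply: ler_wpM2l; first by rewrite mulr_ge0// exprn_ge0.
have zs : z1 ^+ 2 <= 2 * (1 + s).
  by rewrite /z1 /s; have := sqr_ge0 (z - 1); rewrite !expr2; lra.
have z11 : 1 <= z1 by rewrite /z1; lra.
have u1 : 2 * z + 1 <= 2 * z1 by rewrite /z1; lra.
have u2 : z1 <= z1 ^+ 2 by rewrite expr2 ler_peMl//; lra.
have u3 : 1 + s <= (1 + s) ^+ 2 by rewrite expr2 ler_peMl//; lra.
have u4 : (2 * z + 1) * z1 ^+ 2 <= 8 * (1 + s) ^+ 2.
  apply: (@le_trans _ _ (4 * (1 + s) * (2 * (1 + s)))); last by rewrite expr2; lra.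
  by apply: ler_pM => //; rewrite ?sqr_ge0//; lra.
rewrite -(mulrA 4); move: u1 u2 u3 u4 zs.
move: (2 * z + 1) ((1 + s) ^+ 2) (z1 ^+ 2) ((2 * z + 1) * z1 ^+ 2) => Y S Z A.
by clearbody s z1; clear -s0; lra.
Qed.

End tame.

(** * Weights, decaying functions and expansion in time *)

Section tame_examples.
Context {R : realType}.

Lemma wt_S m (s : R) : 0 <= s -> (1 + s) * wt m.+1 s = wt m s.
Proof.
move=> s0; have h : 1 + s != 0 by rewrite gt_eqF//; lra.
by rewrite /wt exprS invfM mulrA divff// mul1r.
Qed.

Lemma wt_SS m (s : R) : 0 <= s -> (1 + s) ^+ 2 * wt m.+2 s = wt m s.
Proof. by move=> s0; rewrite expr2 -mulrA !wt_S. Qed.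

Lemma wt_decr m (s t : R) : 0 <= s -> s <= t -> wt m t <= wt m s.
Proof.
move=> s0 st; rewrite /wt lef_pV2 ?posrE ?exprn_gt0//; [|lra|lra].
by rewrite lerXn2r ?nnegrE//; lra.
Qed.

Lemma wt_derive m (s : R) : 0 <= s -> is_derive s 1 (wt m) (- m%:R * wt m.+1 s).
Proof.
move=> s0; have h : 1 + s != 0 by rewrite gt_eqF//; lra.
have d1 : is_derive s 1 (cst 1 + @id R) (0 + 1) by apply: is_deriveD.
have d2 := is_deriveX m d1.
have E : (cst 1 + @id R) ^+ m = fun y => (1 + y) ^+ m.
  by apply/funext => y; rewrite fctE.
rewrite E in d2.
have hv : (fun y : R => (1 + y) ^+ m) s != 0 by rewrite expf_neq0.
have d3 : is_derive s 1 (wt m) _ := @is_deriveV R (fun y => (1 + y) ^+ m) s _ 1 hv d2.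
apply: is_derive_eq.
rewrite /GRing.scale/= add0r mulr1; case: m d2 hv d3 {E} => [|m] d2 hv d3.
  by rewrite !mul0r mulr0 oppr0 mul0r.
rewrite /wt -[m.+1.-1]/m !exprS /=; field.
by rewrite h expf_neq0.
Qed.

Lemma tame_wt m : tame m (@wt R m) (fun s => - m%:R * wt m.+1 s)
  (fun s => m%:R * m.+1%:R * wt m.+2 s) ((m.+2)%:R ^+ 3).
Proof.
have q1 : 1 <= m.+2%:R :> R by rewrite ler1n.
have q0 : 0 <= m%:R :> R by [].
have qs : m.+1%:R <= m.+2%:R :> R by rewrite ler_nat.
have qm : m%:R <= m.+2%:R :> R by rewrite ler_nat ltnW// ltnW.
have q2 : m.+2%:R <= m.+2%:R ^+ 2 :> R by rewrite expr2 ler_peMl//; lra.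
have q3 : m.+2%:R ^+ 2 <= m.+2%:R ^+ 3 :> R by rewrite (exprS _ 2) ler_peMl// exprn_ge0.
have q4 : m%:R * m.+1%:R <= m.+2%:R ^+ 2 :> R by rewrite expr2; apply: ler_pM.
have q5 : m%:R * m.+1%:R * m.+2%:R <= m.+2%:R ^+ 3 :> R by rewrite exprSr ler_pM2r ?ltr0n.
split.
- move=> s s0; split; first exact: wt_derive.
  have := is_deriveZ (- m%:R) (wt_derive m.+1 s0).
  move=> d; apply: is_derive_eq; rewrite /GRing.scale/=; ring.
- move=> s s0; have w0 := wt_gt0 m s0; have w1 := wt_gt0 m.+1 s0; have w2 := wt_gt0 m.+2 s0.
  split.
  + by rewrite gtr0_norm// ler_peMl ?(ltW w0)//; lra.
  + rewrite normrM normrN !ger0_norm ?(ltW w1)// mulrCA wt_S// ler_wpM2r ?(ltW w0)//.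
    by lra.
  + rewrite normrM !ger0_norm ?mulr_ge0 ?(ltW w2)// mulrCA wt_SS//.
    by rewrite ler_wpM2r ?(ltW w0)//; lra.
- move=> s s' s0 ss'; have w3 := wt_gt0 m.+3 s0; have w0 := wt_gt0 m s0.
  have h : `|m%:R * m.+1%:R * wt m.+2 s' - m%:R * m.+1%:R * wt m.+2 s| <=
      m%:R * m.+1%:R * m.+2%:R * wt m.+3 s * (s' - s).
    apply: (@derive_norm_le_cst _ (fun s => m%:R * m.+1%:R * wt m.+2 s)
      (fun s => m%:R * m.+1%:R * (- m.+2%:R * wt m.+3 s))) => // x /andP[x1 x2].
      by apply: is_deriveZ; apply: wt_derive; exact: le_trans x1.
    have wx := wt_gt0 m.+3 (le_trans s0 x1).
    rewrite !normrM normrN !ger0_norm ?(ltW wx)// mulrA ler_wpM2l ?mulr_ge0//.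
    exact: wt_decr.
  apply: le_trans (ler_wpM2l _ h) _; first by rewrite exprn_ge0//; lra.
  have -> : (1 + s) ^+ 2 * (m%:R * m.+1%:R * m.+2%:R * wt m.+3 s * (s' - s)) =
    m%:R * m.+1%:R * m.+2%:R * ((1 + s) * ((1 + s) * wt m.+3 s)) * (s' - s) by ring.
  rewrite !wt_S// ler_wpM2r ?subr_ge0//.
  apply: (@le_trans _ _ (m.+2%:R ^+ 3 * wt m.+1 s)).
    by rewrite ler_wpM2r// ltW// wt_gt0.
  rewrite ler_wpM2l ?exprn_ge0// -(wt_S m s0) ler_peMl ?(ltW (wt_gt0 _ _))//; lra.
Qed.

Lemma damp_wt n (s : R) : 0 <= s -> damp s <= (16 * n.+1%:R) ^+ n.+1 * wt n.+1 s.
Proof.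
move=> s0; pose N : R := 16 * n.+1%:R.
have n1 : 1 <= n.+1%:R :> R by rewrite ler1n.
have N0 : 0 < N by rewrite /N; lra.
rewrite /damp expRN /wt -/N ler_pdivlMr ?exprn_gt0//; last lra.
rewrite mulrC ler_pdivrMr ?expR_gt0//.
have -> : s / 16 = n.+1%:R * (s / N).
  by rewrite /N; field; rewrite gt_eqF// ltr0n.
rewrite expRM_natl -exprMn; apply: lerXn2r; rewrite ?nnegrE; first lra.
  by rewrite mulr_ge0 ?expR_ge0// ltW.
have := expR_ge1Dx (s / N).
rewrite -(ler_pM2l N0) => h; apply: le_trans h.
have -> : N * (1 + s / N) = N + s by field; rewrite gt_eqF.
by rewrite lerD2r /N; lra.
Qed.

(** Exponential decay gives membership for every [m], which lets [m] be chosen after the exponent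
    and also one unit larger than for the corrector. *)
Lemma tame_of_decay (f f1 f2 : R -> R) (C : R) m : 0 <= C -> tame_decay f f1 f2 C ->
  exists2 C', 0 <= C' & tame m f f1 f2 C'.
Proof.
move=> C0 [df bf lf].
pose A := (16 * m.+2%:R) ^+ m.+2 : R.
have A0 : 0 <= A by rewrite exprn_ge0// mulr_ge0.
have dA (s : R) : 0 <= s -> (1 + s) ^+ 2 * damp s <= A * wt m s.
  move=> s0; have h := @damp_wt m.+1 s s0.
  apply: le_trans (ler_wpM2l _ h) _; first by rewrite exprn_ge0//; lra.
  by rewrite mulrCA wt_SS.
have sq (s : R) : 0 <= s -> 1 <= (1 + s) ^+ 2 /\ 1 + s <= (1 + s) ^+ 2.
  by move=> ss; split; rewrite expr2; clear -ss; nra.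
exists (C * A); first by rewrite mulr_ge0.
split => //.
- move=> s s0; have [b0 b1 b2] := bf s s0; have d := dA s s0; have [k1 k2] := sq s s0.
  have dp := damp_gt0 s.
  have gen (x y : R) : 0 <= y -> y <= (1 + s) ^+ 2 -> `|x| <= C * damp s -> y * `|x| <= C * A * wt m s.
    move=> y0 ys xx; apply: (@le_trans _ _ ((1 + s) ^+ 2 * (C * damp s))); first exact: ler_pM.
    by rewrite mulrCA -mulrA ler_wpM2l.
  split; [rewrite -[X in X <= _]mul1r|..]; apply: gen => //; rewrite ?exprn_ge0//; lra.
- move=> s s' s0 ss'; have h := lf s s' s0 ss'; have d := dA s s0.
  have -> : C * A * wt m s * (s' - s) = C * (A * wt m s) * (s' - s) by ring.
  apply: le_trans (ler_wpM2l _ h) _; first by rewrite exprn_ge0//; lra.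
  have -> : (1 + s) ^+ 2 * (C * damp s * (s' - s)) = C * ((1 + s) ^+ 2 * damp s) * (s' - s) by ring.
  by rewrite ler_wpM2r ?subr_ge0// ler_wpM2l.
Qed.

(** Expansion of t^(-be) h (s / t) at t = 1 with the step [e]: the derivative there is - (be h + s
    h'). In the application [e] is 1/t, one unit of time relative to the current time. *)
Lemma tame_time m (h h1 h2 : R -> R) (C be : R) : tame m h h1 h2 C -> 0 <= C -> 0 <= be ->
  forall s e : R, 0 <= s -> 0 <= e <= 1 ->
  `|(1 + e) `^ (- be) * h (s / (1 + e)) - h s + e * (be * h s + s * h1 s)| <=
  (be + 2) ^+ 2 * 2 ^+ m * C * wt m s * e ^+ 2.
Proof.
move=> [dh bh _] C0 be0 s e s0 /andP[e0 e1].
pose k t := t `^ (- be) * h (s / t).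
pose k1 t := - (t `^ (- be - 1) * (be * h (s / t) + s / t * h1 (s / t))).
pose k2 t := t `^ (- be - 1 - 1) * ((be + 1) * (be * h (s / t) + 2 * (s / t * h1 (s / t))) +
   (s / t) ^+ 2 * h2 (s / t)).
have L0 : 0 <= (be + 2) ^+ 2 * 2 ^+ m * C * wt m s.
  by rewrite mulr_ge0 ?(ltW (wt_gt0 _ _))// mulr_ge0// mulr_ge0 ?sqr_ge0 ?exprn_ge0.
have := @taylor1 _ k k1 k2 1 (1 + e) _ _ L0.
have -> : 1 + e - 1 = e by ring.
have -> : k (1 + e) - k 1 - k1 1 * e =
  (1 + e) `^ (- be) * h (s / (1 + e)) - h s + e * (be * h s + s * h1 s).
  by rewrite /k /k1 !powR1 !divr1; ring.
apply; first by rewrite lerDl.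
- move=> t /andP[t1 t2]; have tp : 0 < t by lra.
  have t0 : t != 0 by rewrite gt_eqF.
  have st : 0 <= s / t by rewrite divr_ge0// ltW.
  have [g1 g2] := dh _ st.
  have p1 : is_derive t 1 ((@powR R)^~ (- be)) (- be * t `^ (- be - 1)) by apply: is_derive1_powR.
  have p2 : is_derive t 1 ((@powR R)^~ (- be - 1)) ((- be - 1) * t `^ (- be - 1 - 1)) by apply: is_derive1_powR.
  have dsg : is_derive t 1 (fun t => s / t) (- (s / t) / t).
    have := is_deriveZ s (is_deriveV t0 (is_derive_id t 1)).
    move=> d; apply: is_derive_eq; rewrite /GRing.scale/=.
    by rewrite /exprz; field.
  have c0 := @is_derive1_comp R h (fun t => s / t) t _ _ g1 dsg.
  have c1 := @is_derive1_comp R h1 (fun t => s / t) t _ _ g2 dsg.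
  have tb : t `^ (- be - 1) = t * t `^ (- be - 1 - 1).
    by rewrite -[X in X * _]powRr1 ?(ltW tp)// -powRD ?(t0, implybT)//; congr (_ `^ _); ring.
  have tb' : t `^ (- be) = t * (t * t `^ (- be - 1 - 1)).
    by rewrite -tb -[X in X * _]powRr1 ?(ltW tp)// -powRD ?(t0, implybT)//; congr (_ `^ _); ring.
  split.
    have := is_deriveM p1 c0.
    rewrite (_ : _ * _ = k)// => d; apply: is_derive_eq.
    by rewrite /k1 /GRing.scale/= tb' tb; field.
  have := is_deriveN (is_deriveM p2 (is_deriveD (is_deriveZ be c0) (is_deriveM dsg c1))).
  rewrite (_ : - _ = k1)//; last first.
  move=> d; apply: is_derive_eq.
  rewrite /k2 /GRing.scale/= !fctE /GRing.scale/= tb.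
  move: (h (s / t)) (h1 (s / t)) (h2 (s / t)) (t `^ _) => H H1 H2 P.
  rewrite -[X in _ + (X + _) * _]/(be * H).
  by field.
- move=> t /andP[t1 t2]; have tp : 0 < t by lra.
  have st : 0 <= s / t by rewrite divr_ge0// ltW.
  have [b0 b1 b2] := bh _ st.
  have wle : wt m (s / t) <= 2 ^+ m * wt m s.
    apply: wt_le => //; rewrite -subr_ge0.
    have -> : 2 * (1 + s / t) - (1 + s) = (t + s * (2 - t)) / t by field; rewrite gt_eqF.
    by rewrite divr_ge0 ?(ltW tp)// addr_ge0 ?(ltW tp)// mulr_ge0//; lra.
  have CW : C * wt m (s / t) <= C * (2 ^+ m * wt m s) by rewrite ler_wpM2l.
  set y := s / t in st b0 b1 b2 wle CW *; set W := C * wt m y in b0 b1 b2 CW.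
  have W0 : 0 <= W by rewrite mulr_ge0// ltW// wt_gt0.
  have c1 : `|y * h1 y| <= W.
    by rewrite normrM (ger0_norm st); apply: le_trans b1; rewrite ler_wpM2r//; lra.
  have c2 : `|y ^+ 2 * h2 y| <= W.
    rewrite normrM ger0_norm ?sqr_ge0//; apply: le_trans b2; rewrite ler_wpM2r//.
    by rewrite lerXn2r ?nnegrE//; lra.
  have pw : t `^ (- be - 1 - 1) <= 1.
    rewrite -[leRHS](powRr0 t).
    by apply: ler_powR => //; lra.
  rewrite /k2 -/y normrM ger0_norm ?powR_ge0//.
  apply: (@le_trans _ _ (1 * ((be + 2) ^+ 2 * W))).
    apply: ler_pM; rewrite ?powR_ge0//.
    apply: le_trans (ler_normD _ _) _.
    have g : `|(be + 1) * (be * h y + 2 * (y * h1 y))| <= (be + 1) * (be * W + 2 * W).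
      rewrite normrM (ger0_norm (_ : 0 <= be + 1)); last lra.
      rewrite ler_wpM2l//; first lra.
      apply: le_trans (ler_normD _ _) _; rewrite (normrM be) (normrM 2) (ger0_norm be0).
      by rewrite (ger0_norm (_ : 0 <= 2))// lerD// ler_wpM2l.
    apply: le_trans (lerD g c2) _.
    have : 0 <= be * W by rewrite mulr_ge0.
    by rewrite expr2; clear -W0; lra.
  rewrite mul1r; have -> : (be + 2) ^+ 2 * 2 ^+ m * C * wt m s = (be + 2) ^+ 2 * (C * (2 ^+ m * wt m s)) by ring.
  by rewrite ler_wpM2l// sqr_ge0.
Qed.

End tame_examples.

(** * The perturbed self-similar solution *)

Section comparison.
Context {R : realType}.
Variables (m : nat) (al lam D : R) (f f1 f2 : R -> R) (Cf C0 : R).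
Hypotheses (hal : 0 < al) (hlam : 0 < lam <= 1) (hD : 1 <= D) (hm : al + 3 / 2 <= m%:R).
Hypotheses (hC : 0 <= Cf) (hf : tame m f f1 f2 Cf).
Hypothesis (hode : forall s : R, 0 <= s -> [/\ 0 < f s, f1 s <= 0 &
        al * f s + s * f1 s + 2 * (lam * (D - 1)) * f1 s +
        Num.max (2 * f1 s + 4 * s * f2 s) (lam * (2 * f1 s + 4 * s * f2 s)) = 0]).

Let psi := @wt R m.
Let psi1 := fun s : R => - m%:R * wt m.+1 s.
Let psi2 := fun s : R => m%:R * m.+1%:R * wt m.+2 s.

(* [gen h1 h2 nu a s] is the generator [tr (A D^2)] on a radial function of
   [s = |x|^2], where [nu] is the trace of [A] and [a] its value on the unit vector [x/|x|]. *)
Definition gen (h1 h2 : R -> R) (nu a s : R) : R := 2 * h1 s * nu + 4 * h2 s * a * s.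

Lemma profile_nonincreasing (s t : R) : 0 <= s -> s <= t -> f t <= f s.
Proof.
move=> s0 st; rewrite -lerN2.
apply: (@derive_nondecreasing _ (- f) (fun x => - f1 x)) => // x /andP[sx _].
  by apply: is_deriveN; have [dh _ _] := hf; have [] := dh x (le_trans s0 sx).
by rewrite oppr_ge0; have [] := hode (le_trans s0 sx).
Qed.

(** For large [s] the transport term s psi' is about - m psi and dominates; the condition m >= al +
    3/2 makes it leave - psi. On the remaining bounded range f is bounded below, and a multiple of
    it compensates. *)
Lemma corrector : exists2 K0 : R, 0 <= K0 & forall s nu a : R, 0 <= s -> 0 <= nu -> 0 <= a <= 1 ->
  (al + 1 / 2) * psi s + s * psi1 s + gen psi1 psi2 nu a s <= 1 / 2 * K0 * f s - 1 / 2 * psi s.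
Proof.
(* Collects the coefficients of [wt m.+1 s]; once 1 + s >= 2 M, these terms cost at most half of
   psi. *)
pose M : R := m%:R + 4 * (m%:R * m.+1%:R).
have m1 : 1 <= m%:R :> R by have := hm; have := hal; lra.
have M1 : 1 <= M.
  have : 0 <= m%:R * m.+1%:R :> R by rewrite mulr_ge0.
  by rewrite /M; lra.
have [fM _ _] := @hode (2 * M) (ltac:(lra)).
exists (2 * (M + 1) / f (2 * M)); first by rewrite divr_ge0 ?(ltW fM)//; lra.
move=> s nu a s0 nu0 /andP[a0 a1].
have w0 : 0 < psi s by exact: wt_gt0.
have w1 : 0 < wt m.+1 s by exact: wt_gt0.
have w2 : 0 < wt m.+2 s by exact: wt_gt0.
have e1 : (1 + s) * wt m.+1 s = psi s by exact: wt_S.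
have e2 : (1 + s) * wt m.+2 s = wt m.+1 s by exact: wt_S.
have [fs _ _] := hode s0.
pose P : R := m%:R * m.+1%:R.
have P0 : 0 <= P by rewrite mulr_ge0.
have g1 : gen psi1 psi2 nu a s <= 4 * P * wt m.+1 s.
  have h1 : 0 <= m%:R * wt m.+1 s * nu by rewrite !mulr_ge0// ltW.
  have h2 : a * s * (P * wt m.+2 s) <= P * wt m.+1 s.
    rewrite -e2 [leRHS]mulrCA; apply: ler_wpM2r; first by rewrite mulr_ge0// ltW.
    by nra.
  by rewrite /gen /psi1 /psi2 -/P; lra.
have g2 : s * psi1 s = - (m%:R * psi s) + m%:R * wt m.+1 s.
  by rewrite /psi1 -e1; ring.
have key : (al + 1 / 2) * psi s + s * psi1 s + gen psi1 psi2 nu a s <= - psi s + M * wt m.+1 s.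
  have : (al + 3 / 2) * psi s <= m%:R * psi s by rewrite ler_pM2r.
  by rewrite g2 /M -/P; lra.
apply: le_trans key _.
have [h|h] := leP (2 * M) (1 + s).
  have h1 : 2 * M * wt m.+1 s <= psi s by rewrite -e1 ler_pM2r.
  have h2 : 0 <= 1 / 2 * (2 * (M + 1) / f (2 * M)) * f s.
    by rewrite !mulr_ge0// ?invr_ge0 ?(ltW fs) ?(ltW fM)//; lra.
  by lra.
have h1 : f (2 * M) <= f s by apply: profile_nonincreasing => //; lra.
have h2 : M + 1 <= 1 / 2 * (2 * (M + 1) / f (2 * M)) * f s.
  have -> : 1 / 2 * (2 * (M + 1) / f (2 * M)) * f s = (M + 1) * (f s / f (2 * M)).
    by field; rewrite gt_eqF.
  by rewrite ler_peMr//; [lra|rewrite ler_pdivlMr// mul1r].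
have w11 : wt m.+1 s <= 1.
  by rewrite /wt invf_le1 ?exprn_gt0// ?exprn_ege1//; lra.
have h3 : M * wt m.+1 s <= M by rewrite ler_piMr//; lra.
by lra.
Qed.

Variable sg : R.
Hypothesis hsg : sg = 1 \/ sg = - 1.
Variables (K B : R).
Hypotheses (hK : 0 <= K) (hB : 0 <= B).

Definition rt (t : R) : R := t `^ (- (1 / 2)).

(** The case [sg = 1] is meant for the supersolution, [sg = -1] for the subsolution. The amplitude
    of f is moved opposite to the corrector, so that its relaxation to 1 in time has the sign that
    the inequality needs. *)
Definition Zb (t s : R) : R := (1 - sg * K * rt t) * f s + sg * B * rt t * psi s.
Definition Zb1 (t s : R) : R := (1 - sg * K * rt t) * f1 s + sg * B * rt t * psi1 s.
Definition Zb2 (t s : R) : R := (1 - sg * K * rt t) * f2 s + sg * B * rt t * psi2 s.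
Definition Z (t n : R) : R := t `^ (- al) * Zb t (n / t).

Let Cp : R := (m.+2)%:R ^+ 3.
Let CC : R := Cf + Cp.

Lemma rt_gt0 t : 0 < t -> 0 < rt t. Proof. exact: powR_gt0. Qed.

Lemma rt_sqr t : 0 < t -> rt t ^+ 2 = t^-1.
Proof.
move=> t0; rewrite /rt expr2 -powRD; last by rewrite (gt_eqF t0) implybT.
have -> : - (1 / 2) + - (1 / 2) = -1 :> R by field.
by rewrite powR_inv1 ?(ltW t0).
Qed.

Let sgn1 : `|sg| = 1.
Proof. by case: hsg => ->; rewrite ?normrN1 ?normr1. Qed.

Let CC0 : 0 <= CC. Proof. by rewrite addr_ge0 ?exprn_ge0//; exact: hC. Qed.

Let tame_mon (h h1 h2 : R -> R) (C C' : R) : C <= C' -> tame m h h1 h2 C -> tame m h h1 h2 C'.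
Proof.
move=> CC' [d b l]; split => //.
  move=> s s0; have [b0 b1 b2] := b s s0; have w := ltW (wt_gt0 m s0).
  by split; [apply: le_trans b0 _|apply: le_trans b1 _|apply: le_trans b2 _]; rewrite ler_wpM2r.
move=> s s' s0 ss; apply: le_trans (l s s' s0 ss) _; rewrite ler_wpM2r ?subr_ge0//.
by rewrite ler_wpM2r// ltW// wt_gt0.
Qed.

Let tf : tame m f f1 f2 CC.
Proof. by apply: tame_mon hf; rewrite /CC lerDl exprn_ge0. Qed.

Let tp : tame m psi psi1 psi2 CC.
Proof. by apply: tame_mon (tame_wt m); rewrite /CC lerDr; exact: hC. Qed.

Definition Cspace : R := 60 * 3 ^+ (m + 2) * CC.
Definition Ctime : R := (al + 3) ^+ 2 * 2 ^+ m * CC.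

Lemma Cspace_ge0 : 0 <= Cspace. Proof. by rewrite !mulr_ge0// exprn_ge0. Qed.
Lemma Ctime_ge0 : 0 <= Ctime. Proof.
by apply: mulr_ge0; [apply: mulr_ge0; [exact: sqr_ge0|exact: exprn_ge0]|exact: CC0].
Qed.

Let coef_le t : 0 < t -> `|1 - sg * K * rt t| <= 1 + K * rt t /\ `|sg * B * rt t| <= B * rt t.
Proof.
move=> t0; have r0 := ltW (rt_gt0 t0); split.
  apply: le_trans (ler_normB _ _) _; rewrite normr1 !normrM sgn1 mul1r.
  by rewrite (ger0_norm hK) (ger0_norm r0).
by rewrite !normrM sgn1 mul1r (ger0_norm hB) (ger0_norm r0).
Qed.

Lemma Z_space (t nx q e : R) : 0 < t -> 0 <= nx -> `|q| <= nx * e -> 0 <= e -> e * rt t <= 1 ->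
  `|Z t (nx ^+ 2 + 2 * q + e ^+ 2) - Z t (nx ^+ 2) - t `^ (- al) *
     (Zb1 t (nx ^+ 2 / t) * (2 * q + e ^+ 2) / t + 2 * Zb2 t (nx ^+ 2 / t) * q ^+ 2 / t ^+ 2)| <=
  t `^ (- al) * (Cspace * (1 + (K + B) * rt t) * psi (nx ^+ 2 / t) * (e * rt t) ^+ 3).
Proof.
move=> t0 nx0 qe e0 er; have r0 := rt_gt0 t0; have r2 := rt_sqr t0.
pose z := nx * rt t; pose p := q / t; pose y := e * rt t.
have z0 : 0 <= z by rewrite mulr_ge0// ltW.
have y01 : 0 <= y <= 1 by rewrite mulr_ge0//= ltW.
have pz : `|p| <= z * y.
  have -> : z * y = nx * e / t by rewrite /z /y -r2; ring.
  by rewrite /p normrM normfV (gtr0_norm t0) ler_pM2r ?invr_gt0.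
have E1 : nx ^+ 2 / t = z ^+ 2 by rewrite /z -r2; ring.
have E2 : (nx ^+ 2 + 2 * q + e ^+ 2) / t = z ^+ 2 + 2 * p + y ^+ 2 by rewrite /z /p /y -r2; ring.
have E3 (A : R) : A * (2 * q + e ^+ 2) / t = A * (2 * p + y ^+ 2) by rewrite /p /y -r2; ring.
have E4 (A : R) : 2 * A * q ^+ 2 / t ^+ 2 = 2 * A * p ^+ 2.
  by rewrite /p; field; rewrite gt_eqF.
rewrite /Z E2 E1 E3 E4 -/y -!mulrBr normrM (ger0_norm (powR_ge0 _ _)) ler_wpM2l ?powR_ge0//.
have hF := tame_space tf CC0 z0 y01 pz; have hP := tame_space tp CC0 z0 y01 pz.
set F := f _ - _ - _ - _ in hF; set P := psi _ - _ - _ - _ in hP.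
have -> : Zb t (z ^+ 2 + 2 * p + y ^+ 2) - Zb t (z ^+ 2) -
   (Zb1 t (z ^+ 2) * (2 * p + y ^+ 2) + 2 * Zb2 t (z ^+ 2) * p ^+ 2) =
   (1 - sg * K * rt t) * F + sg * B * rt t * P.
  by rewrite /Zb /Zb1 /Zb2 /F /P; ring.
have [c1 c2] := coef_le t0.
apply: le_trans (ler_normD _ _) _; rewrite !(normrM _ F) !(normrM _ P).
apply: le_trans (lerD (ler_pM (normr_ge0 _) (normr_ge0 _) c1 hF) (ler_pM (normr_ge0 _) (normr_ge0 _) c2 hP)) _.
rewrite /Cspace le_eqVlt; apply/orP; left; apply/eqP; rewrite /psi; ring.
Qed.

(** Terms with the factor [rt t] decay with the exponent al + 1/2, so [tame_time] is used with both
    exponents. The extra 1/2 leaves the surplus K f / 2, which pays for the corrector in the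
    bulk. *)
Lemma Z_time (t n s : R) : 1 <= t -> 0 <= n -> s = n / t ->
  `|Z (t + 1) n - Z t n - t `^ (- al) * t^-1 *
     (- (1 - sg * K * rt t) * (al * f s + s * f1 s) +
      sg * rt t * (1 / 2 * K * f s - B * ((al + 1 / 2) * psi s + s * psi1 s)))| <=
  t `^ (- al) * (Ctime * (1 + (K + B) * rt t) * psi s * t^-1 ^+ 2).
Proof.
move=> t1 n0 hs; have t0 : 0 < t by exact: lt_le_trans t1.
have tn0 : t != 0 by rewrite gt_eqF.
have r0 := rt_gt0 t0; pose e := t^-1.
have e01 : 0 <= e <= 1 by rewrite invr_ge0 (ltW t0)/= invf_le1.
have s0 : 0 <= s by rewrite hs divr_ge0// ltW.
have tE : t + 1 = t * (1 + e) by rewrite mulrDr mulr1 divff.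
have e1p : 0 <= 1 + e by case/andP: e01 => ? _; lra.
have sE : n / (t + 1) = s / (1 + e).
  rewrite tE hs; field; rewrite tn0 /= /e.
  by apply/negP; rewrite gt_eqF//; case/andP: e01; rewrite /e; lra.
have ab : 0 <= al + 1 / 2 by have := hal; lra.
have al0 := ltW hal.
have hF := tame_time tf CC0 al0 s0 e01.
have hF2 := tame_time tf CC0 ab s0 e01; have hP := tame_time tp CC0 ab s0 e01.
set F := _ * _ - _ + _ in hF; set F2 := _ * _ - _ + _ in hF2; set P := _ * _ - _ + _ in hP.
have pw (b : R) : (t + 1) `^ b = t `^ b * (1 + e) `^ b by rewrite tE powRM// ltW.
have pD : (1 + e) `^ (- (al + 1 / 2)) = (1 + e) `^ (- al) * rt (1 + e).
  rewrite /rt -powRD; first by congr (_ `^ _); ring.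
  by apply/implyP => _; rewrite gt_eqF//; case/andP: e01; lra.
have -> : Z (t + 1) n - Z t n - t `^ (- al) * t^-1 *
     (- (1 - sg * K * rt t) * (al * f s + s * f1 s) +
      sg * rt t * (1 / 2 * K * f s - B * ((al + 1 / 2) * psi s + s * psi1 s))) =
   t `^ (- al) * (F - sg * K * rt t * F2 + sg * B * rt t * P).
  rewrite /Z /Zb sE -hs /rt !pw -/(rt t) -/(rt (1 + e)) /F /F2 /P pD -/e.
  ring.
rewrite normrM (ger0_norm (powR_ge0 _ _)) ler_wpM2l ?powR_ge0//.
have hb : 0 <= 2 ^+ m * CC * wt m s * e ^+ 2.
  by rewrite !mulr_ge0 ?exprn_ge0 ?(ltW (wt_gt0 _ _))//; case/andP: e01.
have up (c : R) : 0 <= c -> c <= al + 3 -> c ^+ 2 * 2 ^+ m * CC * wt m s * e ^+ 2 <=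
    Ctime * psi s * e ^+ 2.
  move=> c0 c1; have -> : c ^+ 2 * 2 ^+ m * CC * wt m s * e ^+ 2 = c ^+ 2 * (2 ^+ m * CC * wt m s * e ^+ 2) by ring.
  have -> : Ctime * psi s * e ^+ 2 = (al + 3) ^+ 2 * (2 ^+ m * CC * wt m s * e ^+ 2).
    by rewrite /Ctime /psi; ring.
  by rewrite ler_wpM2r// lerXn2r ?nnegrE//; exact: le_trans c1.
have {}hF := le_trans hF (up (al + 2) ltac:(lra) ltac:(lra)).
have {}hF2 := le_trans hF2 (up (al + 1 / 2 + 2) ltac:(lra) ltac:(lra)).
have {}hP := le_trans hP (up (al + 1 / 2 + 2) ltac:(lra) ltac:(lra)).
have Kr : `|sg * K * rt t| <= K * rt t.
  by rewrite !normrM sgn1 mul1r (ger0_norm hK) (gtr0_norm r0).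
have [_ Br] := coef_le t0.
apply: le_trans (ler_normD _ _) _; rewrite (normrM _ P).
apply: le_trans (lerD (ler_normB _ _) (lexx _)) _; rewrite (normrM _ F2).
apply: le_trans (lerD (lerD hF (ler_pM (normr_ge0 _) (normr_ge0 _) Kr hF2)) (ler_pM (normr_ge0 _) (normr_ge0 _) Br hP)) _.
by rewrite le_eqVlt; apply/orP; left; apply/eqP; rewrite /e; ring.
Qed.

End comparison.

(** * The one-step inequalities *)

Section barriers.
Context {R : realType}.

Lemma rt_le1 (t : R) : 1 <= t -> rt t <= 1.
Proof.
by move=> t1; rewrite /rt -[leRHS](powRr0 t); apply: ler_powR => //; lra.
Qed.

Lemma rt_small (r0 : R) : 0 < r0 -> exists2 t0 : R, 1 <= t0 & forall t : R, t0 <= t -> rt t <= r0.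
Proof.
move=> r00; exists (1 + r0 ^- 2).
  by rewrite lerDl invr_ge0 exprn_ge0// ltW.
move=> t ht; have r2 : 0 < r0 ^- 2 by rewrite invr_gt0 exprn_gt0.
have tp : 0 < t by lra.
rewrite -(@ler_pXn2r _ 2) ?nnegrE ?(ltW r00) ?(ltW (rt_gt0 tp))// rt_sqr//.
rewrite -[leRHS]invrK lef_pV2 ?posrE//; lra.
Qed.

Definition is_profile (lam D al : R) (f f1 f2 : R -> R) :=
  forall s : R, 0 <= s -> [/\ 0 < f s, f1 s <= 0 &
    al * f s + s * f1 s + 2 * (lam * (D - 1)) * f1 s +
    Num.max (2 * f1 s + 4 * s * f2 s) (lam * (2 * f1 s + 4 * s * f2 s)) = 0].

(** Since f' <= 0, more tangential variance only lowers the generator, and a z never exceeds the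
    maximum of z and lam z for [a] in [[lam, 1]]. *)
Lemma profile_super (lam D al : R) f f1 f2 (s a tau : R) : is_profile lam D al f f1 f2 -> 0 <= s ->
  0 <= lam -> lam <= a <= 1 -> lam * (D - 1) <= tau ->
  al * f s + s * f1 s + gen f1 f2 (tau + a) a s <= 0.
Proof.
move=> hp s0 l0 /andP[a0 a1] ht; have [_ h1 <-] := hp s s0; rewrite /gen.
set z := 2 * f1 s + 4 * s * f2 s.
have e : 2 * f1 s * (tau + a) + 4 * f2 s * a * s = 2 * f1 s * tau + a * z by rewrite /z; ring.
have g1 : f1 s * tau <= f1 s * (lam * (D - 1)) by rewrite ler_wnM2l.
have g2 : a * z <= Num.max z (lam * z).
  rewrite le_max; have [z0|z0] := leP 0 z; apply/orP; [left|right]; clear -a0 a1 z0; nra.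
by rewrite e; clear -g1 g2; lra.
Qed.

(** The generator is affine in the radial variance, so an end point of [[lam, 1]] is optimal. *)
Definition opt_control (lam : R) (f1 f2 : R -> R) (s : R) : R :=
  if 0 <= 2 * f1 s + 4 * s * f2 s then 1 else lam.

Lemma opt_control_itv (lam : R) f1 f2 s : 0 < lam <= 1 -> lam <= opt_control lam f1 f2 s <= 1.
Proof. by move=> /andP[l0 l1]; rewrite /opt_control; case: ifP; rewrite ?lexx ?l1. Qed.

Lemma profile_sub (lam D al : R) f f1 f2 (s : R) (a := opt_control lam f1 f2 s) :
  0 < lam <= 1 -> is_profile lam D al f f1 f2 -> 0 <= s ->
  al * f s + s * f1 s + gen f1 f2 (lam * (D - 1) + a) a s = 0.
Proof.
move=> /andP[l0 l1] hp s0; have [_ h1 <-] := hp s s0; rewrite /gen.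
set z := 2 * f1 s + 4 * s * f2 s.
have e : 2 * f1 s * (lam * (D - 1) + a) + 4 * f2 s * a * s = 2 * f1 s * (lam * (D - 1)) + a * z by rewrite /z; ring.
have g2 : Num.max z (lam * z) = a * z.
  rewrite /a /opt_control -/z; case: ifPn => [z0|]; last rewrite -ltNge => z0.
    by rewrite mul1r max_l//; clear -z0 l0 l1; nra.
  by rewrite max_r//; clear -z0 l0 l1; nra.
by rewrite e g2; ring.
Qed.

(** At the origin there is no radial direction and the diffusion has to be isotropic. The value
    [lam] comes out by itself, because the equation at [s = 0] forces f'(0) < 0. *)
Lemma opt_control0 (lam D al : R) f f1 f2 : 0 < lam <= 1 -> 1 <= D -> 0 < al ->
  is_profile lam D al f f1 f2 -> opt_control lam f1 f2 0 = lam.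
Proof.
move=> /andP[l0 l1] D1 al0 hp; have [h0 h1 h2] := hp 0 (lexx _).
rewrite /opt_control mulr0 mul0r addr0 ifN// -ltNge.
rewrite pmulr_rlt0// lt_neqAle h1 andbT; apply: contra_eqN h2 => /eqP ->.
by rewrite !(mulr0, mul0r, addr0, maxxx) gt_eqF// mulr_gt0.
Qed.

(* The perturbation [B (rt t) psi] produces a gain [B (rt t)^3 psi / 2] which
   absorbs the Taylor errors when [B] is large; [K] compensates the wrong sign
   of the generator on [psi] in the bulk. *)
Section fixed_profile.
Variables (m : nat) (al lam D rho K0 : R) (f f1 f2 : R -> R) (Cf B K t : R).
Hypotheses (hal : 0 < al) (hC : 0 <= Cf) (hf : tame m f f1 f2 Cf).
Hypotheses (hrho : 0 <= rho) (hK0 : 0 <= K0).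
Hypothesis (hcor : forall s nu a : R, 0 <= s -> 0 <= nu -> 0 <= a <= 1 ->
  (al + 1 / 2) * wt m s + s * (- m%:R * wt m.+1 s) +
  gen (fun s => - m%:R * wt m.+1 s) (fun s => m%:R * m.+1%:R * wt m.+2 s) nu a s
    <= 1 / 2 * K0 * f s - 1 / 2 * wt m s).
Hypothesis (hB : B = 4 * (Ctime m al Cf + Cspace m Cf * rho ^+ 3) + 1).
Hypothesis (hK : K = B * K0).
Hypotheses (ht : 1 <= t) (hr : (K + B) * rt t <= 1).

Definition Err (s : R) : R :=
  t `^ (- al) * (Cspace m Cf * (1 + (K + B) * rt t) * wt m s * (rho * rt t) ^+ 3).

Let B0 : 0 <= B.
Proof.
have h1 := Ctime_ge0 m al hC; have h2 := Cspace_ge0 m hC.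
have h3 : 0 <= Cspace m Cf * rho ^+ 3 by rewrite mulr_ge0// exprn_ge0.
by rewrite hB; lra.
Qed.

Let K0' : 0 <= K. Proof. by rewrite hK mulr_ge0. Qed.

(** Multiplying by [sg] treats both signs at once. Up to the factor t^(-al), the errors are at most
    2 (Cspace rho^3 + Ctime) (rt t)^3 psi, as [(K + B) * rt t <= 1], and the gain is B (rt t)^3 psi
    / 2; hence the value of [B]. *)
Let main (sg n s nu a : R) (Zn := Z m al f sg K B)
    (bracket := (1 - sg * K * rt t) * (al * f s + s * f1 s + gen f1 f2 nu a s)) :
  sg = 1 \/ sg = - 1 -> 0 <= n -> s = n / t -> 0 <= nu -> 0 <= a <= 1 ->
  sg * (t `^ (- al) * t^-1 * - bracket) + Err s <=
  sg * (Zn (t + 1) n - Zn t n - t `^ (- al) * t^-1 * gen (Zb1 m f1 sg K B t) (Zb2 m f2 sg K B t) nu a s).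
Proof.
move=> hsg n0 hs nu0 ha.
have tp : 0 < t by exact: lt_le_trans ht.
have r0 := rt_gt0 tp; have r1 := rt_le1 ht; have r2 := rt_sqr tp.
have s0 : 0 <= s by rewrite hs divr_ge0// ltW.
have hT := @Z_time R m al f f1 f2 Cf hal hC hf sg hsg K B K0' B0 t n s ht n0 hs.
have hc := hcor s0 nu0 ha.
set X := - (1 - _) * _ + _ in hT.
have hX : X - gen (Zb1 m f1 sg K B t) (Zb2 m f2 sg K B t) nu a s =
  - bracket + sg * rt t * B * (1 / 2 * K0 * f s - ((al + 1 / 2) * wt m s + s * (- m%:R * wt m.+1 s) +
  gen (fun s => - m%:R * wt m.+1 s) (fun s => m%:R * m.+1%:R * wt m.+2 s) nu a s)).
  by rewrite /X /bracket hK /gen /Zb1 /Zb2; ring.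
set Y := 1 / 2 * K0 * f s - _ in hX.
have Y1 : 1 / 2 * wt m s <= Y by rewrite /Y; move: hc; lra.
set T := t `^ (- al) in hT *.
have T0 : 0 < T by rewrite powR_gt0.
have w0 : 0 < wt m s by exact: wt_gt0.
have sg2 : sg * sg = 1 by case: hsg => ->; ring.
have hT' : - (T * (Ctime m al Cf * (1 + (K + B) * rt t) * wt m s * t^-1 ^+ 2)) <=
   sg * (Zn (t + 1) n - Zn t n - T / t * X).
  rewrite lerNl -mulrN; apply: le_trans hT; apply: le_trans (ler_norm _) _.
  have n1 : `|sg| = 1 by case: hsg => ->; rewrite ?normrN1 ?normr1.
  by rewrite normrM normrN n1 mul1r.
have -> : sg * (Zn (t + 1) n - Zn t n - T / t * gen (Zb1 m f1 sg K B t) (Zb2 m f2 sg K B t) nu a s) =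
   sg * (Zn (t + 1) n - Zn t n - T / t * X) + sg * (T / t * (X - gen (Zb1 m f1 sg K B t) (Zb2 m f2 sg K B t) nu a s)).
  by ring.
rewrite hX.
have -> : sg * (T / t * (- bracket + sg * rt t * B * Y)) =
   sg * (T / t * - bracket) + (sg * sg) * (T / t * (rt t * B * Y)) by ring.
rewrite sg2 mul1r -r2.
suff : Err s + T * (Ctime m al Cf * (1 + (K + B) * rt t) * wt m s * t^-1 ^+ 2) <= T * rt t ^+ 2 * (rt t * B * Y).
  by move: hT'; rewrite -!r2; lra.
rewrite /Err -/T -r2.
have c1 := Ctime_ge0 m al hC; have c2 := Cspace_ge0 m hC.
have Cr : 0 <= Cspace m Cf * rho ^+ 3 by rewrite mulr_ge0// exprn_ge0.
have -> : T * (Cspace m Cf * (1 + (K + B) * rt t) * wt m s * (rho * rt t) ^+ 3) +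
   T * (Ctime m al Cf * (1 + (K + B) * rt t) * wt m s * (rt t ^+ 2) ^+ 2) =
   T * rt t ^+ 2 * (rt t * ((1 + (K + B) * rt t) * (Cspace m Cf * rho ^+ 3 + Ctime m al Cf * rt t) * wt m s)) by ring.
rewrite ler_pM2l ?mulr_gt0 ?exprn_gt0// -(mulrA (rt t) B Y) ler_pM2l//.
apply: (@le_trans _ _ (B * (1 / 2 * wt m s))); last by rewrite ler_wpM2l.
rewrite (mulrA B) ler_pM2r//.
have k0 : 0 <= (K + B) * rt t by rewrite mulr_ge0 ?addr_ge0// ltW.
have k1 : Ctime m al Cf * rt t <= Ctime m al Cf by rewrite ler_piMr.
have k2 : 0 <= Ctime m al Cf * rt t by rewrite mulr_ge0// ltW.
apply: (@le_trans _ _ (2 * (Cspace m Cf * rho ^+ 3 + Ctime m al Cf))).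
  by apply: ler_pM; rewrite ?addr_ge0//; move: hr; lra.
by move: hB => ->; lra.
Qed.

Hypotheses (hlam : 0 < lam <= 1) (hp : is_profile lam D al f f1 f2).
Hypotheses (hD : 1 <= D).

Lemma Z_super (n s a tau : R) : 0 <= n -> s = n / t -> lam <= a <= 1 -> lam * (D - 1) <= tau ->
  Z m al f 1 K B t n + t `^ (- al) * t^-1 * gen (Zb1 m f1 1 K B t) (Zb2 m f2 1 K B t) (tau + a) a s + Err s
  <= Z m al f 1 K B (t + 1) n.
Proof.
move=> n0 hs ha htau; have /andP[a0 a1] := ha; have /andP[l0 l1] := hlam.
have tp : 0 < t by exact: lt_le_trans ht.
have s0 : 0 <= s by rewrite hs divr_ge0// ltW.
have t0 : 0 <= tau by apply: le_trans htau; rewrite mulr_ge0 ?subr_ge0// ltW.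
have h := @main 1 n s (tau + a) a (or_introl erefl) n0 hs.
have {}h := h (ltac:(lra)) (ltac:(apply/andP; split; lra)).
have := profile_super hp s0 (ltW l0) ha htau.
have r0 := rt_gt0 tp.
set b := _ + gen f1 f2 _ _ _ => b0.
have b1 : 0 <= t `^ (- al) * t^-1 * - ((1 - 1 * K * rt t) * b).
  rewrite mulr_ge0 ?mulr_ge0 ?powR_ge0 ?invr_ge0 ?(ltW tp)// -mulrN mulr_ge0//; last by lra.
  rewrite mul1r subr_ge0; apply: le_trans hr; rewrite ler_wpM2r ?(ltW r0)//.
  by rewrite lerDl.
by move: h; rewrite -/b !mul1r; move: b1; rewrite mul1r; lra.
Qed.

Lemma Z_sub (n s a : R) : 0 <= n -> s = n / t -> a = opt_control lam f1 f2 s ->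
  Z m al f (-1) K B (t + 1) n <=
  Z m al f (-1) K B t n + t `^ (- al) * t^-1 *
    gen (Zb1 m f1 (-1) K B t) (Zb2 m f2 (-1) K B t) (lam * (D - 1) + a) a s - Err s.
Proof.
move=> n0 hs ha; have /andP[l0 l1] := hlam.
have /andP[a0 a1] : lam <= a <= 1 by rewrite ha opt_control_itv.
have tp : 0 < t by exact: lt_le_trans ht.
have s0 : 0 <= s by rewrite hs divr_ge0// ltW.
have N0 : 0 <= lam * (D - 1) by rewrite mulr_ge0 ?subr_ge0// ltW.
have h := @main (-1) n s (lam * (D - 1) + a) a (or_intror erefl) n0 hs.
have {}h := h (ltac:(lra)) (ltac:(apply/andP; split; lra)).
have e := profile_sub hlam hp s0; rewrite -ha in e.
by move: h; rewrite e !mulr0 oppr0 !mulr0 add0r mulN1r; lra.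
Qed.

End fixed_profile.

End barriers.

(** * Barriers as used by the probabilistic part *)

Section barrier_interface.
Context {R : realType}.

(* [V t n] bounds the optimal probability of hitting a fixed ball after time [t]
   from a point with [|x|^2 = n]. *)
Definition upper_barrier (lam D al rho t0 M : R) (V : R -> R -> R) :=
  [/\ 1 <= t0, forall t n : R, t0 <= t -> 0 <= n -> 0 < V t n,
      forall t : R, t0 <= t -> V t 0 <= M * t `^ (- al),
      forall t : R, t0 <= t -> exists2 L : R, 0 <= L & forall n n' : R, 0 <= n -> 0 <= n' ->
        `|V t n - V t n'| <= L * `|n - n'| &
      forall t nx : R, t0 <= t -> 0 <= nx -> exists G1 G2 E : R,
        (forall q e : R, `|q| <= nx * e -> 0 <= e <= rho ->
          V t (nx ^+ 2 + 2 * q + e ^+ 2) <= V t (nx ^+ 2) + G1 * (2 * q + e ^+ 2) + G2 * q ^+ 2 + E) /\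
        (forall a tau : R, lam <= a <= 1 -> lam * (D - 1) <= tau ->
          V t (nx ^+ 2) + 2 * G1 * (tau + a) + 2 * G2 * (a * nx ^+ 2) + E <= V (t + 1) (nx ^+ 2))].

(** Here [t] is the remaining time shifted by [t0], and [act] is the radial variance to apply. [V]
    may be negative; at the final time it is positive only for |x|^2 <= L. The coefficients [G1],
    [G2] and [E] do not depend on the increment, so that only its first and second moments
    matter. *)
Definition lower_barrier (lam D al rho t0 c M L : R) (V act : R -> R -> R) :=
  [/\ [/\ 1 <= t0, 0 < c & 0 < M], forall t : R, t0 <= t -> c * t `^ (- al) <= V t 0,
      forall n : R, 0 <= n -> V t0 n <= M /\ (0 < V t0 n -> n <= L),
      forall t : R, t0 <= t ->
        [/\ forall n : R, lam <= act t n <= 1, act t 0 = lam & measurable_fun setT (act t)] &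
      forall t nx : R, t0 <= t -> 0 <= nx -> exists G1 G2 E : R,
        (forall q e : R, `|q| <= nx * e -> 0 <= e <= rho ->
          V t (nx ^+ 2) + G1 * (2 * q + e ^+ 2) + G2 * q ^+ 2 - E <= V t (nx ^+ 2 + 2 * q + e ^+ 2)) /\
        V (t + 1) (nx ^+ 2) <= V t (nx ^+ 2) + 2 * G1 * (lam * (D - 1) + act t (nx ^+ 2)) +
           2 * G2 * (act t (nx ^+ 2) * nx ^+ 2) - E].

Lemma wt_le1 m (s : R) : 0 <= s -> wt m s <= 1.
Proof. by move=> s0; rewrite /wt invf_le1 ?exprn_gt0 ?exprn_ege1//; lra. Qed.

Lemma max0_lip (h : R -> R) (L : R) :
  (forall s s' : R, 0 <= s -> s <= s' -> `|h s' - h s| <= L * (s' - s)) -> 0 <= L ->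
  continuous (fun s : R => h (Num.max s 0)).
Proof.
move=> hl L0; apply: (@lipschitz_continuous _ _ L) => x y.
have gen (a b : R) : Num.max a 0 <= Num.max b 0 -> `|h (Num.max b 0) - h (Num.max a 0)| <= L * `|a - b|.
  move=> ab; apply: le_trans (hl _ _ _ ab) _; first by rewrite le_max lexx orbT.
  rewrite ler_wpM2l//; apply: le_trans (ler_norm _) _.
  by rewrite (distrC a b); exact: max_lip.
have [h1|/ltW h1] := leP (Num.max y 0) (Num.max x 0).
  by rewrite (distrC x y); exact: gen.
by rewrite distrC; exact: gen.
Qed.

(** [al] is fixed before [rho]: the profile ignores the bound on the increments, which enters only
    through [B], [K] and the initial time. *)
Lemma exponent_and_barriers (lam D : R) : 0 < lam <= 1 -> 1 <= D ->
  exists2 al : R, 0 < al & forall rho : R, 0 <= rho ->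
    (exists t0 M V, upper_barrier lam D al rho t0 M V) /\
    (exists t0 c M L V act, lower_barrier lam D al rho t0 c M L V act).
Proof.
move=> hl D1; have [al [C0 [f [f1 [f2 [al0 C00 hdec hp]]]]]] := profile_exists hl D1.
exists al => // rho rho0.
have [m hm] : exists m : nat, al + 3 / 2 <= m%:R :> R.
  exists (Num.truncn (al + 3 / 2)).+1; apply: ltW; exact: truncnS_gt.
have [Cf Cf0 hf] := tame_of_decay m C00 hdec.
(* f is also of the order of [wt m.+1], hence smaller than the corrector [wt m] at infinity. This
   makes the subsolution nonpositive beyond a finite radius and provides the constant [L] below. *)
have [Cf' Cf0' hf'] := tame_of_decay m.+1 C00 hdec.
have [dh bh lh] := hf.
have [K0 K00 hcor] := corrector al0 hm hf hp.
pose B := 4 * (Ctime m al Cf + Cspace m Cf * rho ^+ 3) + 1.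
pose K := B * K0.
have c1 := Ctime_ge0 m al Cf0; have c2 := Cspace_ge0 m Cf0.
have Cr : 0 <= Cspace m Cf * rho ^+ 3 by rewrite mulr_ge0// exprn_ge0.
have B1 : 1 <= B by rewrite /B; lra.
have B0 : 0 <= B by lra.
have K0' : 0 <= K by rewrite mulr_ge0.
have [f00 _ _] := hp 0 (lexx _).
(* Keeps the amplitude of f at least 1/2, the corrector at most f(0) / 2 and the rescaled step
   [rho * rt t] at most 1. *)
pose r0 := Num.min (1 / (2 * (1 + K + B + rho))) (f 0 / (2 * (B + 1))).
have r00 : 0 < r0 by rewrite lt_min !divr_gt0//; lra.
have [t0 t01 ht0] := rt_small r00.
have tp (t : R) : t0 <= t -> 0 < t by move=> h; lra.
have t1 (t : R) : t0 <= t -> 1 <= t by move=> h; lra.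
have small (t : R) : t0 <= t -> [/\ (K + B) * rt t <= 1, rho * rt t <= 1, K * rt t <= 1 / 2 & B * rt t <= 1 / 2 * f 0].
  move=> ht; have r := ltW (rt_gt0 (tp _ ht)).
  have h1 : rt t * (2 * (1 + K + B + rho)) <= 1.
    rewrite -ler_pdivlMr; last by clear -K0' B0 rho0; lra.
    by apply: le_trans (ht0 t ht) _; rewrite /r0 ge_min lexx.
  have h2 : rt t * (2 * (B + 1)) <= f 0.
    rewrite -ler_pdivlMr; last by clear -B0; lra.
    by apply: le_trans (ht0 t ht) _; rewrite /r0 ge_min lexx orbT.
  have k1 : 0 <= K * rt t by rewrite mulr_ge0.
  have k2 : 0 <= B * rt t by rewrite mulr_ge0.
  have k3 : 0 <= rho * rt t by rewrite mulr_ge0.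
  by clear -h1 h2 k1 k2 k3 r; split; lra.
have fdecr (s : R) : 0 <= s -> f s <= f 0.
  by move=> s0; exact: (profile_nonincreasing hf hp).
have ErrS (t : R) : t0 <= t -> forall sg nx q e : R, sg = 1 \/ sg = -1 -> 0 <= nx -> `|q| <= nx * e -> 0 <= e <= rho ->
   `|Z m al f sg K B t (nx ^+ 2 + 2 * q + e ^+ 2) - Z m al f sg K B t (nx ^+ 2) -
     (t `^ (- al) * Zb1 m f1 sg K B t (nx ^+ 2 / t) / t * (2 * q + e ^+ 2) +
      t `^ (- al) * (2 * Zb2 m f2 sg K B t (nx ^+ 2 / t)) / t ^+ 2 * q ^+ 2)| <=
   Err m al rho Cf B K t (nx ^+ 2 / t).
  move=> ht sg nx q e hsg nx0 qe /andP[e0 er].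
  have [h1 h2 _ _] := small t ht; have r := rt_gt0 (tp _ ht).
  have er1 : e * rt t <= 1 by apply: le_trans h2; rewrite ler_pM2r.
  have := @Z_space R m al f f1 f2 Cf Cf0 hf sg hsg K B K0' B0 t nx q e (tp _ ht) nx0 qe e0 er1.
  have -> : t `^ (- al) * (Zb1 m f1 sg K B t (nx ^+ 2 / t) * (2 * q + e ^+ 2) / t +
      2 * Zb2 m f2 sg K B t (nx ^+ 2 / t) * q ^+ 2 / t ^+ 2) =
    t `^ (- al) * Zb1 m f1 sg K B t (nx ^+ 2 / t) / t * (2 * q + e ^+ 2) +
      t `^ (- al) * (2 * Zb2 m f2 sg K B t (nx ^+ 2 / t)) / t ^+ 2 * q ^+ 2 by ring.
  move=> h; apply: le_trans h _; rewrite /Err ler_wpM2l ?powR_ge0//.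
  apply: ler_wpM2l.
    have w : 0 < wt m (nx ^+ 2 / t) by apply: wt_gt0; rewrite divr_ge0 ?sqr_ge0// ltW// tp.
    have kb : 0 <= (K + B) * rt t by apply: mulr_ge0; [exact: addr_ge0|exact: ltW].
    by apply: mulr_ge0; [apply: mulr_ge0 => //; clear -kb; lra|exact: ltW].
  by rewrite lerXn2r ?nnegrE ?ler_pM2r// mulr_ge0// ltW.
have genE (t sg nu a nx : R) : t0 <= t -> 
    t `^ (- al) * t^-1 * gen (Zb1 m f1 sg K B t) (Zb2 m f2 sg K B t) nu a (nx ^+ 2 / t) =
    2 * (t `^ (- al) * Zb1 m f1 sg K B t (nx ^+ 2 / t) / t) * nu +
    2 * (t `^ (- al) * (2 * Zb2 m f2 sg K B t (nx ^+ 2 / t)) / t ^+ 2) * (a * nx ^+ 2).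
  by move=> ht; rewrite /gen; field; rewrite gt_eqF// tp.
split.
  exists t0, (f 0 + B), (Z m al f 1 K B); split => //.
  - move=> t n ht n0; have [_ _ h3 _] := small t ht.
    have s0 : 0 <= n / t by rewrite divr_ge0// ltW// tp.
    have [fs _ _] := hp _ s0; have w := wt_gt0 m s0; have r := rt_gt0 (tp _ ht).
    rewrite /Z; apply: mulr_gt0; first by rewrite powR_gt0// tp.
    have g1 : 0 <= B * rt t * wt m (n / t).
      by apply: mulr_ge0; [apply: mulr_ge0 => //; exact: ltW|exact: ltW].
    have g2 : 0 < (1 - K * rt t) * f (n / t) by apply: mulr_gt0 => //; clear -h3; lra.
    by rewrite /Zb !mul1r; clear -g1 g2; lra.
  - move=> t ht; rewrite /Z mul0r mulrC ler_wpM2r ?powR_ge0// /Zb !mul1r.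
    have r := rt_gt0 (tp _ ht); have r1 := rt_le1 (t1 _ ht).
    have k : 0 <= K * rt t * f 0 by rewrite !mulr_ge0 ?(ltW r) ?(ltW f00).
    have w := wt_le1 m (lexx (0 : R)); have w0 := wt_gt0 m (lexx (0 : R)).
    have b : B * rt t * wt m 0 <= B.
      rewrite -mulrA; apply: ler_piMr; first exact: B0.
      by apply: mulr_ile1; [exact: ltW r|exact: ltW w0|exact: r1|exact: w].
    by clear -k b; lra.
  - move=> t ht; have tpt := tp _ ht; have r := rt_gt0 tpt; have r1 := rt_le1 (t1 _ ht).
    pose L := (1 + K) * Cf + B * (m.+2)%:R ^+ 3.
    have L0 : 0 <= L.
      by rewrite addr_ge0// mulr_ge0// ?exprn_ge0//; clear -K0'; lra.
    pose A := t `^ (- al) * (L / t).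
    have A0 : 0 <= A by rewrite mulr_ge0 ?powR_ge0// divr_ge0// ltW.
    exists A => //.
    have [_ bp _] := @tame_wt R m.
    have [dp _ _] := @tame_wt R m.
    have gl (n n' : R) : 0 <= n -> n <= n' -> `|Z m al f 1 K B t n' - Z m al f 1 K B t n| <= A * (n' - n).
      move=> n0 nn.
      have s0 : 0 <= n / t by rewrite divr_ge0// ltW.
      have ss : n / t <= n' / t by rewrite ler_pM2r ?invr_gt0.
      have h : `|Zb m f 1 K B t (n' / t) - Zb m f 1 K B t (n / t)| <= L * (n' / t - n / t).
        have dZ (x : R) : n / t <= x <= n' / t -> is_derive x 1 (Zb m f 1 K B t) (Zb1 m f1 1 K B t x).
          move=> /andP[x0 x1]; have xx := le_trans s0 x0.
          have [d1 _] := dh x xx; have [d2 _] := dp x xx.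
          exact: (is_deriveD (is_deriveZ (1 - 1 * K * rt t) d1) (is_deriveZ (1 * B * rt t) d2)).
        have bZ (x : R) : n / t <= x <= n' / t -> `|Zb1 m f1 1 K B t x| <= L.
          move=> /andP[x0 x1].
          have xx := le_trans s0 x0; have [_ b1 _] := bh x xx; have [_ b2 _] := bp x xx.
          have w := wt_le1 m xx; have w0 := wt_gt0 m xx.
          have e1 : `|f1 x| <= Cf.
            apply: (@le_trans _ _ ((1 + x) * `|f1 x|)); first by rewrite ler_peMl//; clear -xx; lra.
            by apply: le_trans b1 _; rewrite ler_piMr.
          have e2 : `|- m%:R * wt m.+1 x| <= (m.+2)%:R ^+ 3.
            apply: (@le_trans _ _ ((1 + x) * `|- m%:R * wt m.+1 x|)); first by rewrite ler_peMl//; clear -xx; lra.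
            by apply: le_trans b2 _; rewrite ler_piMr// exprn_ge0.
          rewrite /Zb1 !mul1r; apply: le_trans (ler_normD _ _) _; apply: lerD; rewrite normrM.
            apply: ler_pM => //; apply: le_trans (ler_normB _ _) _; rewrite normr1 lerD2l.
            by rewrite ger0_norm ?mulr_ge0 ?(ltW r)// ler_piMr.
          apply: ler_pM => //; rewrite ger0_norm ?mulr_ge0 ?(ltW r)// ler_piMr//.
        exact: derive_norm_le_cst ss dZ bZ.
      rewrite /Z -mulrBr normrM (ger0_norm (powR_ge0 _ _)) /A -mulrA ler_wpM2l ?powR_ge0//.
      apply: le_trans h _; rewrite -mulrBl; rewrite le_eqVlt; apply/orP; left; apply/eqP; ring.
    move=> n n' n0 n0'; have [nn|/ltW nn] := leP n n'.
      by rewrite distrC (distrC n n') (ger0_norm (_ : 0 <= n' - n)) ?subr_ge0//; exact: gl.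
    by rewrite (ger0_norm (_ : 0 <= n - n')) ?subr_ge0//; exact: gl.
  - move=> t nx ht nx0.
    exists (t `^ (- al) * Zb1 m f1 1 K B t (nx ^+ 2 / t) / t),
      (t `^ (- al) * (2 * Zb2 m f2 1 K B t (nx ^+ 2 / t)) / t ^+ 2),
      (Err m al rho Cf B K t (nx ^+ 2 / t)).
    split.
      move=> q e qe er; have := ErrS t ht 1 nx q e (or_introl erefl) nx0 qe er.
      by rewrite ler_norml => /andP[_]; clear; lra.
    move=> a tau ha htau; have [h1 _ _ _] := small t ht.
    have := @Z_super R m al lam D rho K0 f f1 f2 Cf B K t al0 Cf0 hf rho0 K00 hcor erefl erefl
       (t1 _ ht) h1 hl hp D1 (nx ^+ 2) (nx ^+ 2 / t) a tau (sqr_ge0 _) erefl ha htau.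
    by rewrite genE//; clear; lra.
have Mb : 0 < (1 + K) * f 0 by rewrite mulr_gt0//; clear -K0'; lra.
pose act (t n : R) := opt_control lam f1 f2 (Num.max n 0 / t).
pose L := t0 * ((1 + K) * Cf' / (B * rt t0)).
exists t0, (1 / 2 * f 0), ((1 + K) * f 0), L, (Z m al f (-1) K B), act.
split.
- by split => //; rewrite mulr_gt0.
- move=> t ht; have [_ _ _ h4] := small t ht.
  have r := rt_gt0 (tp _ ht).
  rewrite /Z mul0r mulrC ler_wpM2l ?powR_ge0// /Zb.
  have w := wt_le1 m (lexx (0 : R)).
  have b : B * rt t * wt m 0 <= B * rt t by rewrite ler_piMr// mulr_ge0// ltW.
  have k : 0 <= K * rt t * f 0 by rewrite !mulr_ge0 ?(ltW r) ?(ltW f00).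
  by clear -h4 b k; lra.
- move=> n n0; have tpt := tp _ (lexx t0); have r := rt_gt0 tpt; have r1 := rt_le1 t01.
  have s0 : 0 <= n / t0 by rewrite divr_ge0// ltW.
  have [fs _ _] := hp _ s0; have w := wt_gt0 m s0.
  have kr : K * rt t0 <= K by rewrite ler_piMr.
  have kr0 : 0 <= K * rt t0 by rewrite mulr_ge0// ltW.
  have bw : 0 < B * rt t0 * wt m (n / t0) by rewrite !mulr_gt0//; clear -B1; lra.
  have up : (1 - -1 * K * rt t0) * f (n / t0) <= (1 + K) * f (n / t0).
    by rewrite ler_pM2r//; clear -kr; lra.
  split.
    have h1 : Zb m f (-1) K B t0 (n / t0) <= (1 + K) * f 0.
      have := ler_wpM2l (_ : 0 <= 1 + K) (fdecr _ s0).
      by rewrite /Zb => /(_ (ltac:(clear -K0'; lra))); clear -up bw; lra.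
    apply: (@le_trans _ _ (t0 `^ (- al) * ((1 + K) * f 0))); first by rewrite ler_wpM2l ?powR_ge0.
    rewrite ler_piMl ?(ltW Mb)// -[leRHS](powRr0 t0); apply: ler_powR => //.
    by clear -al0; lra.
  rewrite /Z pmulr_rgt0 ?powR_gt0// /Zb => hZ.
  have [_ b' _] := hf'; have [bf _ _] := b' _ s0.
  rewrite gtr0_norm// in bf.
  have e1 := wt_S m s0.
  have w1 := wt_gt0 m.+1 s0.
  have h1 : B * rt t0 * wt m (n / t0) < (1 + K) * (Cf' * wt m.+1 (n / t0)).
    apply: (@lt_le_trans _ _ ((1 + K) * f (n / t0))); first by clear -hZ up; lra.
    by rewrite ler_wpM2l//; clear -K0'; lra.
  rewrite -e1 in h1.
  have h2 : B * rt t0 * (1 + n / t0) < (1 + K) * Cf'.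
    by rewrite -(ltr_pM2r w1); clear -h1; lra.
  have Br : 0 < B * rt t0 by rewrite mulr_gt0//; clear -B1; lra.
  have h3 : n / t0 <= (1 + K) * Cf' / (B * rt t0).
    rewrite ler_pdivlMr//; clear -h2 Br s0; move: (n / t0) (B * rt t0) h2 Br s0 => x y; lra.
  by rewrite ler_pdivrMr// in h3; rewrite /L mulrC.
- move=> t ht; have tpt := tp _ ht; split.
  + by move=> n; exact: opt_control_itv.
  + by rewrite /act maxxx mul0r (opt_control0 hl D1 al0 hp).
  (* The control is discontinuous, but it is decided by the sign of a continuous function, hence
     measurable. *)
  + pose g (n : R) := 2 * f1 (Num.max (n / t) 0) + 4 * Num.max (n / t) 0 * f2 (Num.max (n / t) 0).
    have actE : act t = fun n => if 0 <= g n then 1 else lam.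
      apply/funext => n; rewrite /act /opt_control /g.
      by have -> : Num.max n 0 / t = Num.max (n / t) 0 by rewrite maxr_pMl ?invr_ge0 ?(ltW tpt)// mul0r.
    have lw (s : R) : 0 <= s -> wt m s <= 1 by exact: wt_le1.
    have cf1 : continuous (fun s : R => f1 (Num.max s 0)).
      apply: (@max0_lip _ Cf) => // s s' s0 ss.
      apply: (@derive_norm_le_cst _ _ f2) => // x /andP[x0 _].
        by have [] := dh x (le_trans s0 x0).
      have xx := le_trans s0 x0; have [_ _ b2] := bh x xx.
      apply: (@le_trans _ _ ((1 + x) ^+ 2 * `|f2 x|)).
        by rewrite ler_peMl// exprn_ege1//; clear -xx; lra.
      by apply: le_trans b2 _; rewrite ler_piMr// lw.
    have cf2 : continuous (fun s : R => f2 (Num.max s 0)).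
      apply: (@max0_lip _ Cf) => // s s' s0 ss.
      apply: (@le_trans _ _ ((1 + s) ^+ 2 * `|f2 s' - f2 s|)).
        by rewrite ler_peMl// exprn_ege1//; clear -s0; lra.
      apply: le_trans (lh s s' s0 ss) _; rewrite ler_wpM2r ?subr_ge0//.
      by rewrite ler_piMr// lw.
    have cm : continuous (fun s : R => Num.max s 0).
      by apply: (@lipschitz_continuous _ _ 1) => x y; rewrite mul1r max_lip.
    have cdiv : continuous (fun n : R => n / t).
      by move=> x; apply: cvgM; [exact: cvg_id|exact: cvg_cst].
    pose g' (s : R) := 2 * f1 (Num.max s 0) + 4 * Num.max s 0 * f2 (Num.max s 0).
    have cg' : continuous g'.
      move=> x; apply: cvgD; first by apply: cvgM; [exact: cvg_cst|exact: cf1].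
      by apply: cvgM; [apply: cvgM; [exact: cvg_cst|exact: cm]|exact: cf2].
    have cg : continuous g.
      by move=> x; apply: (@continuous_comp _ _ _ (fun n : R => n / t) g'); [exact: cdiv|exact: cg'].
    rewrite actE; apply: measurable_fun_ifT.
    * by apply: measurable_fun_ler; [exact: measurable_cst|exact: continuous_measurable_fun].
    * exact: measurable_cst.
    * exact: measurable_cst.
- move=> t nx ht nx0.
  exists (t `^ (- al) * Zb1 m f1 (-1) K B t (nx ^+ 2 / t) / t),
    (t `^ (- al) * (2 * Zb2 m f2 (-1) K B t (nx ^+ 2 / t)) / t ^+ 2),
    (Err m al rho Cf B K t (nx ^+ 2 / t)).
  split.
    move=> q e qe er; have := ErrS t ht (-1) nx q e (or_intror erefl) nx0 qe er.
    by rewrite ler_norml => /andP[+ _]; clear; lra.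
  have [h1 _ _ _] := small t ht.
  have aE : act t (nx ^+ 2) = opt_control lam f1 f2 (nx ^+ 2 / t) by rewrite /act max_l// sqr_ge0.
  have := @Z_sub R m al lam D rho K0 f f1 f2 Cf B K t al0 Cf0 hf rho0 K00 hcor erefl erefl
     (t1 _ ht) h1 hl hp D1 (nx ^+ 2) (nx ^+ 2 / t) (act t (nx ^+ 2)) (sqr_ge0 _) erefl aE.
  by rewrite genE//; clear; lra.
Qed.

End barrier_interface.

(** * Upper bound *)

Section integral_toolbox.
Context {disp : measure_display} {T : measurableType disp} {R : realType}.
Variable P : probability T R.
Implicit Types (A : set T) (f g : T -> R).

Lemma ae_bounded_integrable A f (C : R) : measurable A -> measurable_fun A f ->
  {ae P, forall x, A x -> `|f x| <= C} -> P.-integrable A (EFin \o f).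
Proof.
move=> mA mf hb; apply/integrableP; split; first exact/measurable_EFinP.
apply: le_lt_trans.
  apply: (@integral_le_bound _ _ _ P A (EFin \o f) (`|C|)%:E) => //.
    exact/measurable_EFinP.
  apply: filterS hb => x h Ax; rewrite /= lee_fin.
  by apply: le_trans (h Ax) (ler_norm _).
by rewrite ltey_eq fin_numM// fin_num_measure.
Qed.

Lemma ae_le_Rintegral A f g : measurable A ->
  P.-integrable A (EFin \o f) -> P.-integrable A (EFin \o g) ->
  {ae P, forall x, A x -> f x <= g x} ->
  \int[P]_(x in A) f x <= \int[P]_(x in A) g x.
Proof.
move=> mA fi gi h; rewrite -subr_ge0 -RintegralB//.
have mf : measurable_fun A f by apply/measurable_EFinP; exact: measurable_int fi.
have mg : measurable_fun A g by apply/measurable_EFinP; exact: measurable_int gi.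
(* The difference is nonnegative only almost everywhere; its positive part has the same integral. *)
have -> : \int[P]_(x in A) (g x - f x) = \int[P]_(x in A) Num.max (g x - f x) 0.
  rewrite /Rintegral; congr fine; apply: ae_eq_integral => //.
  - by apply/measurable_EFinP; exact: measurable_funB.
  - by apply/measurable_EFinP; apply: measurable_maxr => //; exact: measurable_funB.
  - by apply: filterS h => x hx Ax; rewrite max_l// subr_ge0; exact: hx.
by apply: Rintegral_ge0 => x _; rewrite le_max lexx orbT.
Qed.

Lemma Rintegral_sum (I : Type) (s : seq I) A (h : I -> T -> R) : measurable A ->
  (forall k, P.-integrable A (EFin \o h k)) ->
  P.-integrable A (EFin \o (fun x => \sum_(k <- s) h k x)) /\
  \int[P]_(x in A) (\sum_(k <- s) h k x) = \sum_(k <- s) \int[P]_(x in A) h k x.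
Proof.
move=> mA hi; elim: s => [|k s [IH1 IH2]].
  have e : (fun x => \sum_(k <- [::]) h k x) = cst 0 by apply/funext => x; rewrite big_nil.
  by rewrite e big_nil Rintegral_cst// mul0r; split => //; exact: finite_measure_integrable_cst.
have e : (fun x => \sum_(j <- k :: s) h j x) = (fun x => h k x + \sum_(j <- s) h j x).
  by apply/funext => x; rewrite big_cons.
rewrite e big_cons -IH2; split; last by rewrite RintegralD.
by rewrite (_ : EFin \o _ = (EFin \o h k) \+ (EFin \o (fun x => \sum_(j <- s) h j x)))//; exact: integrableD.
Qed.

Lemma integrable_Z A f (c : R) : measurable A -> P.-integrable A (EFin \o f) ->
  P.-integrable A (EFin \o (fun x => c * f x)).
Proof.
move=> mA fi; rewrite (_ : EFin \o _ = (fun x => c%:E * (EFin \o f) x)%E)//.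
exact: integrableZl.
Qed.

Lemma integrable_D A f g : measurable A -> P.-integrable A (EFin \o f) ->
  P.-integrable A (EFin \o g) -> P.-integrable A (EFin \o (fun x => f x + g x)).
Proof.
move=> mA fi gi; rewrite (_ : EFin \o _ = (EFin \o f) \+ (EFin \o g))//.
exact: integrableD.
Qed.

Lemma integrable_cst A (c : R) : measurable A -> P.-integrable A (EFin \o (fun=> c)).
Proof. by move=> mA; exact: finite_measure_integrable_cst. Qed.

Lemma Rintegral_partition (I : finType) (idx : T -> I) f :
  (forall j, measurable [set x | idx x = j]) -> P.-integrable setT (EFin \o f) ->
  \int[P]_x f x = \sum_(j : I) \int[P]_(x in [set x | idx x = j]) f x.
Proof.
move=> mI fi.
have mf : measurable_fun setT (EFin \o f) by exact: measurable_int fi.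
have E : \big[setU/set0]_(j <- enum I) [set x | idx x = j] = setT.
  apply/seteqP; split => // x _; rewrite -bigcup_seq.
  by exists (idx x) => //=; rewrite mem_enum.
rewrite /Rintegral -[in LHS]E integral_bigsetU_EFin//=; last 3 first.
- exact: enum_uniq.
- by move=> j k _ _ [x [/= <- <-]].
- by rewrite E.
rewrite -big_enum/=.
have fin j : (\int[P]_(x in [set x | idx x = j]) (f x)%:E)%E \is a fin_num.
  by apply: integrable_fin_num => //; apply: integrableS fi.
elim: (enum I) => [|j s IH]; first by rewrite !big_nil.
rewrite !big_cons fineD// ?IH//.
by apply/sum_fin_numP => k _ _.
Qed.

End integral_toolbox.

(** * Coordinates and the natural filtration *)

Section coordinates.
Context {R : realType} {d : nat}.
Let T := seq_space R d.

Lemma measurable_coord (k : 'I_d) :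
  measurable_fun setT (fun u : borel_rV R d => (u : 'rV[R]_d) 0 k).
Proof.
apply: (measurability _ (RGenOpens.measurableE R)) => _ [_ [a [b ->]] <-].
rewrite setTI; apply: sub_sigma_algebra.
apply: (@open_comp _ _ (fun u : 'rV[R]_d => u 0 k)); last exact: interval_open.
by move=> u _; exact: coord_continuous.
Qed.

Lemma measurable_incr i : measurable_fun setT (@incr R d i : T -> borel_rV R d).
Proof.
move=> _ B mB; apply: sub_sigma_algebra; exists i => //; exists B => //.
Qed.

Lemma measurable_entry i (k : 'I_d) : measurable_fun setT (fun w : T => w i 0 k).
Proof.
exact: (measurableT_comp (measurable_coord k) (measurable_incr i)).
Qed.

(** Presents [natural_filtration] as a measurable type, so that measurability with respect to the
    past follows from the usual closure rules. *)
Definition past_gen (i : nat) : set (set (nat -> 'rV[R]_d)) :=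
  \big[setU/set0]_(l < i) preimage_set_system setT (@incr R d l) measurable.

Notation past i := (g_sigma_algebraType (past_gen i)).

Lemma past_measurableE i (A : set T) : natural_filtration i A = @measurable _ (past i) A.
Proof. by []. Qed.

Lemma past_entry i l (k : 'I_d) : (l < i)%N ->
  measurable_fun setT (fun w : past i => w l 0 k).
Proof.
move=> li.
have mi : measurable_fun setT (@incr R d l : past i -> borel_rV R d).
  move=> _ B mB; apply: sub_sigma_algebra; rewrite /past_gen -(bigcup_mkord i (fun l => preimage_set_system setT (@incr R d l) measurable)).
  by exists l => //; exists B.
exact: (measurableT_comp (measurable_coord k) mi).
Qed.

Lemma past_measurable i (A : set T) : natural_filtration i A -> measurable A.
Proof.
move: A; apply: smallest_sub; first exact: sigma_algebra_measurable.
move=> A; rewrite -(bigcup_mkord i (fun l => preimage_set_system setT (@incr R d l) measurable)) => -[l _ [B mB <-]].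
by have := @measurable_incr l measurableT B mB.
Qed.

Lemma partial_sum_entry i (w : T) (k : 'I_d) : partial_sum i w 0 k = \sum_(l < i) w l 0 k.
Proof. by rewrite /partial_sum summxE. Qed.

Lemma past_partial_sum i (k : 'I_d) :
  measurable_fun setT (fun w : past i => partial_sum i w 0 k).
Proof.
apply: (@eq_measurable_fun _ _ _ _ setT (fun w : past i => \sum_(l < i) w l 0 k)).
  by move=> w _; rewrite partial_sum_entry.
by apply: measurable_sum => l; apply: past_entry; exact: ltn_ord.
Qed.

Lemma measurable_partial_sum i (k : 'I_d) :
  measurable_fun setT (fun w : T => partial_sum i w 0 k).
Proof.
apply: (@eq_measurable_fun _ _ _ _ setT (fun w : T => \sum_(l < i) w l 0 k)).
  by move=> w _; rewrite partial_sum_entry.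
by apply: measurable_sum => l; exact: measurable_entry.
Qed.

End coordinates.

(** * Euclidean geometry *)

Section euclid.
Context {R : realType} {d : nat}.
Implicit Types u v w : 'rV[R]_d.

Lemma dotvC u v : dotv u v = dotv v u.
Proof. by apply: eq_bigr => k _; rewrite mulrC. Qed.

Lemma dotvDl u v w : dotv (u + v) w = dotv u w + dotv v w.
Proof. by rewrite -big_split; apply: eq_bigr => k _; rewrite mxE mulrDl. Qed.

Lemma dotvZl (c : R) u v : dotv (c *: u) v = c * dotv u v.
Proof. by rewrite /dotv mulr_sumr; apply: eq_bigr => k _; rewrite mxE mulrA. Qed.

Lemma dotv_ge0 u : 0 <= dotv u u.
Proof. by apply: sumr_ge0 => k _; rewrite -expr2 sqr_ge0. Qed.

Lemma dotv_sqrD u v : dotv (u + v) (u + v) = dotv u u + 2 * dotv u v + dotv v v.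
Proof. by rewrite dotvDl !(dotvC _ (u + v)) !dotvDl (dotvC v u); ring. Qed.

Lemma dotv0_eq0 u : dotv u u = 0 -> u = 0.
Proof.
move=> /eqP; rewrite psumr_eq0 => [/allP h|k _]; last by rewrite -expr2 sqr_ge0.
apply/rowP => k; rewrite mxE; have := h k (mem_index_enum k).
by rewrite mulf_eq0 orbb => /eqP.
Qed.

Lemma enorm_sqr u : enorm u ^+ 2 = dotv u u.
Proof. by rewrite sqr_sqrtr// dotv_ge0. Qed.

Lemma enorm_ge0 u : 0 <= enorm u. Proof. exact: sqrtr_ge0. Qed.

Lemma enormZ (c : R) u : enorm (c *: u) = `|c| * enorm u.
Proof. by rewrite /enorm dotvZl dotvC dotvZl mulrA -expr2 sqrtrM ?sqr_ge0// sqrtr_sqr. Qed.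

Lemma cauchy_schwarz u v : `|dotv u v| <= enorm u * enorm v.
Proof.
rewrite -(@ler_pXn2r _ 2) ?nnegrE ?mulr_ge0 ?enorm_ge0// real_normK ?num_real//.
rewrite exprMn !enorm_sqr; set a := dotv u v; set b := dotv v v.
have b0 : 0 <= b by exact: dotv_ge0.
have [b1|b1] := eqVneq b 0.
  by rewrite /a (dotv0_eq0 b1) dotvC /dotv big1 ?expr0n ?mulr_ge0 ?dotv_ge0// => k _; rewrite mxE mul0r.
have bp : 0 < b by rewrite lt_neqAle eq_sym b1.
have h : 0 <= b * (dotv u u * b - a ^+ 2).
  have -> : b * (dotv u u * b - a ^+ 2) = dotv (b *: u + - a *: v) (b *: u + - a *: v).
    by rewrite dotv_sqrD !dotvZl !(dotvC _ (_ *: _)) !dotvZl (dotvC v u) -/a -/b; ring.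
  exact: dotv_ge0.
by rewrite pmulr_rge0// subr_ge0 in h.
Qed.

Lemma entry_le_enorm u k : `|u 0 k| <= enorm u.
Proof.
rewrite -(@ler_pXn2r _ 2) ?nnegrE ?enorm_ge0// enorm_sqr real_normK ?num_real//.
rewrite /dotv (bigD1 k)//= -expr2 lerDl; apply: sumr_ge0 => j _; by rewrite -expr2 sqr_ge0.
Qed.

Lemma dotv_le (C : R) u : 0 <= C -> (forall k, `|u 0 k| <= C) -> dotv u u <= d%:R * C ^+ 2.
Proof.
move=> C0 h; apply: (@le_trans _ _ (\sum_(k < d) C ^+ 2)).
  by apply: ler_sum => k _; rewrite -expr2 -real_normK ?num_real// lerXn2r ?nnegrE.
by rewrite sumr_const card_ord mulr_natl.
Qed.

(** For a unit vector [x] these are the projections of the basis vectors onto the hyperplane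
    orthogonal to [x]. They form a Parseval frame of it, which replaces the choice of an orthonormal
    basis. *)
Definition projb (x : 'rV[R]_d) (k : 'I_d) : 'rV[R]_d := delta_mx 0 k - x 0 k *: x.

Lemma dotv_delta u k : dotv u (delta_mx 0 k) = u 0 k.
Proof.
rewrite /dotv (bigD1 k)//= mxE !eqxx mulr1 big1 ?addr0// => j jk.
by rewrite mxE (negbTE jk) andbF mulr0.
Qed.

Lemma dotv_projb u x k : dotv u (projb x k) = u 0 k - x 0 k * dotv u x.
Proof.
rewrite /projb dotvC dotvDl -scaleNr dotvZl dotvC dotv_delta (dotvC x); ring.
Qed.

Lemma sum_projb u x : dotv x x = 1 -> \sum_(k < d) dotv u (projb x k) ^+ 2 + dotv u x ^+ 2 = dotv u u.
Proof.
move=> x1; under eq_bigr do rewrite dotv_projb.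
have key (s : R) : \sum_(k < d) (u 0 k - x 0 k * s) ^+ 2 =
   \sum_(k < d) u 0 k * u 0 k - 2 * s * \sum_(k < d) u 0 k * x 0 k
   + s ^+ 2 * \sum_(k < d) x 0 k * x 0 k.
  by rewrite !mulr_sumr -sumrB -big_split/=; apply: eq_bigr => k _; ring.
by rewrite key -/(dotv u u) -/(dotv u x) -/(dotv x x) x1; ring.
Qed.

Lemma sum_projb_sqr x : dotv x x = 1 -> \sum_(k < d) dotv (projb x k) (projb x k) = d%:R - 1.
Proof.
move=> x1.
have e k : dotv (projb x k) (projb x k) = 1 - x 0 k * x 0 k.
  rewrite dotv_projb (dotvC _ x) dotv_projb x1 mulr1 subrr mulr0 subr0.
  by rewrite /projb !mxE !eqxx.
under eq_bigr do rewrite e.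
by rewrite sumrB sumr_const card_ord -/(dotv x x) x1.
Qed.

Lemma unit_vector u : (0 < d)%N -> exists2 x, dotv x x = 1 & u = enorm u *: x.
Proof.
move=> d0; have [u0|u0] := eqVneq (enorm u) 0.
  have uu : u = 0 by apply: dotv0_eq0; rewrite -enorm_sqr u0 expr0n.
  exists (delta_mx 0 (Ordinal d0)); last by rewrite u0 scale0r uu.
  by rewrite dotv_delta mxE !eqxx.
exists ((enorm u)^-1 *: u); last by rewrite scalerA divff// scale1r.
by rewrite dotvZl dotvC dotvZl -enorm_sqr expr2; field.
Qed.

End euclid.

(** * One step from a deterministic point *)

Section one_step.
Context {R : realType} {d : nat}.
Variables (lam rho : R) (P : probability (seq_space R d) R).
Hypotheses (hlam : 0 < lam <= 1) (hP : martingale_laws d lam rho P).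
Let T := seq_space R d.

Let half_sqr i (v : 'rV[R]_d) (w : T) : R := 2^-1 * dotv (w i) v ^+ 2.

Lemma ae_increment_le i : {ae P, forall w : T, enorm (w i) <= rho}.
Proof. by have [_ ? _] := hP i. Qed.

Lemma half_sqr_integrable i v (A : set T) : natural_filtration i A ->
  P.-integrable A (EFin \o half_sqr i v).
Proof.
move=> hA; have [_ _ [Y [hY _ _]]] := hP i; have [h _ _ _] := hY v.
by apply: integrableS h => //; exact: past_measurable hA.
Qed.

(** Ellipticity speaks of unit vectors; homogeneity extends it to all [v], in particular to the
    vectors [projb x k], which are not normalized. *)
Lemma half_sqr_itv i v (A : set T) : natural_filtration i A ->
  lam * dotv v v * fine (P A) <= \int[P]_(w in A) half_sqr i v w <= dotv v v * fine (P A).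
Proof.
move=> hA; have mA := past_measurable hA.
have [v0|v0] := eqVneq (dotv v v) 0.
  rewrite v0 mulr0 !mul0r.
  have -> : \int[P]_(w in A) half_sqr i v w = 0; last by rewrite lexx.
  rewrite (@eq_Rintegral _ _ _ _ _ (cst 0)) ?Rintegral_cst ?mul0r// => w _.
  rewrite /half_sqr (dotv0_eq0 v0) dotvC /dotv big1 ?expr0n ?mulr0// => k _.
  by rewrite mxE mul0r.
have e0 : enorm v != 0 by apply: contra v0 => /eqP e; rewrite -enorm_sqr e expr0n.
pose u := (enorm v)^-1 *: v.
have u1 : enorm u = 1 by rewrite enormZ normfV ger0_norm ?enorm_ge0// mulVf.
have -> : \int[P]_(w in A) half_sqr i v w = dotv v v * \int[P]_(w in A) half_sqr i u w.
  rewrite -RintegralZl//; last exact: half_sqr_integrable.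
  apply: eq_Rintegral => w _; rewrite /half_sqr /u -enorm_sqr (dotvC _ (_ *: _)) dotvZl (dotvC v).
  by field.
have [_ _ [Y [hY _ hb]]] := hP i; have [_ iY _ eY] := hY u.
have -> : \int[P]_(w in A) half_sqr i u w = \int[P]_(w in A) Y u w.
  by rewrite /Rintegral eY.
have iYA : P.-integrable A (EFin \o Y u) by apply: integrableS iY.
have b1 : {ae P, forall w : T, A w -> lam <= Y u w}.
  apply: filterS hb => w [h _] _; rewrite -lee_fin; apply: le_trans h _.
  by apply: ereal_inf_lbound; exists u.
have b2 : {ae P, forall w : T, A w -> Y u w <= 1}.
  apply: filterS hb => w [_ h] _; rewrite -lee_fin; apply: le_trans _ h.
  by apply: ereal_sup_ubound; exists u.
have v1 : 0 <= dotv v v by exact: dotv_ge0.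
have g1 := ae_le_Rintegral mA (integrable_cst P lam mA) iYA b1.
have g2 := ae_le_Rintegral mA iYA (integrable_cst P 1 mA) b2.
rewrite Rintegral_cst// in g1; rewrite Rintegral_cst// mul1r in g2.
by rewrite (mulrC lam) -mulrA !ler_wpM2l.
Qed.

Lemma entry_integral i (k : 'I_d) (A : set T) : natural_filtration i A ->
  P.-integrable A (EFin \o (fun w : T => w i 0 k)) /\ \int[P]_(w in A) (w i 0 k) = 0.
Proof.
move=> hA; have mA := past_measurable hA; have [h _ _] := hP i; have [h1 _ _ h2] := h k.
split; first by apply: integrableS h1.
by rewrite /Rintegral -h2//= integral0_eq.
Qed.

Lemma measurable_dotv_add (g : 'I_d -> T -> R) : (forall k, measurable_fun setT (g k)) ->
  measurable_fun setT (fun w => \sum_(k < d) g k w * g k w).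
Proof.
by move=> mg; apply: measurable_sum => k; apply: measurable_funM; exact: mg.
Qed.

Variables (al t0 M : R) (V : R -> R -> R).
Hypotheses (hrho : 0 <= rho) (hd : (0 < d)%N) (hV : upper_barrier lam d%:R al rho t0 M V).

Lemma barrier_measurable t (g : T -> R) : t0 <= t -> measurable_fun setT g ->
  (forall w, 0 <= g w) -> measurable_fun setT (fun w => V t (g w)).
Proof.
move=> ht mg g0; have [_ _ _ hL _] := hV; have [L L0 hl] := hL t ht.
have e : (fun w => V t (g w)) = (fun w => V t (Num.max (g w) 0)).
  by apply/funext => w; rewrite max_l.
have mV : measurable_fun setT (fun n : R => V t (Num.max n 0)).
  apply: continuous_measurable_fun; apply: (@max0_lip _ _ L) => // s s' s0 ss.
  by have := hl s' s (le_trans s0 ss) s0; rewrite (ger0_norm (_ : 0 <= s' - s)) ?subr_ge0.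
by rewrite e; exact: (measurableT_comp mV mg).
Qed.

Lemma barrier_le t n : t0 <= t -> 0 <= n -> exists2 C, 0 <= C & forall n', 0 <= n' <= n -> `|V t n'| <= C.
Proof.
move=> ht n0; have [_ _ _ hL _] := hV; have [L L0 hl] := hL t ht.
exists (`|V t 0| + L * n); first by rewrite addr_ge0// mulr_ge0.
move=> n' /andP[n'0 nn]; have := hl n' 0 n'0 (lexx _); rewrite subr0 (ger0_norm n'0) => h.
have -> : V t n' = V t 0 + (V t n' - V t 0) by ring.
apply: le_trans (ler_normD _ _) _; rewrite lerD2l; apply: le_trans h _.
by rewrite ler_wpM2l.
Qed.

Lemma cell_integrable i t (A : set T) (c : 'rV[R]_d) : measurable A -> t0 <= t ->
  P.-integrable A (EFin \o (fun w : T => V t (dotv (c + w i) (c + w i)))).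
Proof.
move=> mA ht; set nx := enorm c; have rho0 := hrho.
have mD (w : T) : dotv (c + w i) (c + w i) = \sum_(k < d) (c 0 k + w i 0 k) * (c 0 k + w i 0 k).
  by apply: eq_bigr => k _; rewrite !mxE.
have mf : measurable_fun setT (fun w : T => V t (dotv (c + w i) (c + w i))).
  apply: barrier_measurable => //; last by move=> w; exact: dotv_ge0.
  rewrite (_ : (fun w : T => dotv (c + w i) (c + w i)) = (fun w : T => \sum_(k < d) (c 0 k + w i 0 k) * (c 0 k + w i 0 k))).
    apply: (measurable_dotv_add (g := fun k w => c 0 k + w i 0 k)) => k.
    by apply: measurable_funD => //; exact: measurable_entry.
  by apply/funext => w; exact: mD.
have sE (w : T) : dotv (c + w i) (c + w i) = nx ^+ 2 + 2 * dotv c (w i) + enorm (w i) ^+ 2.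
  by rewrite dotv_sqrD !enorm_sqr.
have cs (w : T) : `|dotv c (w i)| <= nx * enorm (w i) by exact: cauchy_schwarz.
have nx0 : 0 <= nx by exact: enorm_ge0.
have [C C0 hC] := barrier_le ht (sqr_ge0 (nx + rho)).
apply: (@ae_bounded_integrable _ _ _ _ _ _ C) => //; first exact: measurable_funTS.
apply: filterS (ae_increment_le i) => w hw _; apply: hC; rewrite dotv_ge0/= sE.
have := ler_norm (dotv c (w i)); have := cs w; have := enorm_ge0 (w i).
move: (enorm (w i)) (dotv c (w i)) `|_| hw => e s ns hw e0 g2 g3.
have : nx * e <= nx * rho by rewrite ler_wpM2l.
have : e ^+ 2 <= rho ^+ 2 by rewrite lerXn2r ?nnegrE.
by rewrite !expr2; lra.
Qed.

(** The quadratic majorant of [V] is integrated over an event [A] of the past. Its linear part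
    vanishes by the martingale property, and the mean radial and tangential second moments on [A]
    are admissible values of [a] and [tau] in the barrier inequality. *)
Lemma cell_bound i t (A : set T) (c : 'rV[R]_d) : natural_filtration i A -> t0 <= t ->
  \int[P]_(w in A) V t (dotv (c + w i) (c + w i)) <= V (t + 1) (dotv c c) * fine (P A).
Proof.
move=> hA ht; have mA := past_measurable hA.
have [x x1 cx] := unit_vector c hd.
set nx := enorm c in cx.
have [_ _ _ _ hG] := hV; have [G1 [G2 [E [h1 h2]]]] := hG t nx ht (enorm_ge0 _).
have rho0 := hrho.
pose q (w : T) := \sum_(k < d) c 0 k * w i 0 k.
(* The increment is split along the direction [x] of [c] and its orthogonal complement; the factors
   2 undo the 1/2 in [half_sqr]. *)
pose g (w : T) := (V t (nx ^+ 2) + E) + (2 * G1 * q w + (2 * G1 * (\sum_(k < d) half_sqr i (projb x k) w)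
   + 2 * (G1 + G2 * nx ^+ 2) * half_sqr i x w)).
have qE (w : T) : q w = dotv c (w i) by [].
have sE (w : T) : dotv (c + w i) (c + w i) = nx ^+ 2 + 2 * dotv c (w i) + enorm (w i) ^+ 2.
  by rewrite dotv_sqrD !enorm_sqr.
have cs (w : T) : `|dotv c (w i)| <= nx * enorm (w i) by exact: cauchy_schwarz.
have [iq1 iq2] : P.-integrable A (EFin \o q) /\ \int[P]_(w in A) q w = 0.
  have [a b] := @Rintegral_sum _ T R P 'I_d (index_enum 'I_d) A (fun k w => c 0 k * w i 0 k) mA
    (fun k => integrable_Z (c 0 k) mA (entry_integral k hA).1).
  split => //; rewrite b big1// => k _; have [e1 e2] := entry_integral k hA.
  by rewrite RintegralZl// e2 mulr0.
have [is1 is2] := @Rintegral_sum _ T R P 'I_d (index_enum 'I_d) A (fun k => half_sqr i (projb x k)) mA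
    (fun k => half_sqr_integrable (projb x k) hA).
have ix := half_sqr_integrable x hA.
have i1 := integrable_Z (2 * G1) mA iq1.
have i2 := integrable_Z (2 * G1) mA is1.
have i3 := integrable_Z (2 * (G1 + G2 * nx ^+ 2)) mA ix.
have i4 := integrable_D mA i2 i3.
have i5 := integrable_D mA i1 i4.
have i0 := integrable_cst P (V t (nx ^+ 2) + E) mA.
have ig : P.-integrable A (EFin \o g) by exact: integrable_D mA i0 i5.
have fg : {ae P, forall w : T, A w -> V t (dotv (c + w i) (c + w i)) <= g w}.
  apply: filterS (ae_increment_le i) => w hw _.
  rewrite sE; have := h1 (dotv c (w i)) (enorm (w i)) (cs w).
  rewrite enorm_ge0 hw => /(_ isT) h; apply: le_trans h _.
  rewrite /g qE /half_sqr -mulr_sumr enorm_sqr -(sum_projb (w i) x1).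
  have -> : dotv c (w i) = nx * dotv (w i) x by rewrite cx dotvZl dotvC.
  by rewrite le_eqVlt; apply/orP; left; apply/eqP; field.
have jf := cell_integrable i c mA ht.
apply: le_trans (ae_le_Rintegral mA jf ig fg) _.
have -> : \int[P]_(w in A) g w = (V t (nx ^+ 2) + E) * fine (P A) +
   (2 * G1 * \sum_(k < d) \int[P]_(w in A) half_sqr i (projb x k) w +
    2 * (G1 + G2 * nx ^+ 2) * \int[P]_(w in A) half_sqr i x w).
  have r0 := RintegralD mA i0 i5; have r1 := RintegralD mA i1 i4; have r2 := RintegralD mA i2 i3.
  have z1 := @RintegralZl _ _ _ P A _ (2 * G1) mA iq1.
  have z2 := @RintegralZl _ _ _ P A _ (2 * G1) mA is1.
  have z3 := @RintegralZl _ _ _ P A _ (2 * (G1 + G2 * nx ^+ 2)) mA ix.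
  rewrite /g r0 r1 r2 z1 z2 z3 iq2 mulr0 add0r is2; congr (_ + _).
  by rewrite Rintegral_cst.
have /andP[l0 l1] := hlam.
set p := fine (P A).
have p0 : 0 <= p by exact: fine_ge0.
have := half_sqr_itv x hA; rewrite x1 mulr1 mul1r -/p; set Ix := \int[P]_(w in A) _ => /andP[x2 x3].
have s1 : lam * (d%:R - 1) * p <= \sum_(k < d) \int[P]_(w in A) half_sqr i (projb x k) w.
  rewrite -(sum_projb_sqr x1) mulr_sumr mulr_suml; apply: ler_sum => k _.
  by have /andP[] := half_sqr_itv (projb x k) hA.
have s2 : \sum_(k < d) \int[P]_(w in A) half_sqr i (projb x k) w <= (d%:R - 1) * p.
  rewrite -(sum_projb_sqr x1) mulr_suml; apply: ler_sum => k _.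
  by have /andP[] := half_sqr_itv (projb x k) hA.
move: s1 s2; set IS := \sum_(k < d) _ => s1 s2.
rewrite -enorm_sqr -/nx.
(* The means are quotients by [p]; on a null event both moments vanish instead. *)
have [pz|pn] := eqVneq p 0.
  have -> : IS = 0 by apply/eqP; rewrite eq_le; move: s1 s2; rewrite pz !mulr0 => -> ->.
  have -> : Ix = 0 by apply/eqP; rewrite eq_le; move: x2 x3; rewrite pz !mulr0 => -> ->.
  by rewrite pz !mulr0 !addr0.
have pp : 0 < p by rewrite lt_neqAle eq_sym pn.
have := h2 (Ix / p) (IS / p).
rewrite ler_pdivlMr// x2 ler_pdivrMr// mul1r x3 ler_pdivlMr// s1 => /(_ isT isT).
rewrite -(ler_pM2r pp); apply: le_trans; rewrite le_eqVlt; apply/orP; left; apply/eqP.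
by field.
Qed.

End one_step.

(** * The supermartingale property *)

Section upper_bound.
Context {R : realType} {d : nat}.
Variables (lam rho : R) (P : probability (seq_space R d) R).
Hypotheses (hlam : 0 < lam <= 1) (hP : martingale_laws d lam rho P).
Variables (al t0 M : R) (V : R -> R -> R).
Hypotheses (hrho : 0 <= rho) (hd : (0 < d)%N) (hV : upper_barrier lam d%:R al rho t0 M V).
Let T := seq_space R d.

Let sqn (x : 'rV[R]_d) : R := dotv x x.

Lemma measurable_truncn_eq (m : nat) : measurable [set y : R | Num.truncn y = m].
Proof.
have ge_n (n : nat) : measurable [set y : R | (n <= Num.truncn y)%N].
  case: n => [|n].
    by rewrite (_ : [set _ | _] = setT)//; apply/seteqP; split.
  rewrite (_ : [set _ | _] = `[n.+1%:R, +oo[%classic); first exact: measurable_itv.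
  by apply/seteqP; split => y /=; rewrite in_itv/= andbT truncn_gt_nat.
rewrite (_ : [set _ | _] = [set y : R | (m <= Num.truncn y)%N] `\` [set y : R | (m.+1 <= Num.truncn y)%N]).
  exact: measurableD.
apply/seteqP; split => y /=; first by move=> ->; rewrite ltnn leqnn; split.
by move=> [h1 /negP]; rewrite -leqNgt => h2; apply/eqP; rewrite eqn_leq h1 h2.
Qed.

Lemma measurable_partial_sqn i :
  measurable_fun setT (fun w : T => sqn (partial_sum i w)).
Proof.
apply: (measurable_dotv_add (g := fun k w => partial_sum i w 0 k)) => k.
exact: measurable_partial_sum.
Qed.

Lemma partial_sumS i (w : T) : partial_sum i.+1 w = partial_sum i w + w i.
Proof. by rewrite /partial_sum big_ord_recr. Qed.

Lemma ae_partial_sum_le : {ae P, forall w : T, forall i k, `|partial_sum i w 0 k| <= i%:R * rho}.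
Proof.
have h : {ae P, forall w : T, forall i, enorm (w i) <= rho}.
  by apply: ae_foralln => i; exact: ae_increment_le hP i.
apply: filterS h => w hw i k; rewrite partial_sum_entry.
apply: le_trans (ler_norm_sum _ _ _) _.
rewrite -[i in i%:R]card_ord mulr_natl -sumr_const.
by apply: ler_sum => l _; apply: le_trans (entry_le_enorm _ _) (hw l).
Qed.

Lemma V_partial_integrable i t : t0 <= t ->
  P.-integrable setT (EFin \o (fun w : T => V t (sqn (partial_sum i w)))).
Proof.
move=> ht; have n0 : 0 <= d%:R * (i%:R * rho) ^+ 2 by rewrite mulr_ge0// sqr_ge0.
have [C C0 hC] := barrier_le hV ht n0.
apply: (@ae_bounded_integrable _ _ _ _ _ _ C) => //.
  apply: (barrier_measurable hV) => //; last by move=> w; exact: dotv_ge0.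
  exact: measurable_partial_sqn.
apply: filterS ae_partial_sum_le => w hw _; apply: hC; rewrite dotv_ge0/=.
by apply: dotv_le => //; rewrite mulr_ge0.
Qed.

Let sqn_diff (x y z : 'rV[R]_d) (e C : R) : 0 <= e -> 0 <= C -> (forall k, `|x 0 k - y 0 k| <= e) ->
  (forall k, `|x 0 k| <= C) -> (forall k, `|y 0 k| <= C) -> (forall k, `|z 0 k| <= C) ->
  `|sqn (x + z) - sqn (y + z)| <= d%:R * (e * (4 * C)).
Proof.
move=> e0 C0 hxy hx hy hz.
have -> : sqn (x + z) - sqn (y + z) = \sum_(k < d) (x 0 k - y 0 k) * (x 0 k + y 0 k + 2 * z 0 k).
  by rewrite /sqn /dotv -sumrB; apply: eq_bigr => k _; rewrite !mxE; ring.
apply: le_trans (ler_norm_sum _ _ _) _.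
rewrite -[X in X%:R * _]card_ord mulr_natl -sumr_const; apply: ler_sum => k _.
rewrite normrM; apply: ler_pM => //.
have := hx k; have := hy k; have := hz k; rewrite !ler_norml => /andP[? ?] /andP[? ?] /andP[? ?].
by apply/andP; split; lra.
Qed.

(** On each cell the position at time [i] is replaced by the corner [c j], both before and after the
    step. The two Lipschitz errors are of order 1/N, and [N] is arbitrary. *)
Lemma barrier_step i t : t0 <= t ->
  \int[P]_w V t (sqn (partial_sum i.+1 w)) <= \int[P]_w V (t + 1) (sqn (partial_sum i w)).
Proof.
move=> ht; have ht1 : t0 <= t + 1 by apply: le_trans ht _; rewrite lerDl.
have [_ _ _ hL _] := hV.
have [L L0 hl] := hL t ht; have [L' L0' hl'] := hL (t + 1) ht1.
pose b := i%:R * rho + 1.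
have ir : 0 <= i%:R * rho by rewrite mulr_ge0.
have b1 : 1 <= b by rewrite /b lerDr.
pose C := b + rho.
have C0 : 0 <= C by rewrite /C addr_ge0//; exact: le_trans b1.
pose Q := (L + L') * (d%:R * (4 * C)).
suff key (N : nat) : (0 < N)%N -> \int[P]_w V t (sqn (partial_sum i.+1 w)) <=
    \int[P]_w V (t + 1) (sqn (partial_sum i w)) + Q / N%:R.
  have Q0 : 0 <= Q by rewrite mulr_ge0 ?addr_ge0// mulr_ge0// mulr_ge0.
  rewrite -subr_le0 leNgt; apply/negP => X0; set X := _ - _ in X0.
  pose N := (Num.truncn (Q / X)).+1.
  have hN : Q / X < N%:R by exact: truncnS_gt.
  have Np : 0 < N%:R :> R by rewrite ltr0n.
  have := key N isT; rewrite -lerBlDl -/X ler_pdivlMr// => h.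
  by move: hN; rewrite ltr_pdivrMr// mulrC; lra.
move=> N0; have Np : 0 < N%:R :> R by rewrite ltr0n.
(* Coordinates lie in [[- b, b]] almost surely, so N (x + b) <= 2 b N and [inord] keeps the index
   outside a null set. *)
pose J := Num.truncn (N%:R * (2 * b)).
pose h (x : R) : 'I_J.+1 := inord (Num.truncn (N%:R * (x + b))).
pose idx (w : T) : {ffun 'I_d -> 'I_J.+1} := [ffun k => h (partial_sum i w 0 k)].
pose c (j : {ffun 'I_d -> 'I_J.+1}) : 'rV[R]_d := \row_k ((j k)%:R / N%:R - b).
have mh (a : 'I_J.+1) : measurable [set x : R | h x = a].
  have ma : measurable_fun setT (fun x : R => N%:R * (x + b)).
    by apply: measurable_funM => //; apply: measurable_funD.
  rewrite (_ : [set x | h x = a] = (fun x : R => N%:R * (x + b)) @^-1`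
      (\bigcup_(m in [set m | inord m = a]) [set y : R | Num.truncn y = m])).
    rewrite -[X in measurable X]setTI; apply: ma => //.
    by apply: bigcup_measurable => m _; exact: measurable_truncn_eq.
  apply/seteqP; split => x /=; first by move=> hx; exists (Num.truncn (N%:R * (x + b))).
  by move=> [m /= <- <-].
have mF j : natural_filtration i [set w : T | idx w = j].
  have -> : [set w : T | idx w = j] = \bigcap_(k in [set: 'I_d]) [set w : T | h (partial_sum i w 0 k) = j k].
    apply/seteqP; split => w /=; first by move=> <- k _ /=; rewrite ffunE.
    by move=> hw; apply/ffunP => k; rewrite ffunE; exact: hw.
  rewrite past_measurableE; apply: fin_bigcap_measurable => //.
  move=> k _; have := @past_partial_sum R d i k measurableT _ (mh (j k)).
  by rewrite setTI.
have mF' j : measurable [set w : T | idx w = j] by exact: past_measurable (mF j).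
pose p j := fine (P [set w : T | idx w = j]).
have sp : \sum_j p j = 1.
  have := @Rintegral_partition _ T R P _ idx (fun=> 1) mF' (integrable_cst P 1 measurableT).
  rewrite Rintegral_cst//; have -> : fine (P setT) = 1 by rewrite probability_setT.
  rewrite mulr1 => ->.
  by apply: eq_bigr => j _; rewrite Rintegral_cst// mul1r.
have near_c : {ae P, forall w : T, (forall k, `|partial_sum i w 0 k - c (idx w) 0 k| <= N%:R^-1) /\
   (forall k, `|partial_sum i w 0 k| <= C) /\ (forall k, `|c (idx w) 0 k| <= C)}.
  apply: filterS ae_partial_sum_le => w hw.
  have hk k : `|partial_sum i w 0 k - c (idx w) 0 k| <= N%:R^-1.
    have := hw i k; rewrite ler_norml => /andP[q1 q2].
    rewrite !mxE ffunE /h; set x := partial_sum i w 0 k in q1 q2 *.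
    have y0 : 0 <= N%:R * (x + b) by rewrite mulr_ge0//; move: q1 q2; rewrite /b; lra.
    have yJ : (Num.truncn (N%:R * (x + b)) < J.+1)%N.
      rewrite ltnS /J; apply: le_truncn.
      by rewrite ler_pM2l//; move: q1 q2; rewrite /b; lra.
    rewrite inordK//; have /andP[z1 z2] := truncn_itv y0.
    move: z1 z2; set m := Num.truncn _ => z1 z2.
    have e1 : m%:R / N%:R <= x + b by rewrite ler_pdivrMr// mulrC.
    have e2 : x + b < m%:R / N%:R + N%:R^-1.
      have -> : m%:R / N%:R + N%:R^-1 = m.+1%:R / N%:R :> R by rewrite -natr1 mulrDl mul1r.
      by rewrite ltr_pdivlMr// mulrC.
    by rewrite ler_norml; apply/andP; split; lra.
  have N1 : N%:R^-1 <= 1 :> R by rewrite invf_le1// ler1n.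
  split=> //; split=> k.
    by apply: le_trans (hw i k) _; rewrite /C /b; move: hrho; lra.
  have := hk k; have := hw i k; rewrite !ler_norml => /andP[q1 q2] /andP[q3 q4].
  by move: hrho; rewrite /C /b => ?; apply/andP; split; lra.
have If := V_partial_integrable i.+1 ht; have Ig := V_partial_integrable i ht1.
rewrite (Rintegral_partition mF' If) (Rintegral_partition mF' Ig).
have -> : Q / N%:R = \sum_j (Q / N%:R * p j) by rewrite -mulr_sumr sp mulr1.
rewrite -big_split/=; apply: ler_sum => j _; rewrite -/(p j).
have mj := mF' j; set A := [set w : T | idx w = j] in mj *.
pose e := d%:R * (N%:R^-1 * (4 * C)).
have IfA : P.-integrable A (EFin \o (fun w : T => V t (sqn (partial_sum i.+1 w)))) by apply: integrableS If.
have IgA : P.-integrable A (EFin \o (fun w : T => V (t + 1) (sqn (partial_sum i w)))) by apply: integrableS Ig.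
have rC : {ae P, forall w : T, forall k, `|w i 0 k| <= C}.
  apply: filterS (ae_increment_le hP i) => w hw k.
  apply: le_trans (entry_le_enorm _ _) _; apply: le_trans hw _; rewrite /C lerDr.
  exact: le_trans b1.
have n0 : 0 <= d%:R * (C + C) ^+ 2 by rewrite mulr_ge0// sqr_ge0.
have IcA : P.-integrable A (EFin \o (fun w : T => V t (sqn (c j + w i)))).
  exact: (cell_integrable hP hrho hV).
have Ninv : 0 <= N%:R^-1 :> R by rewrite invr_ge0.
have s1 : \int[P]_(w in A) V t (sqn (partial_sum i.+1 w)) <=
    \int[P]_(w in A) (V t (sqn (c j + w i)) + L * e).
  apply: ae_le_Rintegral => //; first by apply: integrable_D => //; exact: integrable_cst.
  apply: filterS2 near_c rC => w [w1 [w2 w3]] w4 Aw; rewrite Aw in w1 w3.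
  have h1 := sqn_diff Ninv C0 w1 w2 w3 w4.
  have := hl _ _ (dotv_ge0 (partial_sum i.+1 w)) (dotv_ge0 (c j + w i)).
  rewrite partial_sumS ler_norml => /andP[_ h2].
  have h3 := ler_wpM2l L0 h1.
  by move: h2 h3; rewrite /sqn -/e; lra.
have s2 : V (t + 1) (sqn (c j)) * p j <= \int[P]_(w in A) (V (t + 1) (sqn (partial_sum i w)) + L' * e).
  rewrite -Rintegral_cst//; apply: ae_le_Rintegral => //; first exact: integrable_cst.
    by apply: integrable_D => //; exact: integrable_cst.
  apply: filterS2 near_c rC => w [w1 [w2 w3]] w4 Aw; rewrite Aw in w1 w3.
  have z0 k : `|(0 : 'rV[R]_d) 0 k| <= C by rewrite mxE normr0.
  have h1 := sqn_diff Ninv C0 w1 w2 w3 z0; rewrite !addr0 in h1.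
  have := hl' _ _ (dotv_ge0 (partial_sum i w)) (dotv_ge0 (c j)).
  rewrite ler_norml => /andP[h2 _].
  have h3 := ler_wpM2l L0' h1.
  by move: h2 h3; rewrite /sqn -/e; lra.
have s3 := cell_bound hlam hP hrho hd hV (c j) (mF j) ht.
move: s1 s2; rewrite RintegralD//; last exact: integrable_cst.
rewrite RintegralD//; last exact: integrable_cst.
rewrite !Rintegral_cst// -/(p j) => s1 s2.
have -> : Q / N%:R * p j = L * e * p j + L' * e * p j by rewrite /Q /e; ring.
by move: s1 s2 s3; rewrite -/(p j) -/A /sqn; lra.
Qed.

End upper_bound.

(** * The upper bound on the return probability *)

Section upper_bound_final.
Context {R : realType} {d : nat}.
Variables (lam rho : R).
Hypotheses (hlam : 0 < lam <= 1) (hrho : 0 <= rho) (hd : (0 < d)%N).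
Variables (al t0 M : R) (V : R -> R -> R).
Hypothesis hV : upper_barrier lam d%:R al rho t0 M V.
Let T := seq_space R d.

Lemma barrier_iter (P : probability T R) i t : martingale_laws d lam rho P -> t0 <= t ->
  \int[P]_w V t (dotv (partial_sum i w) (partial_sum i w)) <= V (t + i%:R) 0.
Proof.
move=> hP; elim: i t => [|i ih] t ht.
  rewrite addr0 (@eq_Rintegral _ _ _ _ _ (cst (V t 0))).
    by rewrite Rintegral_cst// (_ : fine (P setT) = 1) ?mulr1//; rewrite probability_setT.
  move=> w _; rewrite /= /partial_sum big_ord0; congr (V t _).
  by rewrite /dotv big1// => k _; rewrite mxE mul0r.
apply: le_trans (barrier_step hlam hP hrho hd hV i ht) _.
have -> : t + i.+1%:R = t + 1 + i%:R by rewrite -natr1; ring.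
apply: ih.
by apply: le_trans ht _; rewrite lerDl.
Qed.

Lemma barrier_min (N : R) : 0 <= N -> exists2 c, 0 < c & forall n, 0 <= n <= N -> c <= V t0 n.
Proof.
move=> N0; have [t01 Vp _ hL _] := hV; have [L L0 hl] := hL t0 (lexx _).
have ct : continuous (fun n : R => V t0 (Num.max n 0)).
  apply: (@max0_lip _ _ L) => // s s' s0 ss.
  by have := hl s' s (le_trans s0 ss) s0; rewrite (ger0_norm (_ : 0 <= s' - s)) ?subr_ge0.
have [c] := EVT_min N0 (continuous_subspaceT (A := `[0, N]) ct).
rewrite in_itv/= => /andP[c0 c1] hc.
exists (V t0 (Num.max c 0)); first by apply: Vp => //; rewrite le_max lexx orbT.
move=> n /andP[n0 n1]; have := hc n; rewrite in_itv/= n0 n1 => /(_ isT).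
by rewrite (max_l n0).
Qed.

(** Markov's inequality for [V t0] at |M_n|^2: it is at least [c] on the ball and positive
    elsewhere, and its mean is at most [V] at the origin at time t0 + n. *)
Lemma return_upper_bound (K : R) : 0 <= al -> 0 <= K -> exists2 C : R, 0 < C &
  forall (P : probability T R) n, martingale_laws d lam rho P -> (0 < n)%N ->
  (P [set w : T | (enorm (partial_sum n w) <= K)%R] <= (C / n%:R `^ al)%:E)%E.
Proof.
move=> al0 K0; have [c c0 hc] := barrier_min (sqr_ge0 K).
have [t01 Vp hM _ _] := hV.
have t0p : 0 < t0 by exact: lt_le_trans t01.
have M0 : 0 < M.
  have := lt_le_trans (Vp t0 0 (lexx _) (lexx _)) (hM t0 (lexx _)).
  by rewrite pmulr_lgt0// powR_gt0.
exists (M / c); first by rewrite divr_gt0.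
move=> P n hP n0; pose f (w : T) := V t0 (dotv (partial_sum n w) (partial_sum n w)).
pose idx (w : T) : bool := enorm (partial_sum n w) <= K.
have np : 0 < n%:R :> R by rewrite ltr0n.
have mI b : measurable [set w : T | idx w = b].
  have me : measurable_fun setT idx.
    rewrite (_ : idx = fun w => dotv (partial_sum n w) (partial_sum n w) <= K ^+ 2); last first.
      by apply/funext => w; rewrite /idx -enorm_sqr ler_pXn2r ?nnegrE ?enorm_ge0.
    by apply: measurable_fun_ler => //; exact: measurable_partial_sqn.
  by rewrite -[X in measurable X]setTI; exact: (me measurableT [set b]).
have If : P.-integrable setT (EFin \o f) by exact: (V_partial_integrable hP hrho hV).
have := barrier_iter n hP (lexx t0); rewrite -/f (Rintegral_partition mI If) big_bool/=.
set A := [set w : T | idx w = true].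
have mA : measurable A by exact: mI.
have IA : P.-integrable A (EFin \o f) by apply: integrableS If.
have h1 : c * fine (P A) <= \int[P]_(w in A) f w.
  rewrite -Rintegral_cst//; apply: ae_le_Rintegral => //; first exact: integrable_cst.
  apply: aeW => w Aw; apply: hc; rewrite dotv_ge0/= -enorm_sqr.
  by rewrite lerXn2r ?nnegrE ?enorm_ge0.
have h2 : 0 <= \int[P]_(w in [set w : T | idx w = false]) f w.
  by apply: Rintegral_ge0 => w _; apply/ltW/Vp => //; exact: dotv_ge0.
have tn : t0 <= t0 + n%:R by rewrite lerDl.
have := hM (t0 + n%:R) tn => h3 h4.
have pA : fine (P A) <= M / c * (t0 + n%:R) `^ (- al).
  by rewrite mulrAC ler_pdivlMr// mulrC; lra.
rewrite -(fineK (_ : P A \is a fin_num)) ?fin_num_measure// lee_fin.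
apply: le_trans pA _; apply: ler_wpM2l; first by rewrite ltW ?divr_gt0.
rewrite powRN lef_pV2 ?posrE ?powR_gt0//; last by rewrite addr_gt0.
by apply: ge0_ler_powR; rewrite ?nnegrE ?ler0n ?addr_ge0 ?lerDr// ltW.
Qed.
End upper_bound_final.

(** * Uniform digits *)

Section digits.
Context {R : realType}.
Variable K : nat.
Hypothesis K0 : (0 < K)%N.

(* The base-[K] expansion of [u] up to order [n], read as an integer; reducing
   modulo [K ^ n] only matters outside of [0, 1[. *)
Definition digits (n : nat) (u : R) : nat := (Num.truncn (u * (K ^ n)%:R) %% K ^ n)%N.

Lemma digits_lt n u : (digits n u < K ^ n)%N.
Proof. by rewrite ltn_mod expn_gt0 K0. Qed.

Lemma truncn_divn (x : R) : (Num.truncn (x * K%:R) %/ K)%N = Num.truncn x.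
Proof.
have Kp : 0 < K%:R :> R by rewrite ltr0n.
have [x0|x0] := ltP x 0.
  have -> : Num.truncn x = 0%N by apply/truncn0Pn; rewrite -ltNge (lt_trans x0).
  have -> : Num.truncn (x * K%:R) = 0%N; last by rewrite div0n.
  by apply/truncn0Pn; rewrite -ltNge (lt_trans _ ltr01)// pmulr_llt0.
have xK : 0 <= x * K%:R by rewrite mulr_ge0.
apply/esym/truncn_def/andP; split.
  have := leq_divM (Num.truncn (x * K%:R)) K.
  by rewrite (truncn_ge_nat _ xK) natrM ler_pM2r.
have : (Num.truncn (x * K%:R) < (Num.truncn (x * K%:R) %/ K).+1 * K)%N by rewrite ltn_ceil.
by rewrite (truncn_lt_nat _ xK) natrM ltr_pM2r.
Qed.

Lemma digits_divn n u : (digits n.+1 u %/ K)%N = digits n u.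
Proof. by rewrite /digits expnSr -modn_divl natrM mulrA truncn_divn. Qed.

Lemma measurable_digits n j : measurable [set u : R | digits n u = j].
Proof.
have ma : measurable_fun setT (fun u : R => u * (K ^ n)%:R) by apply: measurable_funM.
rewrite (_ : [set u | digits n u = j] = (fun u : R => u * (K ^ n)%:R) @^-1`
    (\bigcup_(m in [set m | (m %% K ^ n)%N = j]) [set y : R | Num.truncn y = m])).
  rewrite -[X in measurable X]setTI; apply: ma => //.
  by apply: bigcup_measurable => m _; exact: measurable_truncn_eq.
apply/seteqP; split => x /=; first by move=> hx; exists (Num.truncn (x * (K ^ n)%:R)).
by move=> [m /= <- <-].
Qed.

Let Q : probability (measurableTypeR R) R := uniform_prob (@ltr01 R).

Lemma uniform_prob_itv (a b : R) : 0 <= a -> a <= b -> b <= 1 -> Q `[a, b[%classic = (b - a)%:E.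
Proof.
move=> a0 ab b1; rewrite /Q/= /uniform_prob.
rewrite (eq_integral (cst 1%E)); last first.
  move=> x; rewrite inE/= in_itv/= => /andP[ax xb]; rewrite /uniform_pdf.
  by rewrite (le_trans a0 ax) (le_trans (ltW xb) b1)/= subr0 invr1.
rewrite integral_cst//= mul1e.
rewrite [LHS](lebesgue_measure_itv `[a, b[)/= lte_fin.
by case: ltP => // ba; rewrite (_ : b - a = 0)//; lra.
Qed.

(** Each level set contains an interval of length 1/K^n in [[0, 1]], which gives a lower bound.
    These bounds already add up to 1, so all of them are equalities, and the level sets need not be
    described exactly. *)
Lemma digits_prob n j : (j < K ^ n)%N -> Q [set u | digits n u = j] = ((K ^ n)%:R^-1)%:E.
Proof.
set m := (K ^ n)%N; move=> jm.
have m0 : (0 < m)%N by rewrite expn_gt0 K0.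
have mp : 0 < m%:R :> R by rewrite ltr0n.
pose p (i : 'I_m) := fine (Q [set u | digits n u = i]).
have pE (i : 'I_m) : Q [set u | digits n u = i] = (p i)%:E.
  by rewrite fineK// fin_num_measure//; exact: measurable_digits.
have ge (i : 'I_m) : m%:R^-1 <= p i.
  rewrite -lee_fin -pE.
  have i1 : (i%:R + 1) / m%:R <= 1 :> R by rewrite ler_pdivrMr// mul1r natr1 ler_nat.
  have i0 : 0 <= i%:R / m%:R :> R by rewrite divr_ge0.
  have -> : m%:R^-1 = (i%:R + 1) / m%:R - i%:R / m%:R :> R by rewrite mulrDl mul1r; ring.
  have ii : i%:R / m%:R <= (i%:R + 1) / m%:R :> R by rewrite ler_pM2r ?invr_gt0// lerDl.
  rewrite -(uniform_prob_itv i0 ii i1).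
  apply: le_measure; rewrite ?inE//; first exact: measurable_digits.
  move=> u /=; rewrite in_itv/= ler_pdivrMr// ltr_pdivlMr// natr1 => h.
  by rewrite /digits (truncn_def h) modn_small.
have sp : \sum_(i < m) p i = 1.
  pose idx (u : R) : 'I_m := Ordinal (digits_lt n u).
  have mI (i : 'I_m) : measurable [set u : R | idx u = i].
    rewrite (_ : [set u | idx u = i] = [set u | digits n u = i]); first exact: measurable_digits.
    by apply/seteqP; split => u /=; [move=> <-|move=> h; exact/val_inj].
  have := @Rintegral_partition _ _ R Q _ idx (fun=> 1) mI (integrable_cst Q 1 measurableT).
  rewrite Rintegral_cst//; have -> : fine (Q setT) = 1 by rewrite probability_setT.
  rewrite mulr1 => ->; apply: eq_bigr => i _.
  have := Rintegral_cst Q (mI i) 1 => ->; rewrite mul1r /p.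
  congr (fine (Q _)); apply/seteqP; split => u /=; first by move=> h; exact/val_inj.
  by move=> <-.
have s0 : \sum_(i < m) (p i - m%:R^-1) = 0.
  by rewrite sumrB sp sumr_const card_ord -[X in _ - X]mulr_natl divff ?subrr// gt_eqF.
have := pE (Ordinal jm) => /= ->; congr (_%:E); apply/eqP; rewrite -subr_eq0.
move/eqP : s0; rewrite psumr_eq0; last by move=> i _; rewrite subr_ge0.
by move/allP/(_ (Ordinal jm) (mem_index_enum _)).
Qed.

End digits.

Lemma sum_divn (V : zmodType) (K m : nat) (F : nat -> V) :
  \sum_(0 <= j < m * K) F j = \sum_(0 <= j < m) \sum_(0 <= x < K) F (j * K + x)%N.
Proof.
elim: m => [|m IH]; first by rewrite mul0n !big_nil.
rewrite big_nat_recr//= -IH mulSnr (@big_cat_nat _ _ _ (m * K)%N)//= ?leq_addr//.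
congr (_ + _); rewrite -{1}[(m * K)%N]add0n big_addn addnC addnK.
by apply: eq_bigr => x _; rewrite addnC.
Qed.

(** [N n u] codes the first [n] digits and division by [K] forgets the last one; uniformity at every
    order makes each new digit uniform given the previous ones. *)
Definition uniform_digits (R : realType) (disp : measure_display) (Om : measurableType disp)
    (Q : probability Om R) (K : nat) (N : nat -> Om -> nat) : Prop :=
  [/\ (forall n u, (N n u < K ^ n)%N), (forall n u, (N n.+1 u %/ K)%N = N n u),
      (forall n j, measurable [set u | N n u = j]) &
      forall n j, (j < K ^ n)%N -> Q [set u | N n u = j] = ((K ^ n)%:R^-1)%:E].

Lemma uniform_digits_ex (R : realType) (K : nat) : (0 < K)%N ->
  exists (Q : probability (measurableTypeR R) R) (N : nat -> R -> nat), uniform_digits Q K N.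
Proof.
move=> K0; exists (uniform_prob (@ltr01 R)), (@digits R K); split.
- exact: digits_lt.
- exact: digits_divn.
- exact: measurable_digits.
- exact: digits_prob.
Qed.

(** * Integrals of functions of finitely many digits *)

Section digit_integrals.
Context {R : realType} {disp : measure_display} {Om : measurableType disp}.
Variables (Q : probability Om R) (K : nat) (N : nat -> Om -> nat).
Hypotheses (K0 : (0 < K)%N) (hN : uniform_digits Q K N).

Lemma digits_preimage n (B : set nat) : measurable [set u | B (N n u)].
Proof.
have [_ _ mN _] := hN.
rewrite (_ : [set u | B (N n u)] = \bigcup_(j in B) [set u | N n u = j]).
  by apply: bigcup_measurable => j _; exact: mN.
by apply/seteqP; split => u /=; [move=> h; exists (N n u)|move=> [j Bj /= ->]].
Qed.

Lemma digits_fun_measurable n (g : nat -> R) : measurable_fun setT (fun u => g (N n u)).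
Proof. by move=> _ B mB; rewrite setTI; exact: (digits_preimage n (g @^-1` B)). Qed.

Lemma digits_integrable n (g : nat -> R) (A : set Om) : measurable A ->
  Q.-integrable A (EFin \o (fun u => g (N n u))).
Proof.
move=> mA; have [hlt _ _ _] := hN.
apply: (@ae_bounded_integrable _ _ _ _ _ _ (\sum_(j < K ^ n) `|g j|)) => //.
  by apply: measurable_funTS; exact: digits_fun_measurable.
apply: aeW => u _; rewrite (bigD1 (Ordinal (hlt n u)))//= lerDl.
exact: sumr_ge0.
Qed.

Lemma digits_Rintegral n (g : nat -> R) :
  \int[Q]_u g (N n u) = (K ^ n)%:R^-1 * \sum_(0 <= j < K ^ n) g j.
Proof.
have [hlt _ mN hQ] := hN; pose idx u : 'I_(K ^ n) := Ordinal (hlt n u).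
have iE (j : 'I_(K ^ n)) : [set u | idx u = j] = [set u | N n u = j].
  by apply/seteqP; split => u /=; [move=> <-|move=> h; exact/val_inj].
have mI (j : 'I_(K ^ n)) : measurable [set u | idx u = j] by rewrite iE.
rewrite (Rintegral_partition mI (digits_integrable n g measurableT)).
rewrite big_mkord mulr_sumr; apply: eq_bigr => j _.
rewrite (@eq_Rintegral _ _ _ _ _ (cst (g j))); last by move=> u; rewrite inE/= => <-.
have hq : fine (Q [set u | idx u = j]) = (K ^ n)%:R^-1 by rewrite iE (hQ n j (ltn_ord j)).
by rewrite (Rintegral_cst Q (mI j)) hq mulrC.
Qed.

(** Each value of [N n] corresponds to a block of [K] consecutive, equally likely values of
    [N n.+1]; equal sums over the blocks give equal integrals over every event decided by [N n]. *)
Lemma digits_cond_Rintegral n (B : set nat) (g1 g2 : nat -> R) :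
  (forall j, \sum_(0 <= x < K) g1 (j * K + x)%N = \sum_(0 <= x < K) g2 (j * K + x)%N) ->
  \int[Q]_(u in [set u | B (N n u)]) g1 (N n.+1 u) =
  \int[Q]_(u in [set u | B (N n u)]) g2 (N n.+1 u).
Proof.
have [_ hdiv _ _] := hN; move=> h.
have e (g : nat -> R) : \int[Q]_(u in [set u | B (N n u)]) g (N n.+1 u) =
    \int[Q]_u (if `[< B (N n.+1 u %/ K)%N >] then g (N n.+1 u) else 0).
  rewrite Rintegral_mkcond; apply: eq_Rintegral => u _; rewrite patchE hdiv.
  have -> // : (u \in [set u | B (N n u)]) = `[< B (N n u) >].
  by apply/idP/asboolP; rewrite inE.
rewrite !e !(digits_Rintegral n.+1 (fun j => if `[< B (j %/ K)%N >] then _ j else 0)) expnSr !sum_divn.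
congr (_ * _); apply: eq_bigr => j _.
have s (g : nat -> R) : \sum_(0 <= x < K) (if `[< B ((j * K + x) %/ K)%N >] then g (j * K + x)%N else 0) =
    (if `[< B j >] then \sum_(0 <= x < K) g (j * K + x)%N else 0).
  rewrite (eq_big_nat _ _ (F2 := fun x => if `[< B j >] then g (j * K + x)%N else 0)).
    by case: ifP => // _; rewrite big1.
  by move=> x /andP[_ xK]; rewrite divnMDl// divn_small// addn0.
by rewrite !s h.
Qed.

End digit_integrals.

(** * Lower bound *)

(** An event of the past depends on the first [i] increments only. The induction on the generated
    sigma-algebra needs an equivalence, since complements exchange the two directions. *)
Lemma past_congr (R : realType) (d i : nat) (A : set (seq_space R d)) (w w' : seq_space R d) :
  natural_filtration i A -> (forall l, (l < i)%N -> w l = w' l) -> A w -> A w'.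
Proof.
move=> hA; have hc : forall w w' : seq_space R d,
    (forall l, (l < i)%N -> w l = w' l) -> A w <-> A w'.
  move: A hA; apply: smallest_sub; last first.
    move=> A; rewrite -(bigcup_mkord i (fun l => preimage_set_system setT (@incr R d l) measurable)).
    move=> -[l li [B mB <-]] {}w {}w' e; rewrite !setTI.
    by rewrite /preimage/= /incr e.
  split.
  - by [].
  - move=> A hA w0 w1 e; have [h1 h2] := hA _ _ e.
    by split=> -[_ h]; split=> // h'; apply: h; [exact: h2|exact: h1].
  - move=> F hF w0 w1 e; split => -[k _ Fk]; exists k => //; have [h1 h2] := hF k _ _ e; [exact: h1|exact: h2].
by move=> e; apply (hc w w' e).
Qed.

(** * The walk driven by the digits *)

Section walk.
Context {R : realType} {d : nat} {disp : measure_display} {Om : measurableType disp}.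
Variables (Q : probability Om R) (K : nat) (N : nat -> Om -> nat).
Hypotheses (K0 : (0 < K)%N) (hN : uniform_digits Q K N).
Variable step : nat -> 'rV[R]_d -> nat -> 'rV[R]_d.
Let T := seq_space R d.

(** [j] is read in base [K] with the most recent digit last: [j %% K] chooses the last step and
    [j %/ K] codes the earlier ones. *)
Fixpoint walk (i j : nat) : 'rV[R]_d :=
  if i is i'.+1 then walk i' (j %/ K)%N + step i' (walk i' (j %/ K)%N) (j %% K)%N else 0.

Definition walk_incr (i j : nat) : 'rV[R]_d := step i (walk i (j %/ K)%N) (j %% K)%N.

Definition walk_path (u : Om) : T := fun i => walk_incr i (N i.+1 u).

Lemma partial_sum_walk i u : partial_sum i (walk_path u) = walk i (N i u).
Proof.
have [_ hdiv _ _] := hN.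
elim: i => [|i IH]; first by rewrite /partial_sum big_ord0.
by rewrite partial_sumS IH /walk_path /walk_incr/= hdiv.
Qed.

Lemma digits_eq i l u u' : (l <= i)%N -> N i u = N i u' -> N l u = N l u'.
Proof.
have [_ hdiv _ _] := hN; move=> /subnKC <-; elim: (i - l)%N => [|m IH]; first by rewrite addn0.
by rewrite addnS => h; apply: IH; rewrite -(hdiv _ u) -(hdiv _ u') h.
Qed.

Lemma measurable_walk_path : measurable_fun setT (walk_path : Om -> T).
Proof.
apply: (@measurability _ _ Om T setT walk_path (@cylinders R d)) => //.
move=> _ [_ [i _ [B mB <-]] <-]; rewrite !setTI.
exact: (digits_preimage hN i.+1 [set j | B (walk_incr i j)]).
Qed.

Definition walk_law : probability T R := distribution Q (mfun_Sub (mem_set measurable_walk_path)).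

Lemma walk_lawE (A : set T) : walk_law A = Q (walk_path @^-1` A).
Proof. by []. Qed.

Lemma walk_integrable i (f : T -> R) (g : nat -> R) : measurable_fun setT f ->
  (forall u, f (walk_path u) = g (N i u)) -> walk_law.-integrable setT (EFin \o f).
Proof.
move=> mf hf; apply: (@integrable_pushforward _ _ Om T R walk_path measurable_walk_path Q setT (EFin \o f)) => //.
  exact/measurable_EFinP.
rewrite preimage_setT (_ : _ \o _ = EFin \o (fun u => g (N i u))); first exact: (digits_integrable hN).
by apply/funext => u /=; rewrite hf.
Qed.

Lemma walk_integral i (f : T -> R) (g : nat -> R) (A : set T) : measurable_fun setT f ->
  (forall u, f (walk_path u) = g (N i u)) -> measurable A ->
  (\int[walk_law]_(w in A) (f w)%:E = (\int[Q]_(u in walk_path @^-1` A) g (N i u))%:E)%E.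
Proof.
move=> mf hf mA.
have mA' : measurable (walk_path @^-1` A).
  by rewrite -[X in measurable X]setTI; exact: measurable_walk_path.
have e : (EFin \o f) \o walk_path = EFin \o (fun u => g (N i u)) by apply/funext => u /=; rewrite hf.
have I := digits_integrable hN i g mA'.
rewrite (@integral_pushforward _ _ _ _ _ _ measurable_walk_path Q A (EFin \o f)) ?e//.
  by rewrite /Rintegral fineK// integrable_fin_num.
exact/measurable_EFinP.
Qed.

(** Along the walk both functions depend on the first i + 1 digits. An event of the past leaves the
    last digit free, so it is enough to compare sums over that digit. *)
Lemma walk_cond_exp i (f Y : T -> R) (g1 g2 : nat -> R) : measurable_fun setT f ->
  (forall B, measurable B -> natural_filtration i (Y @^-1` B)) ->
  (forall u, f (walk_path u) = g1 (N i.+1 u)) -> (forall u, Y (walk_path u) = g2 (N i.+1 u)) ->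
  (forall j, \sum_(0 <= x < K) g1 (j * K + x)%N = \sum_(0 <= x < K) g2 (j * K + x)%N) ->
  cond_exp walk_law (natural_filtration i) f Y.
Proof.
move=> mf mY hf hY hg.
have mY' : measurable_fun setT Y.
  by move=> _ B mB; rewrite setTI; apply: (@past_measurable _ _ i); exact: mY.
split => //; [exact: walk_integrable mf hf|exact: walk_integrable mY' hY|].
move=> A hA; have mA := past_measurable hA.
rewrite (walk_integral mf hf mA) (walk_integral mY' hY mA); congr (_%:E).
(* The event is rewritten in terms of [N i]: it depends on the first [i] increments, and these on
   the first [i] digits. *)
pose B : set nat := [set j | exists2 u, N i u = j & A (walk_path u)].
have -> : walk_path @^-1` A = [set u | B (N i u)].
  apply/seteqP; split => u /=; first by move=> h; exists u.
  move=> [u' e h]; apply: (past_congr hA) h => l li.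
  by rewrite /walk_path (digits_eq li e).
exact/esym/(digits_cond_Rintegral K0 hN).
Qed.

Variables (lam rho : R) (q : nat -> 'rV[R]_d -> 'rV[R]_d -> R).
Hypothesis step0 : forall i x k, \sum_(0 <= z < K) step i x z 0 k = 0.
Hypothesis step_le : forall i x z, enorm (step i x z) <= rho.
Hypothesis stepq : forall i x v, \sum_(0 <= z < K) 2^-1 * dotv (step i x z) v ^+ 2 = K%:R * q i x v.
Hypothesis qc : forall i x, continuous (q i x).
Hypothesis mq : forall i v (B : set R), measurable B ->
  natural_filtration i ((fun w : T => q i (partial_sum i w) v) @^-1` B).
Hypothesis q_itv : forall i x v, enorm v = 1 -> lam <= q i x v <= 1.

Lemma walk_martingale : martingale_laws d lam rho walk_law.
Proof.
have [_ hdiv _ _] := hN.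
have incrE i j x : (x < K)%N -> walk_incr i (j * K + x)%N = step i (walk i j) x.
  by move=> xK; rewrite /walk_incr divnMDl// divn_small// addn0 modnMDl modn_small.
move=> i; split.
- move=> k; apply: (@walk_cond_exp i _ _ (fun j => walk_incr i j 0 k) (fun=> 0)) => //.
  + exact: measurable_entry.
  + by move=> B mB; rewrite past_measurableE -[X in measurable X]setTI; exact: measurable_cst.
  + move=> j; rewrite [RHS]big1// -[RHS](step0 i (walk i j) k).
    by apply: eq_big_nat => x /andP[_ xK]; rewrite incrE.
- have mw : measurable [set w : T | rho < enorm (w i)].
    have rho0 : 0 <= rho by exact: le_trans (enorm_ge0 _) (step_le 0 0 0).
    have mb : measurable_fun setT (fun w : T => rho ^+ 2 < dotv (w i) (w i)).
      apply: measurable_fun_ltr => //; apply: measurable_sum => k.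
      by apply: measurable_funM; exact: measurable_entry.
    have := mb measurableT [set true] I; rewrite setTI; congr measurable.
    apply/seteqP; split => w /=; rewrite -enorm_sqr ltr_pXn2r ?nnegrE ?enorm_ge0//.
  exists [set w : T | rho < enorm (w i)]; split => //.
    rewrite walk_lawE (_ : _ @^-1` _ = set0) ?measure0//.
    by apply/seteqP; split => // u /=; rewrite ltNge step_le.
  by move=> w /= /negP; rewrite -ltNge.
(* This version is a function of the current position, hence measurable for the past, and it is
   continuous in [v] along every path. *)
- exists (fun v w => q i (partial_sum i w) v); split.
  + move=> v; apply: (@walk_cond_exp i _ _ (fun j => 2^-1 * dotv (walk_incr i j) v ^+ 2)
      (fun j => q i (walk i (j %/ K)%N) v)).
    * apply: measurable_funM => //; apply: measurable_funX; apply: measurable_sum => k.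
      by apply: measurable_funM => //; exact: measurable_entry.
    * exact: mq.
    * by [].
    * by move=> u; rewrite partial_sum_walk hdiv.
    * move=> j; rewrite (eq_big_nat _ _ (F2 := fun x => 2^-1 * dotv (step i (walk i j) x) v ^+ 2)).
        rewrite stepq (eq_big_nat _ _ (F2 := fun=> q i (walk i j) v)).
          by rewrite big_const_nat subn0 iter_addr_0 mulr_natl.
        by move=> x /andP[_ xK]; rewrite divnMDl// divn_small// addn0.
      by move=> x /andP[_ xK]; rewrite incrE.
  + by move=> w; exact: qc.
  + apply: aeW => w; split.
      by apply: le_ereal_inf_tmp => _ [v v1 <-]; rewrite lee_fin; have /andP[] := q_itv i (partial_sum i w) v1.
    by apply: ge_ereal_sup => _ [v v1 <-]; rewrite lee_fin; have /andP[] := q_itv i (partial_sum i w) v1.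
Qed.

Lemma walk_prob n (r : R) : walk_law [set w : T | enorm (partial_sum n w) <= r] =
  ((K ^ n)%:R^-1 * \sum_(0 <= j < K ^ n) (enorm (walk n j) <= r)%R%:R)%:E.
Proof.
rewrite -(digits_Rintegral hN n (fun j => (enorm (walk n j) <= r)%R%:R)) walk_lawE.
have mS := digits_preimage hN n [set j | enorm (walk n j) <= r].
rewrite (_ : _ @^-1` _ = [set u | enorm (walk n (N n u)) <= r]); last first.
  by apply/seteqP; split => u /=; rewrite partial_sum_walk.
have := Rintegral_cst Q mS 1; rewrite mul1r Rintegral_mkcond => e.
rewrite -[LHS]fineK ?fin_num_measure//; congr (_%:E); rewrite -[LHS]e.
apply: eq_Rintegral => u _; rewrite patchE.
case: ifPn => [|]; first by rewrite inE/= => ->.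
by rewrite notin_setE/= => /negP/negbTE->.
Qed.

End walk.

(** * Diffusion matrices with prescribed radial variance *)

Section control.
Context {R : realType} {d : nat}.
Variable lam : R.
Hypothesis hlam : 0 < lam <= 1.
Implicit Types (x v : 'rV[R]_d) (a : R).

(* The image of the [k]-th basis vector under the square root of
   [lam I + (a - lam) x^T x / |x|^2]; the junk value [0^-1 = 0] makes this
   [lam I] for [x = 0]. *)
Definition dirv a x (k : 'I_d) : 'rV[R]_d :=
  Num.sqrt lam *: delta_mx 0 k + ((Num.sqrt a - Num.sqrt lam) * x 0 k / dotv x x) *: x.

Definition diffusion a x v : R := lam * dotv v v + (a - lam) * (dotv x v ^+ 2 / dotv x x).

Let lam0 : 0 <= lam. Proof. by have /andP[/ltW] := hlam. Qed.

Lemma dotv_dirv a x k v : dotv (dirv a x k) v =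
  Num.sqrt lam * v 0 k + (Num.sqrt a - Num.sqrt lam) * x 0 k / dotv x x * dotv x v.
Proof. by rewrite /dirv dotvDl !dotvZl (dotvC (delta_mx 0 k)) dotv_delta. Qed.

Lemma dotv0l v : dotv 0 v = 0.
Proof. by rewrite /dotv big1// => k _; rewrite mxE mul0r. Qed.

Lemma dotv_dirv_self a x k : dotv (dirv a x k) x = Num.sqrt a * x 0 k.
Proof.
rewrite dotv_dirv; have [x0|x0] := eqVneq (dotv x x) 0; last by field.
by rewrite (dotv0_eq0 x0) mxE !(mulr0, mul0r) addr0.
Qed.

Lemma sum_dirv_sqr a x v : 0 <= a -> \sum_(k < d) dotv (dirv a x k) v ^+ 2 = diffusion a x v.
Proof.
move=> a0; rewrite /diffusion.
pose b := (Num.sqrt a - Num.sqrt lam) / dotv x x * dotv x v.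
have -> : \sum_(k < d) dotv (dirv a x k) v ^+ 2 = \sum_(k < d) (Num.sqrt lam * v 0 k + b * x 0 k) ^+ 2.
  by apply: eq_bigr => k _; rewrite dotv_dirv /b; congr (_ ^+ 2); ring.
have -> : \sum_(k < d) (Num.sqrt lam * v 0 k + b * x 0 k) ^+ 2 = 
   Num.sqrt lam ^+ 2 * dotv v v + 2 * Num.sqrt lam * b * dotv x v + b ^+ 2 * dotv x x.
  rewrite /dotv !mulr_sumr -!big_split/=; apply: eq_bigr => k _; ring.
have e1 := sqr_sqrtr a0; have e2 := sqr_sqrtr lam0.
rewrite e2 -addrA; congr (_ + _).
have -> : a - lam = Num.sqrt a ^+ 2 - Num.sqrt lam ^+ 2 by rewrite e1 e2.
have [x0|x0] := eqVneq (dotv x x) 0; last by rewrite /b; field.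
by rewrite /b (dotv0_eq0 x0) !dotv0l invr0 !(mulr0, mul0r, addr0).
Qed.

Lemma dotv_dirv_dirv a x k : 0 <= a ->
  dotv (dirv a x k) (dirv a x k) = lam + (a - lam) * (x 0 k ^+ 2 / dotv x x).
Proof.
move=> a0; rewrite dotv_dirv (dotvC x) dotv_dirv_self.
have -> : dirv a x k 0 k = Num.sqrt lam + (Num.sqrt a - Num.sqrt lam) * x 0 k / dotv x x * x 0 k.
  by rewrite /dirv !mxE !eqxx mulr1.
transitivity (Num.sqrt lam ^+ 2 + (Num.sqrt a ^+ 2 - Num.sqrt lam ^+ 2) * (x 0 k ^+ 2 / dotv x x)).
  by ring.
by rewrite !sqr_sqrtr.
Qed.

Lemma dirv_le a x k : lam <= a <= 1 -> dotv (dirv a x k) (dirv a x k) <= 1.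
Proof.
move=> /andP[la a1]; have a0 := le_trans lam0 la.
rewrite dotv_dirv_dirv//.
have r1 : x 0 k ^+ 2 / dotv x x <= 1.
  have [x0|x0] := eqVneq (dotv x x) 0; first by rewrite x0 invr0 mulr0.
  rewrite ler_pdivrMr ?mul1r; last by rewrite lt_neqAle eq_sym x0 dotv_ge0.
  by rewrite -enorm_sqr -[X in X <= _]real_normK ?num_real// lerXn2r ?nnegrE ?enorm_ge0// entry_le_enorm.
have al0 : 0 <= a - lam by rewrite subr_ge0.
by have := ler_wpM2l al0 r1; lra.
Qed.

(** The sum is the trace of the diffusion matrix; at [x = 0] its rank-one part disappears, hence the
    condition on [a] there. *)
Lemma sum_dotv_dirv a x : 0 <= a -> (x = 0 -> a = lam) ->
  \sum_(k < d) dotv (dirv a x k) (dirv a x k) = lam * (d%:R - 1) + a.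
Proof.
move=> a0 ha; under eq_bigr do rewrite dotv_dirv_dirv//.
rewrite big_split/= sumr_const card_ord -mulr_sumr -mulr_suml.
have -> : \sum_(k < d) x 0 k ^+ 2 = dotv x x by apply: eq_bigr => k _; rewrite expr2.
rewrite -mulr_natr.
have [x0|x0] := eqVneq (dotv x x) 0; last by rewrite divff//; ring.
by rewrite (ha (dotv0_eq0 x0)); ring.
Qed.

Lemma diffusion_continuous a x : continuous (diffusion a x).
Proof.
have dc (f g : 'rV[R]_d -> 'rV[R]_d) : (forall k, continuous (fun v => f v 0 k)) ->
    (forall k, continuous (fun v => g v 0 k)) -> continuous (fun v => dotv (f v) (g v)).
  move=> fc gc; apply: continuous_big => [|k _]; first exact: add_continuous.
  by move=> v; exact: (cvgM (fc k v) (gc k v)).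
have cc k : continuous (fun v : 'rV[R]_d => v 0 k) by exact: coord_continuous.
have xc := dc (fun=> x) id (fun k => cst_continuous (x := x 0 k)) cc.
have kc (c : R) : continuous (fun _ : 'rV[R]_d => c) by exact: cst_continuous.
have h1 : continuous (fun v : 'rV[R]_d => lam * dotv v v).
  by move=> v; exact: (cvgM (kc lam v) (dc id id cc cc v)).
have h2 : continuous (fun v : 'rV[R]_d => dotv x v ^+ 2).
  by move=> v; exact: (cvgM (xc v) (xc v)).
have h3 : continuous (fun v : 'rV[R]_d => (a - lam) * (dotv x v ^+ 2 / dotv x x)).
  by move=> v; exact: (cvgM (kc (a - lam) v) (cvgM (h2 v) (kc (dotv x x)^-1 v))).
by move=> v; exact: (cvgD (h1 v) (h3 v)).
Qed.

Lemma diffusion_past i (f : R -> R) v (B : set R) : measurable_fun setT f -> measurable B ->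
  natural_filtration i ((fun w : seq_space R d =>
    diffusion (f (dotv (partial_sum i w) (partial_sum i w))) (partial_sum i w) v) @^-1` B).
Proof.
move=> mf mB; rewrite past_measurableE -[X in measurable X]setTI.
pose past := g_sigma_algebraType (@past_gen R d i).
have mc := @past_partial_sum R d i.
have md (u : past -> 'rV[R]_d) : (forall k, measurable_fun setT (fun w => u w 0 k)) ->
    measurable_fun setT (fun w : past => dotv (partial_sum i w) (u w)).
  by move=> mu; apply: measurable_sum => k; apply: measurable_funM; [exact: mc|exact: mu].
have mn := md (partial_sum i) mc.
have mv : measurable_fun setT (fun w : past => dotv (partial_sum i w) v).
  by apply: md => k; exact: measurable_cst.
suff mF : measurable_fun setT (fun w : past =>
    diffusion (f (dotv (partial_sum i w) (partial_sum i w))) (partial_sum i w) v) by exact: mF.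
apply: measurable_funD => //; apply: measurable_funM.
  by apply: measurable_funB => //; exact: (measurableT_comp mf mn).
apply: measurable_funM; first by apply: measurable_funX.
(* The inverse is written as a real power, which is measurable on the whole line and also vanishes
   at 0. *)
rewrite (_ : (fun w => _) = (fun w : past => (dotv (partial_sum i w) (partial_sum i w)) `^ (-1))).
  exact: (measurableT_comp (@measurable_powR R (-1)) mn).
by apply/funext => w; rewrite powR_inv1// dotv_ge0.
Qed.

Lemma diffusion_itv a x v : lam <= a <= 1 -> enorm v = 1 -> lam <= diffusion a x v <= 1.
Proof.
move=> /andP[a0 a1] v1; have vv : dotv v v = 1 by rewrite -enorm_sqr v1 expr1n.
have r0 : 0 <= dotv x v ^+ 2 / dotv x x by rewrite divr_ge0 ?sqr_ge0// dotv_ge0.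
have r1 : dotv x v ^+ 2 / dotv x x <= 1.
  have [x0|x0] := eqVneq (dotv x x) 0; first by rewrite x0 invr0 mulr0.
  rewrite ler_pdivrMr ?mul1r; last by rewrite lt_neqAle eq_sym x0 dotv_ge0.
  have := cauchy_schwarz x v; rewrite v1 mulr1 -enorm_sqr => h.
  by rewrite -[X in X <= _]real_normK ?num_real// lerXn2r ?nnegrE ?enorm_ge0.
rewrite /diffusion vv mulr1; move: r0 r1; set r := _ / _ => r0 r1.
have al0 : 0 <= a - lam by rewrite subr_ge0.
have m0 := mulr_ge0 al0 r0; have m1 := ler_wpM2l al0 r1.
by apply/andP; split; lra.
Qed.

End control.

(** * The controlled walk *)

Section controlled_walk.
Context {R : realType} {d : nat}.
Variables (lam : R) (pol : nat -> R -> R).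
Hypotheses (hlam : 0 < lam <= 1) (hd : (0 < d)%N).
Hypotheses (hpol : forall i n, lam <= pol i n <= 1) (mpol : forall i, measurable_fun setT (pol i)).
Let K := (d * 2)%N.
Let s : R := Num.sqrt (2 * d%:R).

(** The digit [z] encodes a coordinate, [z./2], and a sign, its parity. The factor sqrt (2 d)
    compensates the probability 1/d of a coordinate and the 1/2 of the ellipticity condition. The
    default 0 concerns z >= 2 d, which no digit reaches. *)
Definition cstep (i : nat) (x : 'rV[R]_d) (z : nat) : 'rV[R]_d :=
  if insub z./2 is Some k then ((-1) ^+ odd z * s) *: dirv lam (pol i (dotv x x)) x k else 0.

Let lam0 : 0 < lam. Proof. by have /andP[] := hlam. Qed.
Let pol0 i n : 0 <= pol i n. Proof. by have /andP[/(le_trans (ltW lam0))] := hpol i n. Qed.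
Let s2 : s ^+ 2 = 2 * d%:R. Proof. by rewrite sqr_sqrtr// mulr_ge0. Qed.
Let s0 : 0 <= s. Proof. exact: sqrtr_ge0. Qed.

Lemma cstepE i x (k : 'I_d) (b : bool) : cstep i x (k * 2 + b)%N =
  ((-1) ^+ b * s) *: dirv lam (pol i (dotv x x)) x k.
Proof.
rewrite /cstep (_ : (k * 2 + b)./2 = k); last by rewrite muln2 addnC half_bit_double.
rewrite (_ : odd (k * 2 + b) = b); last by rewrite muln2 addnC oddD odd_double addbF oddb.
by rewrite insubT// => hk; congr (_ *: dirv _ _ _ _); exact/val_inj.
Qed.

Lemma sum_cstep (V : zmodType) (G : 'rV[R]_d -> V) i x :
  \sum_(0 <= z < K) G (cstep i x z) =
  \sum_(k < d) (G (s *: dirv lam (pol i (dotv x x)) x k) + G (- s *: dirv lam (pol i (dotv x x)) x k)).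
Proof.
rewrite (sum_divn 2 d (fun z => G (cstep i x z))) big_mkord; apply: eq_bigr => k _.
by rewrite big_nat_recr//= big_nat1 (cstepE i x k false) (cstepE i x k true) mul1r mulN1r.
Qed.

Lemma cstep_le i x z : dotv (cstep i x z) (cstep i x z) <= 2 * d%:R.
Proof.
rewrite /cstep; case: insub => [k|]; last by rewrite dotv0l mulr_ge0.
rewrite dotvZl dotvC dotvZl mulrA -expr2 exprMn sqrr_sign mul1r s2.
by rewrite ler_piMr ?mulr_ge0// dirv_le.
Qed.

Lemma control_law (rho : R) : Num.sqrt (2 * d%:R) <= rho ->
  exists2 P : probability (seq_space R d) R, martingale_laws d lam rho P &
  forall n (r : R), P [set w | (enorm (partial_sum n w) <= r)%R] =
    ((K ^ n)%:R^-1 * \sum_(0 <= j < K ^ n) (enorm (walk K cstep n j) <= r)%R%:R)%:E.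
Proof.
move=> hr; have K0 : (0 < K)%N by rewrite muln_gt0 hd.
have [Q [N hN]] := @uniform_digits_ex R K K0.
exists (walk_law hN cstep); last by move=> n r; exact: walk_prob.
apply: (@walk_martingale _ _ _ _ _ _ _ K0 hN _ lam rho
  (fun i x v => diffusion lam (pol i (dotv x x)) x v)) => //.
- move=> i x k; rewrite (sum_cstep (fun u : 'rV[R]_d => u 0 k)) big1// => l _.
  by rewrite !mxE; ring.
- move=> i x z; apply: le_trans hr; rewrite ler_wsqrtr//; exact: cstep_le.
- move=> i x v; rewrite (sum_cstep (fun u => 2^-1 * dotv u v ^+ 2)) -sum_dirv_sqr//.
  rewrite mulr_sumr; apply: eq_bigr => k _; rewrite !dotvZl.
  by rewrite !exprMn sqrrN s2 natrM; field.
- by move=> i x; exact: diffusion_continuous.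
- by move=> i v B mB; exact: (@diffusion_past R d lam i (pol i) v B (mpol i) mB).
- by move=> i x v v1; exact: diffusion_itv.
Qed.

(** A submartingale inequality in finite terms: the mean of [phi i] over the equally likely
    positions at time [i] is nondecreasing in [i]. *)
Lemma value_iteration (phi : nat -> 'rV[R]_d -> R) (m n : nat) : (m <= n)%N ->
  (forall i x, (m <= i < n)%N ->
    K%:R * phi i x <= \sum_(0 <= z < K) phi i.+1 (x + cstep i x z)) ->
  (K ^ m)%:R^-1 * \sum_(0 <= j < K ^ m) phi m (walk K cstep m j) <=
  (K ^ n)%:R^-1 * \sum_(0 <= j < K ^ n) phi n (walk K cstep n j).
Proof.
have K0 : (0 < K)%N by rewrite muln_gt0 hd.
have Kp : 0 < K%:R :> R by rewrite ltr0n.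
move=> /subnKC <-; elim: (n - m)%N => [|l IH] h; first by rewrite addn0.
apply: le_trans (IH _) _.
  by move=> i x /andP[h1 h2]; apply: h; rewrite h1 addnS ltnS ltnW.
rewrite addnS; set i := (m + l)%N.
have Ki : 0 < (K ^ i)%:R :> R by rewrite ltr0n expn_gt0 K0.
rewrite expnSr natrM invfM -mulrA ler_pM2l ?invr_gt0// ler_pdivlMl//.
rewrite sum_divn mulr_sumr; apply: ler_sum => j _.
apply: le_trans (h i (walk K cstep i j) _) _; first by rewrite leq_addr /= addnS ltnS.
rewrite le_eqVlt; apply/orP; left; apply/eqP; apply: eq_big_nat => z /andP[_ zK].
by rewrite /= divnMDl// divn_small// addn0 modnMDl modn_small.
Qed.

(** The two signs cancel the terms that are odd in the increment; summing over the coordinates turns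
    the others into the trace and the radial variance of the diffusion matrix. *)
Lemma lower_barrier_step (al rho t0 c M L t : R) (V act : R -> R -> R) i x :
  lower_barrier lam d%:R al rho t0 c M L V act -> Num.sqrt (2 * d%:R) <= rho -> t0 <= t ->
  pol i = act t ->
  K%:R * V (t + 1) (dotv x x) <=
    \sum_(0 <= z < K) V t (dotv (x + cstep i x z) (x + cstep i x z)).
Proof.
move=> [_ _ _ hact hG] hr ht pa; have [_ act0 _] := hact t ht.
have [G1 [G2 [E [h1 h2]]]] := hG t (enorm x) ht (enorm_ge0 _).
rewrite !enorm_sqr -pa in h1 h2; set a := pol i (dotv x x) in h2.
set Vx := V t (dotv x x) in h1 h2.
pose lo (u : 'rV[R]_d) := Vx + G1 * (2 * dotv x u + dotv u u) + G2 * dotv x u ^+ 2 - E.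
apply: (@le_trans _ _ (\sum_(0 <= z < K) lo (cstep i x z))); last first.
  apply: ler_sum => z _; rewrite dotv_sqrD /lo -[dotv (cstep _ _ _) (cstep _ _ _)]enorm_sqr.
  apply: h1; first exact: cauchy_schwarz.
  by rewrite enorm_ge0/=; apply: le_trans hr; rewrite ler_wsqrtr// cstep_le.
rewrite (sum_cstep lo) -/a.
have e (k : 'I_d) : lo (s *: dirv lam a x k) + lo (- s *: dirv lam a x k) =
    2 * (Vx - E) + 2 * G1 * (2 * d%:R) * dotv (dirv lam a x k) (dirv lam a x k)
    + 2 * G2 * (2 * d%:R) * a * (x 0 k * x 0 k).
  rewrite /lo !(dotvC x) !dotvZl !(dotvC _ (_ *: _)) !dotvZl dotv_dirv_self.
  have ea : Num.sqrt a ^+ 2 = a by rewrite sqr_sqrtr// pol0.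
  set D := dotv (dirv _ _ _ _) _.
  transitivity (2 * (Vx - E) + 2 * G1 * s ^+ 2 * D + 2 * G2 * s ^+ 2 * Num.sqrt a ^+ 2 * (x 0 k * x 0 k)).
    by ring.
  by rewrite ea s2.
under eq_bigr do rewrite e.
rewrite !big_split/= sumr_const card_ord -!mulr_sumr -/(dotv x x) sum_dotv_dirv//.
  rewrite -[X in _ <= X + _ + _]mulr_natr; apply: (@le_trans _ _ (K%:R * (Vx + 2 * G1 * (lam * (d%:R - 1) + a) + 2 * G2 * (a * dotv x x) - E))).
    exact: ler_wpM2l.
  by rewrite /K natrM le_eqVlt; apply/orP; left; apply/eqP; ring.
  exact: pol0.
by move=> x0; rewrite /a x0 dotv0l pa act0.
Qed.

(* With [a = 1], a step backwards along the coordinate where [|x 0 k|] is largest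
   changes [|x|^2] by at most [- 2 sqrt 2 |x| + 2 d]. *)
Lemma steering_step i x : pol i (dotv x x) = 1 -> exists2 z, (z < K)%N &
  dotv (x + cstep i x z) (x + cstep i x z) <= Num.max (dotv x x - 2 * d%:R) (2 * d%:R ^+ 2).
Proof.
move=> p1; have [k hk] : exists k, dotv x x <= d%:R * x 0 k ^+ 2.
  pose F k := x 0 k ^+ 2; have := @arg_maxP _ R _ (Ordinal hd) xpredT F isT.
  case=> k _ hk; exists k.
  rewrite mulr_natl -[X in _ *+ X]card_ord -sumr_const; apply: ler_sum => l _.
  by rewrite -expr2; exact: (hk l isT).
pose b := 0 <= x 0 k.
have bE : (-1) ^+ b * x 0 k = - `|x 0 k|.
  by rewrite /b; case: (leP 0 (x 0 k)) => h; rewrite ?expr1 ?mulN1r ?expr0 ?mul1r ?opprK// ?(ger0_norm h)// ltr0_norm ?opprK.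
exists (k * 2 + b)%N.
  by rewrite /K -ltn_divLR// divnMDl// divn_small ?addn0 ?ltn_ord//; case: b {bE}.
have h1 := cstep_le i x (k * 2 + b).
rewrite dotv_sqrD; move: h1; set D := dotv (cstep _ _ _) (cstep _ _ _) => h1.
have -> : dotv x (cstep i x (k * 2 + b)) = - (s * `|x 0 k|).
  by rewrite cstepE p1 dotvC dotvZl dotv_dirv_self sqrtr1 mul1r mulrAC bE mulNr mulrC.
set n := dotv x x in hk *; have n0 : 0 <= n by exact: dotv_ge0.
set y := s * `|x 0 k|.
have y0 : 0 <= y by rewrite mulr_ge0.
have y2 : 2 * n <= y ^+ 2 by rewrite exprMn s2 real_normK ?num_real// -mulrA ler_pM2l.
have d1 : 1 <= d%:R :> R by rewrite ler1n.
move: (d%:R : R) d1 h1 => e e1 h1; rewrite le_max.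
(* Far out, y >= 2 e and the new value is at most n - 2 e. Otherwise it is at most 2 e^2: directly
   for y >= 2 e, and for y < 2 e since n <= y^2 / 2 and y^2 / 2 - 2 y + 2 e is convex in y on
   [0, 2 e]. *)
have [ne|ne] := leP (2 * e ^+ 2) n; apply/orP; [left|right].
  have : 2 * e <= y.
    by rewrite -(@ler_pXn2r _ 2) ?nnegrE//; nra.
  by lra.
have [ye|ye] := leP (2 * e) y; first by lra.
have [e2|e2] := leP 2 e.
  have h2 : 0 <= (e - 2) * (2 * e - y) by apply: mulr_ge0; lra.
  have h3 : 0 <= y * (2 * e - y) by apply: mulr_ge0; lra.
  by rewrite !expr2 in y2 *; nra.
have h2 : 0 <= (2 - e) * y by apply: mulr_ge0; lra.
have h3 : 0 <= y * (2 * e - y) by apply: mulr_ge0; lra.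
have h4 : 0 <= e * (e - 1) by apply: mulr_ge0; lra.
by rewrite !expr2 in y2 *; nra.
Qed.

End controlled_walk.

(** At the final time the subsolution is at most [M] times the indicator of |x|^2 <= L. From such
    points a run of [T0] favourable digits leads to the ball, and such a run has the constant
    probability (2 d)^(- T0). *)
Lemma return_lower_bound (R : realType) (d : nat) (lam al rho t0 c M L : R) (V act : R -> R -> R) :
  0 < lam <= 1 -> (0 < d)%N -> 0 <= al -> Num.sqrt (2 * d%:R) <= rho ->
  lower_barrier lam d%:R al rho t0 c M L V act ->
  exists2 c' : R, 0 < c' & exists T0, forall n, (T0 <= n)%N ->
  exists2 P : probability (seq_space R d) R, martingale_laws d lam rho P &
    ((c' * (t0 + n%:R) `^ (- al))%:E <=
      P [set w | (enorm (partial_sum n w) <= Num.sqrt d%:R * rho)%R])%E.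
Proof.
move=> hlam hd al0 hr hV; have [[t01 c0 M0] hc hM hact _] := hV.
have K0 : (0 < d * 2)%N by rewrite muln_gt0 hd.
(* Each steering step lowers |x|^2 by 2 d or brings it to at most 2 d^2, so more than [L] steps are
   ample. *)
pose T0 := (Num.truncn L).+1.
have LT : L < T0%:R by exact: truncnS_gt.
have Kp m : 0 < ((d * 2) ^ m)%:R :> R by rewrite ltr0n expn_gt0 K0.
pose c1 := (M * ((d * 2) ^ T0)%:R)^-1.
have c10 : 0 < c1 by rewrite invr_gt0 mulr_gt0.
have d1 : 1 <= d%:R :> R by rewrite ler1n.
have l1 : lam <= 1 by have /andP[] := hlam.
exists (c * c1); first by rewrite mulr_gt0.
exists T0 => n Tn; pose m := (n - T0)%N.
have mn : (m <= n)%N by rewrite leq_subr.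
have nmT : (n - m)%N = T0 by rewrite subKn.
(* Before time [m] the barrier control is used with its clock running backwards: the step of index
   [i] leaves the time t0 + m - (i + 1). From [m] on the control is 1, as steering requires. *)
pose pol i := if (i < m)%N then act (t0 + (m - i.+1)%:R) else cst 1.
have ht k : t0 <= t0 + k%:R by rewrite lerDl.
have hpol i x : lam <= pol i x <= 1.
  rewrite /pol; case: ifP => _; last by rewrite /= l1 lexx.
  by have [h _ _] := hact _ (ht (m - i.+1)%N); exact: h.
have mpol i : measurable_fun setT (pol i).
  rewrite /pol; case: ifP => _; last exact: measurable_cst.
  by have [] := hact _ (ht (m - i.+1)%N).
have [P hP Pn] := control_law hlam hd hpol mpol hr.
exists P => //; rewrite Pn lee_fin.
set W := walk (d * 2) (cstep lam pol).
pose phi i (x : 'rV[R]_d) := V (t0 + (m - i)%:R) (dotv x x) * c1.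
(* A lower bound for the chance of ending in the ball: all remaining digits have to be favourable,
   and the admissible radius grows with the number of steps left. *)
pose psi i (x : 'rV[R]_d) : R := ((d * 2) ^ (n - i))%:R^-1 *
  (dotv x x <= 2 * d%:R ^+ 2 + 2 * d%:R * (n - i)%:R)%R%:R.
have s1 : c * c1 * (t0 + n%:R) `^ (- al) <= phi 0%N 0.
  rewrite /phi subn0 dotv0l mulrAC ler_pM2r//; apply: le_trans (hc _ (ht m)).
  rewrite ler_pM2l// !powRN lef_pV2 ?posrE ?powR_gt0 ?(lt_le_trans ltr01 (le_trans t01 (ht _)))//.
  apply: ge0_ler_powR; rewrite ?nnegrE ?(le_trans ler01 (le_trans t01 (ht _)))//.
  by rewrite lerD2l ler_nat.
have := @value_iteration R d lam pol hd phi 0 m (leq0n _).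
rewrite expn0 invr1 mul1r big_nat1 => s2.
apply: (le_trans s1); apply: le_trans (s2 _) _.
  move=> i x /andP[_ im]; rewrite /phi mulrA.
  rewrite -mulr_suml ler_pM2r//.
  have -> : t0 + (m - i)%:R = t0 + (m - i.+1)%:R + 1 by rewrite -addrA natr1 subnSK.
  have pe : pol i = act (t0 + (m - i.+1)%:R) by rewrite /pol im.
  exact: (lower_barrier_step hlam hpol x hV hr (ht _) pe).
have s3 x : phi m x <= psi m x.
  rewrite /phi /psi subnn addr0 nmT.
  have [h1 h2] := hM _ (dotv_ge0 x).
  case: (leP (dotv x x) (_ + _)) => [xL|xL] /=; rewrite ?mulr1 ?mulr0.
    by rewrite /c1 invfM mulrA ler_piMl ?invr_ge0// ler_pdivrMr// mul1r.
  rewrite pmulr_lle0// leNgt; apply/negP => /h2 xL'.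
  have h3 : T0%:R <= d%:R * T0%:R :> R by rewrite ler_peMl.
  have h4 : 0 <= d%:R ^+ 2 :> R by rewrite sqr_ge0.
  have h5 : 0 <= T0%:R :> R by [].
  by move: xL xL' LT h3 h4 h5; lra.
apply: (@le_trans _ _ (((d * 2) ^ m)%:R^-1 * \sum_(0 <= j < (d * 2) ^ m) psi m (W m j))).
  by rewrite ler_pM2l ?invr_gt0//; apply: ler_sum => j _; exact: s3.
have s4 := @value_iteration R d lam pol hd psi m n mn.
apply: le_trans (s4 _) _.
  move=> i x /andP[mi im]; rewrite /psi.
  have e : (n - i)%N = (n - i.+1).+1 by rewrite subnSK.
  set r := (n - i.+1)%N in e *; rewrite e expnS (natrM _ (d * 2) ((d * 2) ^ r)) invfM mulrA mulrA mulfV ?mul1r; last first.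
    by rewrite pnatr_eq0 -lt0n.
  case: (leP (dotv x x) (_ + _)) => [xL|xL] /=; last by rewrite mulr0 sumr_ge0// => z _; rewrite mulr_ge0 ?invr_ge0.
  have [z zK hz] := @steering_step R d lam pol hlam hd hpol i x (ltac:(by rewrite /pol ltnNge mi)).
  rewrite big_mkord (bigD1 (Ordinal zK))//= -[X in X <= _]addr0 lerD//; last first.
    by rewrite sumr_ge0// => z' _; rewrite mulr_ge0 ?invr_ge0.
  rewrite ler_pM2l ?invr_gt0//.
  suff -> : dotv (x + cstep lam pol i x z) (x + cstep lam pol i x z) <= 2 * d%:R ^+ 2 + 2 * d%:R * r%:R by [].
  apply: le_trans hz _; rewrite ge_max -/r; apply/andP; split.
    by move: xL; rewrite -[r.+1%:R]natr1; lra.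
  by rewrite lerDl !mulr_ge0.
(* The steered walk ends with |x|^2 <= 2 d^2, and 2 d^2 <= d rho^2 as rho >= sqrt (2 d). *)
have hh (y : 'rV[R]_d) : dotv y y <= 2 * d%:R ^+ 2 -> enorm y <= Num.sqrt d%:R * rho.
  move=> h; have rho0 : 0 <= rho by exact: le_trans (sqrtr_ge0 _) hr.
  rewrite -(@ler_pXn2r _ 2) ?nnegrE ?enorm_ge0 ?mulr_ge0 ?sqrtr_ge0// enorm_sqr.
  apply: le_trans h _; rewrite exprMn sqr_sqrtr// expr2 mulrCA ler_wpM2l//.
  rewrite -[X in X <= _](@sqr_sqrtr _ (2 * d%:R)) ?mulr_ge0//.
  by rewrite lerXn2r ?nnegrE ?sqrtr_ge0.
rewrite ler_pM2l ?invr_gt0//; apply: ler_sum => j _.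
rewrite /psi subnn expn0 invr1 mul1r mulr0 addr0 ler_nat -/W.
by case: (leP (dotv _ _)) => //= /hh ->.
Qed.

Theorem corollary1p1 (R : realType) (d : nat) (lambda : R)
    (hd : (1 <= d)%N) (hlambda : 0 < lambda <= 1) :
  exists2 alpha : R, 0 < alpha &
    forall rho : R, Num.sqrt (2 * d%:R) <= rho ->
      exists2 C : R, 1 <= C &
        \forall n \near \oo,
          ((1 / (C * n%:R `^ alpha))%:E
             <= ereal_sup
                  [set P [set w | (enorm (partial_sum n w)
                                     <= Num.sqrt d%:R * rho)%R]
                  | P in martingale_laws d lambda rho]
             <= (C / n%:R `^ alpha)%:E)%E.
Proof.
have d1 : 1 <= d%:R :> R by rewrite ler1n.
have [al al0 hal] := exponent_and_barriers hlambda d1.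
exists al => // rho hr.
have rho0 : 0 <= rho by exact: le_trans (sqrtr_ge0 _) hr.
have [[t0 [M [V hV]]] [s0 [c [M' [L [W [act hW]]]]]]] := hal rho rho0.
have K0 : 0 <= Num.sqrt d%:R * rho by rewrite mulr_ge0 ?sqrtr_ge0.
have [C1 C10 hC1] := return_upper_bound hlambda rho0 hd hV (ltW al0) K0.
have [c' c'0 [T0 hT0]] := return_lower_bound hlambda hd (ltW al0) hr hW.
have [[s01 _ _] _ _ _ _] := hW.
have sp : 0 < s0 + 1 by rewrite addr_gt0// (lt_le_trans ltr01 s01).
(* For n >= 1, s0 + n <= (s0 + 1) n; this removes the shift of time. *)
pose c2 := c' * (s0 + 1) `^ (- al).
have c20 : 0 < c2 by rewrite mulr_gt0// powR_gt0.
exists (1 + C1 + c2^-1); first by rewrite -addrA lerDl addr_ge0 ?invr_ge0// ltW.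
exists (maxn T0 1) => // n /=; rewrite geq_max => /andP[Tn n1].
have np : 0 < n%:R :> R by rewrite ltr0n.
have pp : 0 < n%:R `^ al by rewrite powR_gt0.
have i20 : 0 < c2^-1 by rewrite invr_gt0.
apply/andP; split; last first.
  apply: ge_ereal_sup => _ [P hP <-]; apply: le_trans (hC1 P n hP n1) _.
  rewrite lee_fin ler_pM2r ?invr_gt0//; move: C10 i20; lra.
have [P hP hn] := hT0 n Tn.
apply: (@le_trans _ _ (P [set w | (enorm (partial_sum n w) <= Num.sqrt d%:R * rho)%R])); last first.
  by apply: ereal_sup_ubound; exists P.
apply: le_trans hn; rewrite lee_fin.
have sn : 0 < s0 + n%:R by rewrite addr_gt0// (lt_le_trans ltr01 s01).
have le1 : c2 / n%:R `^ al <= c' * (s0 + n%:R) `^ (- al).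
  rewrite /c2 -mulrA ler_pM2l// !powRN -invfM -(powRM _ (ltW sp) (ltW np)).
  rewrite lef_pV2 ?posrE ?powR_gt0 ?mulr_gt0//.
  apply: ge0_ler_powR; rewrite ?nnegrE ?(ltW al0) ?(ltW sn) ?(ltW (mulr_gt0 sp np))//.
  have n1' : 1 <= n%:R :> R by rewrite ler1n.
  have := s01; nra.
apply: le_trans le1; rewrite mul1r invfM ler_pM2r ?invr_gt0//.
rewrite -[leRHS]invrK lef_pV2 ?posrE//; move: C10 i20; lra.
Qed.
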